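(* The solution operator $\mathcal S:H^1_0(\mathcal X_c)\to H^1(\mathbb L^2(\Omega))$, which maps $\ell$ to the unique reduced solution $\sigma$ of the state equation with respect to $u_D=\mathcal G\ell+\mathfrak a$, is weakly and strongly continuous, that is: (i) if $\ell_n\rightharpoonup\ell$ in $H^1_0(\mathcal X_c)$, then $\mathcal S(\ell_n)\rightharpoonup\mathcal S(\ell)$ in $H^1(\mathbb L^2(\Omega))$; (ii) if $\ell_n\to\ell$ in $H^1_0(\mathcal X_c)$, then $\mathcal S(\ell_n)\to\mathcal S(\ell)$ in $H^1(\mathbb L^2(\Omega))$.
   Context: Notation. $T>0$ is fixed; for a Banach space $X$, $L^2(X)=L^2(0,T;X)$, $H^1(X)=H^1(0,T;X)$; a dot denotes the time derivative; operators act pointwise in time. $\Omega\subset\mathbb R^d$, $d\ge2$, is a bounded domain with Lipschitz boundary $\Gamma$, the disjoint union of a relatively open part $\Gamma_N$ and a relatively closed part $\Gamma_D$ of positive surface measure; $\Omega\cup\Gamma_N$ is regular in the sense of Gröger (each $x\in\partial\Omega$ has a neighborhood $U$ and a bi-Lipschitz map $\Phi$ such that $\Phi(U\cap(\Omega\cup\Gamma_N))$ is one of $\{|y|<1,y_d<0\}$, $\{|y|<1,y_d\le0\}$, $\{|y|<1,y_d\le 0,\ (y_d<0\text{ or }y_1>0)\}$). $\mathbb R^{d\times d}_s$ is the space of symmetric matrices, $\mathbb L^2(\Omega)=L^2(\Omega;\mathbb R^{d\times d}_s)$, $\mathbf H^1(\Omega)=H^1(\Omega;\mathbb R^d)$;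 $\mathbf H^1_D(\Omega)$ is the closure in $\mathbf H^1(\Omega)$ of $\{\psi|_\Omega:\psi\in C_c^\infty(\mathbb R^d;\mathbb R^d),\ \mathrm{supp}\,\psi\cap\Gamma_D=\emptyset\}$. $\nabla^s=\frac12(\nabla+\nabla^\top)$. $\mathbb C$ is a symmetric coercive linear map on $\mathbb R^{d\times d}_s$, $\mathbb A=\mathbb C^{-1}$. Stresses. $\mathcal E(\Omega)=\{\tau\in\mathbb L^2(\Omega):(\tau,\nabla^s\varphi)_{\mathbb L^2(\Omega)}=0\ \forall\varphi\in\mathbf H^1_D(\Omega)\}$. For a fixed closed convex $K\subset\mathbb R^{d\times d}_s$, $\mathcal K(\Omega)=\{\tau\in\mathbb L^2(\Omega):\tau(x)\in K\text{ for a.a. }x\}$. The initial stress satisfies $\sigma_0\in\mathcal E(\Omega)\cap\mathcal K(\Omega)$ and $\sigma_0\in L^{\overline p}(\Omega;\mathbb R^{d\times d}_s)$ for some fixed $\overline p>2$. Reduced solution. $\sigma\in H^1(\mathbb L^2(\Omega))$ is a reduced solution of the state equation with respect to $u_D\in H^1(\mathbf H^1(\Omega))$ if $\sigma(0)=\sigma_0$ and, for a.a. $t\in(0,T)$, $\sigma(t)\in\mathcal E(\Omega)\cap\mathcal K(\Omega)$ and $(\mathbb A\dot\sigma(t)-\nabla^s\dot u_D(t),\tau-\sigma(t))_{\mathbb L^2(\Omega)}\ge0$ for all $\tau\in\mathcal E(\Omega)\cap\mathcal K(\Omega)$. (For every $u_D\in H^1(\mathbf H^1(\Omega))$ there is exactly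 one.) Controls. $\mathcal X$ is a real Banach space, $\mathcal X_c$ a Hilbert space compactly embedded in $\mathcal X$, $H^1_0(\mathcal X_c)=\{\ell\in H^1(\mathcal X_c):\ell(0)=\ell(T)=0\}$, $\mathcal G:\mathcal X\to\mathbf H^1(\Omega)$ is linear and continuous, and $\mathfrak a\in H^1(\mathbf H^1(\Omega))$ is fixed. *)

(* Defs.v *)
From HB Require Import structures.
From mathcomp Require Import all_boot all_order all_algebra.
From mathcomp Require Import all_classical all_reals all_analysis.

Set Implicit Arguments.
Unset Strict Implicit.
Unset Printing Implicit Defensive.

Import Order.TTheory GRing.Theory Num.Theory.
Import numFieldNormedType.Exports.

Local Open Scope classical_set_scope.
Local Open Scope ring_scope.

Section borel_matrix.
Variables (R : realType) (m n : nat).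

(* The product sigma-algebra, which is also the Borel sigma-algebra since R is
   second countable. *)
Definition mx_measurable : set (set 'M[R]_(m, n)) :=
  <<s [set A | exists (i : 'I_m) (j : 'I_n) (B : set R),
         measurable B /\ A = (fun M : 'M[R]_(m, n) => M i j) @^-1` B] >>.

Lemma mx_measurable0 : mx_measurable set0.
Proof. exact: sigma_algebra0. Qed.

Lemma mx_measurableC A : mx_measurable A -> mx_measurable (~` A).
Proof. exact: sigma_algebraC. Qed.

Lemma mx_measurable_bigcup (F : (set 'M[R]_(m, n))^nat) :
  (forall i, mx_measurable (F i)) -> mx_measurable (\bigcup_i F i).
Proof. exact: sigma_algebra_bigcup. Qed.

HB.instance Definition _ := @isMeasurable.Build default_measure_display
  'M[R]_(m, n) mx_measurable
  mx_measurable0 mx_measurableC mx_measurable_bigcup.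

Lemma measurable_mx_coord i j :
  measurable_fun [set: 'M[R]_(m, n)] (fun M : 'M[R]_(m, n) => M i j).
Proof.
move=> _ B mB; rewrite setTI; apply: sub_sigma_algebra.
by exists i, j, B.
Qed.

Lemma measurable_fun_mx d (T : measurableType d) (f : T -> 'M[R]_(m, n)) :
  (forall i j, measurable_fun [set: T] (fun x => f x i j)) ->
  measurable_fun [set: T] f.
Proof.
move=> mf; have mE : @measurable _ 'M[R]_(m, n) = mx_measurable by [].
by apply: (measurability _ mE) => _ [_ [i [j [B [mB ->]]]] <-]; exact: mf.
Qed.

End borel_matrix.

Section lebesgue_rV.
Variable R : realType.

Definition rV_cons n (p : (measurableTypeR R * 'rV[R]_n)%type) : 'rV[R]_n.+1 :=
  row_mx (p.1%:M : 'M[R]_1) p.2.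

Lemma measurable_rV_cons n :
  measurable_fun [set: (measurableTypeR R * 'rV[R]_n)%type] (@rV_cons n).
Proof.
apply: measurable_fun_mx => i j; rewrite /rV_cons.
case: (@splitP 1 n j) => k jk.
  rewrite (_ : (fun x => _) = fst); first exact: measurable_fst.
  apply/funext => x.
  have -> : j = lshift n k by apply/val_inj.
  by apply: etrans (row_mxEl _ _ _ _) _; rewrite !mxE !ord1 eqxx mulr1n.
rewrite (_ : (fun x => _) = (fun v : 'rV[R]_n => v i k) \o snd).
  apply: measurableT_comp; last exact: measurable_snd.
  exact: measurable_mx_coord.
apply/funext => x /=.
have -> : j = rshift 1 k by apply/val_inj.
exact: row_mxEr.
Qed.

Section cons_measure.
Variables (n : nat) (mu : {sigma_finite_measure set 'rV[R]_n -> \bar R}).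

Definition cons_measure : set 'rV[R]_n.+1 -> \bar R :=
  pushforward (@lebesgue_measure R \x mu)%E (@rV_cons n).

Let mcons := @measurable_rV_cons n.

Let cons_measure0 : cons_measure set0 = 0%E.
Proof. by rewrite /cons_measure (measure0 (pushforward _ _)). Qed.

Let cons_measure_ge0 A : (0 <= cons_measure A)%E.
Proof. exact: measure_ge0. Qed.

Let cons_measure_sigma_additive : semi_sigma_additive cons_measure.
Proof. exact: measure_semi_sigma_additive. Qed.

HB.instance Definition _ := isMeasure.Build _ _ _ cons_measure
  cons_measure0 cons_measure_ge0 cons_measure_sigma_additive.

Let cons_measure_sigma_finite : sigma_finite setT cons_measure.
Proof.
have /sigma_finiteP[F [TF ndF Foo]] := sigma_finiteT (@lebesgue_measure R).
have /sigma_finiteP[G [TG ndG Goo]] := sigma_finiteT mu.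
pose uncons (v : 'rV[R]_n.+1) : (measurableTypeR R * 'rV[R]_n)%type :=
  (lsubmx (v : 'rV[R]_(1 + n)) 0 0, rsubmx (v : 'rV[R]_(1 + n))).
have muncons : measurable_fun setT uncons.
  apply/measurable_fun_pairP; split => /=.
    rewrite (_ : _ \o _ = fun v : 'rV[R]_n.+1 => v 0 (lshift n 0 : 'I_(1 + n))).
      exact: measurable_mx_coord.
    by apply/funext => v /=; rewrite mxE.
  apply: measurable_fun_mx => i j.
  rewrite (_ : (fun _ => _) =
      fun v : 'rV[R]_n.+1 => v i (rshift 1 j : 'I_(1 + n))).
    exact: measurable_mx_coord.
  by apply/funext => v /=; rewrite mxE.
have consK : cancel (@rV_cons n) uncons.
  move=> [x v]; rewrite /uncons /rV_cons row_mxKl row_mxKr !mxE eqxx mulr1n.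
  by [].
exists (fun k => uncons @^-1` (F k `*` G k)).
  apply/seteqP; split => // v _.
  have [k _ Fk] : (\bigcup_k F k) (uncons v).1 by rewrite -TF.
  have [l _ Gl] : (\bigcup_k G k) (uncons v).2 by rewrite -TG.
  exists (maxn k l) => //; split.
  - by move: Fk; exact/subsetPset/ndF/leq_maxl.
  - by move: Gl; exact/subsetPset/ndG/leq_maxr.
move=> k; have [? ?] := Foo k; have [? ?] := Goo k; split.
  by rewrite -[X in measurable X]setTI; apply: muncons => //; exact: measurableX.
rewrite /cons_measure /pushforward -comp_preimage.
rewrite (_ : _ \o _ = id); last by apply/funext => x /=; rewrite consK.
by rewrite preimage_id product_measure1E// lte_mul_pinfty// ge0_fin_numE.
Qed.

HB.instance Definition _ := Measure_isSigmaFinite.Build _ _ _ cons_measure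
  cons_measure_sigma_finite.

End cons_measure.

Fixpoint lebesgue_rV n : {sigma_finite_measure set 'rV[R]_n -> \bar R} :=
  match n with
  | 0 => \d_(0 : 'rV[R]_0)
  | n'.+1 => cons_measure (lebesgue_rV n')
  end.

End lebesgue_rV.

(* A space whose elements are classes of functions modulo null sets is encoded
   by representatives: [dom] is the linear subspace of admissible
   representatives inside an ambient vector space, and [x], [y] in [dom] stand
   for the same element iff [sn (x - y) = 0]; accordingly linearity of maps
   between such spaces is only required up to [sn]. *)
Record snspace (R : realType) := SNSpace {
  amb :> lmodType R;
  dom : set amb;
  sn : amb -> R }.
Arguments dom {R} s _.
Arguments sn {R} s _.

Definition normed_snspace (R : realType) (V : normedModType R) : snspace R :=
  @SNSpace R V setT (fun x => `|x|).

Definition bounded_linear (R : realType) (V W : snspace R) (L : V -> W) :=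
  [/\ forall x, dom V x -> dom W (L x),
      forall (a : R) x y, dom V x -> dom V y ->
        sn W (L (a *: x + y) - (a *: L x + L y)) = 0 &
      exists C : R, forall x, dom V x -> sn W (L x) <= C * sn V x].

Definition strong_cvg (R : realType) (V : snspace R) (x_ : nat -> V) (x : V) :=
  (fun k => sn V (x_ k - x)) @ \oo --> (0 : R).

Definition weak_cvg (R : realType) (V : snspace R) (x_ : nat -> V) (x : V) :=
  forall phi : V -> R, @bounded_linear R V (normed_snspace R^o) phi ->
    (fun k => phi (x_ k)) @ \oo --> phi x.

Section bochner.
Variables (R : realType) (X : snspace R).
Local Notation mu := (@lebesgue_measure R).

Record simple_fun := SimpleFun {
  sf_card : nat;
  sf_set : 'I_sf_card -> set R;
  sf_val : 'I_sf_card -> X;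
  sf_meas : forall i, measurable (sf_set i);
  sf_dom : forall i, dom X (sf_val i) }.

Definition sf_eval (s : simple_fun) (t : R) : X :=
  \sum_i (\1_(@sf_set s i) t : R) *: sf_val i.

(* Meant for [D] of finite measure. *)
Definition sf_integral (D : set R) (s : simple_fun) : X :=
  \sum_i fine (mu (@sf_set s i `&` D)) *: sf_val i.

Definition strongly_measurable (D : set R) (g : R -> X) :=
  exists s : nat -> simple_fun, forall t, D t ->
    (fun k => sn X (sf_eval (s k) t - g t)) @ \oo --> (0 : R).

(* [v] is the Bochner integral over [D] of the strongly measurable [g]. *)
Definition bochner_integral (D : set R) (g : R -> X) (v : X) :=
  exists s : nat -> simple_fun,
    (fun k => \int[mu]_(t in D) (sn X (sf_eval (s k) t - g t))%:E)%E @ \oo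
      --> 0%E /\
    (fun k => sn X (sf_integral D (s k) - v)) @ \oo --> (0 : R).

Definition L2T (T : R) : snspace R :=
  @SNSpace R (R -> X)%type
    [set g | [/\ forall t, `[0, T]%classic t -> dom X (g t),
                 strongly_measurable `[0, T] g &
                 (\int[mu]_(t in `[0%R, T]) ((sn X (g t)) ^+ 2)%:E < +oo)%E]]
    (fun g => Num.sqrt (\int[mu]_(t in `[0, T]) (sn X (g t)) ^+ 2)).

(* An element of H^1(0,T;X) is the pair [(u, u')] of its absolutely continuous
   representative, so that [u t] makes sense for every t in [0,T], and its
   derivative [u'] in L^2(0,T;X), with u(t) - u(s) the integral of [u'] over
   [s,t]. *)
Definition H1T (T : R) : snspace R :=
  @SNSpace R ((R -> X) * (R -> X))%type
    [set u | [/\ dom (L2T T) u.2,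
                 forall t, `[0, T]%classic t -> dom X (u.1 t) &
                 forall s t, 0 <= s -> s <= t -> t <= T ->
                   bochner_integral `[s, t] u.2 (u.1 t - u.1 s)]]
    (fun u => Num.sqrt (sn (L2T T) u.1 ^+ 2 + sn (L2T T) u.2 ^+ 2)).

Definition H10T (T : R) : snspace R :=
  @SNSpace R (H1T T)
    (dom (H1T T) `&` [set u | sn X (u.1 0) = 0 /\ sn X (u.1 T) = 0])
    (sn (H1T T)).

End bochner.

Definition lift_time (R : realType) (V W : snspace R) (T : R) (L : V -> W)
    (u : H1T V T) : H1T W T :=
  (L \o u.1, L \o u.2).

Definition mxdot (R : realType) m n (A B : 'M[R]_(m, n)) : R :=
  \sum_i \sum_j A i j * B i j.

(* Euclidean (Frobenius) norm; the library norm on matrices is the max norm. *)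
Definition enorm (R : realType) m n (A : 'M[R]_(m, n)) : R :=
  Num.sqrt (mxdot A A).

Section sobolev.
Variables (R : realType) (d : nat) (Omega : set 'rV[R]_d).
Local Notation mu := (@lebesgue_rV R d).

Definition L2ip m n (f g : 'rV[R]_d -> 'M[R]_(m, n)) : R :=
  \int[mu]_(x in Omega) mxdot (f x) (g x).

Definition L2 m n : snspace R :=
  @SNSpace R ('rV[R]_d -> 'M[R]_(m, n))%type
    [set f | measurable_fun Omega f /\
             (\int[mu]_(x in Omega) (mxdot (f x) (f x))%:E < +oo)%E]
    (fun f => Num.sqrt (L2ip f f)).

Definition symmx : set 'M[R]_d := [set A | A^T = A].

Definition L2sym : snspace R :=
  @SNSpace R (L2 d d)
    (dom (L2 d d) `&` [set f | forall x, Omega x -> symmx (f x)])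
    (sn (L2 d d)).

Definition partial (j : 'I_d) (f : 'rV[R]_d -> R) : 'rV[R]_d -> R :=
  fun x => 'D_(delta_mx 0 j) f x.

Fixpoint Ck (k : nat) (f : 'rV[R]_d -> R) : Prop :=
  match k with
  | 0 => continuous f
  | k'.+1 => forall j, (forall x, derivable f x (delta_mx 0 j)) /\
                       Ck k' (partial j f)
  end.

Definition smooth (f : 'rV[R]_d -> R) := forall k, Ck k f.

Definition support (V : zmodType) (f : 'rV[R]_d -> V) : set 'rV[R]_d :=
  closure [set x | f x != 0].

Definition test_function (phi : 'rV[R]_d -> R) :=
  [/\ smooth phi, compact (support phi) & support phi `<=` Omega].

Definition weak_gradient (u : 'rV[R]_d -> 'rV[R]_d)
    (G : 'rV[R]_d -> 'M[R]_d) :=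
  forall phi, test_function phi -> forall i j : 'I_d,
    \int[mu]_(x in Omega) (u x 0 i * partial j phi x) =
    - \int[mu]_(x in Omega) (G x i j * phi x).

(* H^1(Omega; R^d) as the graph of the weak gradient: pairs [(u, grad u)] with
   [(grad u)_ij] the j-th partial derivative of [u_i]. *)
Definition H1 : snspace R :=
  @SNSpace R (L2 1 d * L2 d d)%type
    [set v | [/\ dom (L2 1 d) v.1, dom (L2 d d) v.2 &
                 weak_gradient v.1 v.2]]
    (fun v => Num.sqrt (sn (L2 1 d) v.1 ^+ 2 + sn (L2 d d) v.2 ^+ 2)).

Definition symgrad (v : H1) : L2sym :=
  fun x => 2^-1 *: (v.2 x + (v.2 x)^T).

Definition H1D (GammaD : set 'rV[R]_d) : set H1 :=
  [set v | dom H1 v /\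
    forall eps : R, 0 < eps ->
      exists (psi : 'rV[R]_d -> 'rV[R]_d) (w : H1),
        [/\ forall i, smooth (fun x => psi x 0 i),
            compact (support psi),
            support psi `&` GammaD = set0,
            dom H1 w /\ (forall x, Omega x -> w.1 x = psi x) &
            sn H1 (v - w) < eps]].

Definition boundary : set 'rV[R]_d := closure Omega `\` interior Omega.

(* Hausdorff measure of dimension [k >= 1], without normalization constant. *)
Definition ediam (U : set 'rV[R]_d) : \bar R :=
  ereal_sup ([set 0%E] `|`
    [set e | exists x y, [/\ U x, U y & e = (enorm (x - y))%:E]]).

Definition hausdorff_measure (k : nat) (A : set 'rV[R]_d) : \bar R :=
  ereal_sup [set h | exists2 delta : R, 0 < delta &
    h = ereal_inf [set s | exists U : nat -> set 'rV[R]_d,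
      [/\ A `<=` \bigcup_i U i,
          forall i, (ediam (U i) <= delta%:E)%E &
          s = (\sum_(0 <= i <oo) (ediam (U i)) ^+ k)%E]]].

End sobolev.
Arguments symgrad {R d} Omega v _.
Arguments H1D {R d} Omega GammaD _.

Section domain_regularity.
Variables (R : realType) (n : nat) (Omega : set 'rV[R]_n.+1).

(* Near each boundary point, and in suitable orthonormal coordinates, Omega is
   the set lying strictly below the graph of a Lipschitz function of the first
   n coordinates. *)
Definition lipschitz_boundary :=
  forall x, boundary Omega x ->
    exists (U : set 'rV[R]_n.+1) (Q : 'M[R]_n.+1) (gamma : 'rV[R]_n -> R),
      [/\ open U /\ U x, Q *m Q^T = 1%:M,
          exists L : R, forall y z,
            `|gamma y - gamma z| <= L * enorm (y - z) &
          forall y, U y ->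
            (Omega y <-> (y *m Q) 0 ord_max < gamma (col' ord_max (y *m Q)))].

Definition bilipschitz (U : set 'rV[R]_n.+1)
    (Phi : 'rV[R]_n.+1 -> 'rV[R]_n.+1) :=
  exists c L : R, 0 < c /\ forall y z, U y -> U z ->
    c * enorm (y - z) <= enorm (Phi y - Phi z) <= L * enorm (y - z).

Definition groeger_model1 : set 'rV[R]_n.+1 :=
  [set y | enorm y < 1 /\ y 0 ord_max < 0].
Definition groeger_model2 : set 'rV[R]_n.+1 :=
  [set y | enorm y < 1 /\ y 0 ord_max <= 0].
Definition groeger_model3 : set 'rV[R]_n.+1 :=
  [set y | [/\ enorm y < 1, y 0 ord_max <= 0 &
               y 0 ord_max < 0 \/ 0 < y 0 ord0]].

Definition groeger_regular (GammaN : set 'rV[R]_n.+1) :=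
  forall x, boundary Omega x ->
    exists (U : set 'rV[R]_n.+1) (Phi : 'rV[R]_n.+1 -> 'rV[R]_n.+1),
      [/\ open U, U x, bilipschitz U Phi &
          let I := Phi @` (U `&` (Omega `|` GammaN)) in
          [\/ I = groeger_model1, I = groeger_model2 | I = groeger_model3]].

End domain_regularity.

Section plasticity.
Variables (R : realType) (d : nat).

Definition elasticity_tensor (C : 'M[R]_d -> 'M[R]_d) :=
  [/\ forall s, symmx s -> symmx (C s),
      forall (a : R) s t, symmx s -> symmx t ->
        C (a *: s + t) = a *: C s + C t,
      forall s t, symmx s -> symmx t -> mxdot (C s) t = mxdot s (C t) &
      exists2 c : R, 0 < c &
        forall s, symmx s -> c * mxdot s s <= mxdot (C s) s].

Definition inverse_tensor (C A : 'M[R]_d -> 'M[R]_d) :=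
  forall s, symmx s -> [/\ symmx (A s), A (C s) = s & C (A s) = s].

Variables (T : R) (Omega GammaD : set 'rV[R]_d).

Definition equilibrium_stresses : set (L2sym Omega) :=
  [set tau | dom (L2sym Omega) tau /\
    forall phi, H1D Omega GammaD phi -> L2ip Omega tau (symgrad Omega phi) = 0].

Definition admissible_stresses (K : set 'M[R]_d) : set (L2sym Omega) :=
  [set tau | dom (L2sym Omega) tau /\
    {ae lebesgue_rV R d, forall x, Omega x -> K (tau x)}].

Definition reduced_solution (A : 'M[R]_d -> 'M[R]_d) (K : set 'M[R]_d)
    (sigma0 : L2sym Omega) (uD : H1T (H1 Omega) T)
    (sigma : H1T (L2sym Omega) T) :=
  let EK := equilibrium_stresses `&` admissible_stresses K in
  [/\ dom (H1T (L2sym Omega) T) sigma,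
      sn (L2sym Omega) (sigma.1 0 - sigma0) = 0 &
      {ae (@lebesgue_measure R), forall t, `]0, T[%classic t ->
         EK (sigma.1 t) /\
         forall tau, EK tau ->
           0 <= L2ip Omega
                  (fun x => A (sigma.2 t x) - symgrad Omega (uD.2 t) x)
                  (fun x => tau x - sigma.1 t x)}].

End plasticity.

(* Main.v *)
(* The reduced solutions solve a sweeping-type variational inequality in the
   Hilbert space of stresses, driven by the strain rate f of the Dirichlet data.
   - Testing with the solution at times t + h and t - h and letting h tend to 0
     gives the energy identity int (A s', s') = int (f, s'); it bounds s' in L^2
     by f and needs no differentiability of s at single times.
   - Comparing two solutions s_n and s gives
     |s_n(t) - s(t)|^2 <= C int_0^t (f_n - f, s_n - s).
     When l_n converges weakly, l_n(t) converges weakly for every t, hence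
     j l_n(t) strongly by compactness, so that after integration by parts in
     time the right-hand side tends to 0. Pointwise convergence together with
     the bound on s_n' yields weak convergence in H^1.
   - If moreover f_n -> f in L^2, then the energy identities for s_n and s show
     that the energies of s_n' converge to that of s', which turns weak into
     strong convergence.
   The seminormed spaces of representatives are not known to be complete, so
   Riesz representation, the uniform boundedness principle and Mazur's lemma are
   replaced by elementary arguments with the inner product. *)

Require Import Defs.
From HB Require Import structures.
From mathcomp Require Import all_boot all_order all_algebra.
From mathcomp Require Import all_classical all_reals all_analysis.
From mathcomp Require Import measurable_realfun ring lra.

Set Implicit Arguments.
Unset Strict Implicit.
Unset Printing Implicit Defensive.

Import Order.TTheory GRing.Theory Num.Theory.
Import numFieldNormedType.Exports.

Local Open Scope classical_set_scope.
Local Open Scope ring_scope.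

(** * Seminormed spaces with an inner product *)

(** Spaces consist of representatives, so maps between them are linear only up to elements of
    seminorm 0. Real-valued forms and functionals are exactly linear, and the arguments are pushed
    through them as far as possible. The variational inequality holds at almost every time, and the
    solution is known to be an admissible test element only at almost every time. Continuity of the
    solution and density of the good times make its value at any time admissible, which shifts by a
    prescribed h require. The offset [a] cancels in f_n - f. Hence f_n - f has as primitive the
    difference of the images of l_n and l under one map that factors through [j]; this is where
    compactness enters. Integrating by parts leaves no boundary term at time 0, because both
    solutions start from the same stress. The boundary term at time t stays, so the controls have to
    converge at every single time and not only in the mean. *)

Lemma quadratic_ge0_discr (R : realFieldType) (a r d : R) :
  0 <= a -> 0 <= d -> (forall t, 0 <= t ^+ 2 * a + t * r + d) ->
  r ^+ 2 <= 4 * a * d.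
Proof.
move=> a0 d0 h; have [a_eq0|an0] := eqVneq a 0.
  (* For [a = 0] and [r != 0] the affine function takes the value -1 at this point. *)
  suff -> : r = 0 by rewrite expr0n /= a_eq0 mulr0 mul0r.
  apply/eqP; apply: contraT => rn0.
  have := h (- (d + 1) / r); rewrite a_eq0 mulr0 add0r mulrVK ?unitfE//.
  lra.
have ap : 0 < a by rewrite lt_def an0.
have := h (- r / (2 * a)).
rewrite (_ : _ + d = (4 * a * d - r ^+ 2) / (4 * a)); last by field; rewrite an0.
by rewrite pmulr_lge0 ?subr_ge0// invr_gt0 mulr_gt0.
Qed.

(** The form determines the seminorm on [dom V] only. Nonnegativity of [sn] is asked everywhere,
    since the seminorms at hand are norms or square roots. *)
Record prehilbert (R : realType) (V : snspace R) (b : V -> V -> R) : Prop :=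
  PreHilbert {
  ph_dom0 : dom V 0;
  ph_domP : forall (a : R) x y, dom V x -> dom V y -> dom V (a *: x + y);
  ph_lin : forall (a : R) x y z, dom V x -> dom V y -> dom V z ->
    b (a *: x + y) z = a * b x z + b y z;
  ph_sym : forall x y, dom V x -> dom V y -> b x y = b y x;
  ph_ge0 : forall x, 0 <= sn V x;
  ph_sn : forall x, dom V x -> sn V x ^+ 2 = b x x }.

(** Neither symmetry nor positivity is asked, so that one notion serves for product rules and weak
    limits as well as for inner products. *)
Record bounded_form (R : realType) (V : snspace R) (beta : V -> V -> R)
    (M : R) : Prop := BoundedForm {
  bf_linl : forall (a : R) x y z, dom V x -> dom V y -> dom V z ->
    beta (a *: x + y) z = a * beta x z + beta y z;
  bf_linr : forall (a : R) x y z, dom V x -> dom V y -> dom V z ->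
    beta z (a *: x + y) = a * beta z x + beta z y;
  bf_ge0 : 0 <= M;
  bf_le : forall x y, dom V x -> dom V y ->
    `|beta x y| <= M * sn V x * sn V y }.

(** Linearity is exact here: a real number of absolute value 0 is 0, so for real-valued maps
    linearity up to the seminorm is no weaker. *)
Record bounded_functional (R : realType) (V : snspace R) (phi : V -> R)
    (M : R) : Prop := BoundedFunctional {
  bl_lin : forall (a : R) x y, dom V x -> dom V y ->
    phi (a *: x + y) = a * phi x + phi y;
  bl_ge0 : 0 <= M;
  bl_le : forall x, dom V x -> `|phi x| <= M * sn V x }.

Section prehilbert_theory.
Variables (R : realType) (V : snspace R) (b : V -> V -> R).
Hypothesis phV : prehilbert b.
Implicit Types (x y z : V) (a : R).

Let d0 := ph_dom0 phV.

Lemma ph_domZ a x : dom V x -> dom V (a *: x).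
Proof. by move=> dx; rewrite -[_ *: _]addr0; apply: (ph_domP phV). Qed.

Lemma ph_domD x y : dom V x -> dom V y -> dom V (x + y).
Proof. by move=> dx dy; rewrite -[x]scale1r; apply: (ph_domP phV). Qed.

Lemma ph_domN x : dom V x -> dom V (- x).
Proof. by move=> dx; rewrite -scaleN1r; exact: ph_domZ. Qed.

Lemma ph_domB x y : dom V x -> dom V y -> dom V (x - y).
Proof. by move=> dx dy; apply: ph_domD => //; exact: ph_domN. Qed.

Lemma ph_dom_sum (I : Type) (r : seq I) (P : pred I) (F : I -> V) :
  (forall i, P i -> dom V (F i)) -> dom V (\sum_(i <- r | P i) F i).
Proof. by move=> dF; elim/big_ind : _ => //; exact: ph_domD. Qed.

Section functional.
Variables (phi : V -> R) (M : R).
Hypothesis bphi : bounded_functional phi M.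

Lemma bl0 : phi 0 = 0.
Proof.
have := bl_lin bphi 1 d0 d0; rewrite scale1r addr0 mul1r.
by move/eqP; rewrite addrC -subr_eq subrr eq_sym => /eqP.
Qed.

Lemma blZ a x : dom V x -> phi (a *: x) = a * phi x.
Proof. by move=> dx; rewrite -[_ *: _]addr0 (bl_lin bphi)// bl0 addr0. Qed.

Lemma blD x y : dom V x -> dom V y -> phi (x + y) = phi x + phi y.
Proof. by move=> dx dy; rewrite -{1}[x]scale1r (bl_lin bphi)// mul1r. Qed.

Lemma blN x : dom V x -> phi (- x) = - phi x.
Proof. by move=> dx; rewrite -scaleN1r blZ// mulN1r. Qed.

Lemma blB x y : dom V x -> dom V y -> phi (x - y) = phi x - phi y.
Proof. by move=> dx dy; rewrite blD ?blN//; exact: ph_domN. Qed.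

Lemma bl_sum (I : Type) (r : seq I) (F : I -> V) :
  (forall i, dom V (F i)) -> phi (\sum_(i <- r) F i) = \sum_(i <- r) phi (F i).
Proof.
move=> dF; elim: r => [|i r IH]; first by rewrite !big_nil bl0.
by rewrite !big_cons blD ?IH//; apply: ph_dom_sum.
Qed.

End functional.

Section form.
Variables (beta : V -> V -> R) (M : R).
Hypothesis bb : bounded_form beta M.

Lemma bf_functionall z : dom V z -> bounded_functional (beta^~ z) (M * sn V z).
Proof.
move=> dz; split => [a x y dx dy||x dx].
- exact: (bf_linl bb).
- by rewrite mulr_ge0 ?(bf_ge0 bb) ?(ph_ge0 phV).
- by rewrite mulrAC; apply: (bf_le bb).
Qed.

Lemma bf_functionalr z : dom V z -> bounded_functional (beta z) (M * sn V z).
Proof.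
move=> dz; split => [a x y dx dy||x dx].
- exact: (bf_linr bb).
- by rewrite mulr_ge0 ?(bf_ge0 bb) ?(ph_ge0 phV).
- exact: (bf_le bb).
Qed.

Lemma bfDl x y z : dom V x -> dom V y -> dom V z ->
  beta (x + y) z = beta x z + beta y z.
Proof. by move=> dx dy /bf_functionall/blD ->. Qed.
Lemma bfBl x y z : dom V x -> dom V y -> dom V z ->
  beta (x - y) z = beta x z - beta y z.
Proof. by move=> dx dy /bf_functionall/blB ->. Qed.
Lemma bfZl a x z : dom V x -> dom V z -> beta (a *: x) z = a * beta x z.
Proof. by move=> dx /bf_functionall/blZ ->. Qed.
Lemma bfNl x z : dom V x -> dom V z -> beta (- x) z = - beta x z.
Proof. by move=> dx /bf_functionall/blN ->. Qed.
Lemma bfDr x y z : dom V x -> dom V y -> dom V z ->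
  beta z (x + y) = beta z x + beta z y.
Proof. by move=> dx dy /bf_functionalr/blD ->. Qed.
Lemma bfBr x y z : dom V x -> dom V y -> dom V z ->
  beta z (x - y) = beta z x - beta z y.
Proof. by move=> dx dy /bf_functionalr/blB ->. Qed.
Lemma bfZr a x z : dom V x -> dom V z -> beta z (a *: x) = a * beta z x.
Proof. by move=> dx /bf_functionalr/blZ ->. Qed.
Lemma bfNr x z : dom V x -> dom V z -> beta z (- x) = - beta z x.
Proof. by move=> dx /bf_functionalr/blN ->. Qed.

End form.

Let lin := ph_lin phV.
Let sym := ph_sym phV.

Let quad x y t : dom V x -> dom V y ->
  sn V (t *: x + y) ^+ 2 = t ^+ 2 * b x x + t * (2 * b x y) + b y y.
Proof.
move=> dx dy; have dz : dom V (t *: x + y) by apply: (ph_domP phV).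
rewrite (ph_sn phV)// lin// (sym dx dz) (sym dy dz) !lin// (sym dy dx).
by ring.
Qed.

Lemma ph_cauchy_schwarz x y : dom V x -> dom V y ->
  `|b x y| <= sn V x * sn V y.
Proof.
move=> dx dy.
have bxx z : dom V z -> 0 <= b z z by move=> dz; rewrite -(ph_sn phV)// sqr_ge0.
have q t : 0 <= t ^+ 2 * b x x + t * (2 * b x y) + b y y.
  by rewrite -quad// sqr_ge0.
have := quadratic_ge0_discr (bxx _ dx) (bxx _ dy) q.
rewrite -!(ph_sn phV)// exprMn (_ : 2 ^+ 2 = 4 :> R); last by ring.
rewrite -mulrA ler_pM2l// -exprMn -real_normK ?num_real//.
by rewrite ler_sqr ?nnegrE// mulr_ge0 ?(ph_ge0 phV).
Qed.

Lemma ph_bounded_form : bounded_form b 1.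
Proof.
split=> // [a x y z dx dy dz|x y dx dy].
  by rewrite (sym dz) ?lin ?(sym dz)//; apply: (ph_domP phV).
by rewrite mul1r; exact: ph_cauchy_schwarz.
Qed.

Lemma ph_snZ a x : dom V x -> sn V (a *: x) = `|a| * sn V x.
Proof.
move=> dx; apply/eqP; rewrite -(eqrXn2 (n := 2))// ?mulr_ge0 ?(ph_ge0 phV)//.
rewrite exprMn !(ph_sn phV)//; last exact: ph_domZ.
rewrite (bfZl ph_bounded_form) ?(bfZr ph_bounded_form)//; last exact: ph_domZ.
by rewrite real_normK ?num_real// expr2 mulrA.
Qed.

Lemma ph_sn0 : sn V 0 = 0.
Proof. by rewrite -(scale0r (0 : V)) ph_snZ// normr0 mul0r. Qed.

Lemma ph_snN x : dom V x -> sn V (- x) = sn V x.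
Proof. by move=> dx; rewrite -scaleN1r ph_snZ// normrN1 mul1r. Qed.

Lemma ph_snBC x y : dom V x -> dom V y -> sn V (x - y) = sn V (y - x).
Proof. by move=> dx dy; rewrite -(ph_snN (ph_domB dy dx)) opprB. Qed.

Lemma ph_snD x y : dom V x -> dom V y -> sn V (x + y) <= sn V x + sn V y.
Proof.
move=> dx dy.
rewrite -ler_sqr ?nnegrE ?addr_ge0 ?(ph_ge0 phV)//.
have := quad 1 dx dy; rewrite scale1r => ->.
rewrite -!(ph_sn phV)//.
have := le_trans (ler_norm _) (ph_cauchy_schwarz dx dy).
by nra.
Qed.

Lemma ph_snB x y : dom V x -> dom V y -> sn V (x - y) <= sn V x + sn V y.
Proof.
by move=> dx dy; rewrite (le_trans (ph_snD _ _)) ?ph_snN//; exact: ph_domN.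
Qed.

Lemma ph_sn_le x y : dom V x -> dom V y -> sn V x <= sn V y + sn V (x - y).
Proof.
move=> dx dy; rewrite -{1}(subrK y x) addrC.
by apply: ph_snD => //; exact: ph_domB.
Qed.

Lemma ph_snB3 x y z : dom V x -> dom V y -> dom V z ->
  sn V (x - z) <= sn V (x - y) + sn V (y - z).
Proof.
move=> dx dy dz; rewrite -[x - z](subrKA y).
by apply: ph_snD; exact: ph_domB.
Qed.

Lemma ph_dist_sn x y : dom V x -> dom V y -> `|sn V x - sn V y| <= sn V (x - y).
Proof.
move=> dx dy; rewrite ler_norml lerBlDl lerNl opprB lerBlDl.
by rewrite ph_sn_le//= ph_snBC// ph_sn_le.
Qed.

Lemma ph_sqD x y : dom V x -> dom V y ->
  sn V (x + y) ^+ 2 = sn V x ^+ 2 + 2 * b x y + sn V y ^+ 2.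
Proof.
by move=> dx dy; have := quad 1 dx dy; rewrite scale1r -!(ph_sn phV)// => ->; ring.
Qed.

(* Near-minimizers of |x|^2/2 - phi x: they replace the Riesz representative,
   which needs completeness. *)
Lemma approx_riesz phi M : bounded_functional phi M -> forall eps, 0 < eps ->
  exists2 e, dom V e & forall x, dom V x -> `|phi x - b x e| <= eps * sn V x.
Proof.
move=> bphi eps e0.
pose J x := 2^-1 * b x x - phi x.
pose S := [set J x | x in dom V].
have J_lb x : dom V x -> - (M ^+ 2 / 2) <= J x.
  move=> dx; rewrite /J -(ph_sn phV)//.
  have := le_trans (ler_norm _) (bl_le bphi dx).
  have := sqr_ge0 (sn V x - M); have := ph_ge0 phV x; nra.
have Slb : has_lbound S.
  by exists (- (M ^+ 2 / 2)) => _ [x dx <-]; exact: J_lb.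
have Sn0 : S !=set0 by exists (J 0), 0.
(* The discriminant turns a slack of eps^2/2 in the infimum into exactly the bound
   [eps * sn V x]. *)
have d_gt0 : 0 < eps ^+ 2 / 2 by rewrite divr_gt0// exprn_gt0.
have [_ [e de <-] Je] := inf_adherent d_gt0 (conj Sn0 Slb).
exists e => // x dx.
(* Near-minimality of [e] along the line through [e] in direction [x] is a quadratic polynomial in
   [t] that is nowhere negative. *)
have h t : 0 <= t ^+ 2 * (2^-1 * b x x) + t * (b x e - phi x) + eps ^+ 2 / 2.
  have dz : dom V (t *: x + e) by apply: (ph_domP phV).
  have : inf S <= J (t *: x + e) by apply: ge_inf => //; exists (t *: x + e).
  rewrite /J -(ph_sn phV)// quad// (bl_lin bphi)//.
  move: Je; rewrite /J; nra.
have bxx : 0 <= 2^-1 * b x x by rewrite -(ph_sn phV)// mulr_ge0// sqr_ge0.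
have := quadratic_ge0_discr bxx (ltW d_gt0) h.
rewrite -(ph_sn phV)// => h2.
rewrite distrC -ler_sqr ?nnegrE ?mulr_ge0 ?(ltW e0) ?(ph_ge0 phV)//.
rewrite real_normK ?num_real// exprMn; apply: le_trans h2 _.
by rewrite le_eqVlt; apply/orP; left; apply/eqP; field.
Qed.

(** On a bounded sequence an approximate Riesz element [e] gives [phi (x_ k)] up to an error uniform
    in k, so testing with inner products suffices. *)
Lemma weakly_null_prehilbert (x_ : nat -> V) phi M B :
  (forall k, dom V (x_ k)) -> (forall k, sn V (x_ k) <= B) ->
  (forall e, dom V e -> (fun k => b (x_ k) e) @ \oo --> (0 : R)) ->
  bounded_functional phi M -> (fun k => phi (x_ k)) @ \oo --> (0 : R).
Proof.
move=> dx xB hx bphi; apply/cvgrPdist_lt => eps e0.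
have B0 : 0 <= B by rewrite (le_trans _ (xB 0)) ?(ph_ge0 phV).
have d_gt0 : 0 < eps / 2 / (B + 1) by rewrite !divr_gt0// ltr_wpDl.
have [e de he] := approx_riesz bphi d_gt0.
have /cvgrPdist_lt/(_ (eps / 2)) := hx e de.
rewrite divr_gt0// => /(_ isT); apply: filterS => k.
rewrite !sub0r !normrN => bk; rewrite -[phi _](subrK (b (x_ k) e)).
rewrite (le_lt_trans (ler_normD _ _))// [ltRHS](splitr eps) ler_ltD//.
rewrite (le_trans (he _ (dx k)))// -mulrA ler_piMr ?divr_ge0 ?(ltW e0)//.
by rewrite ler_pdivrMl ?mulr1 ?ltr_wpDl// (le_trans (xB k))// lerDl.
Qed.

(* Gliding hump, summing signed multiples of the normalized large elements. *)
Lemma uniform_boundedness (x_ : nat -> V) :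
  (forall k, dom V (x_ k)) ->
  (forall phi M, bounded_functional phi M ->
     exists B, forall k, `|phi (x_ k)| <= B) ->
  exists B, forall k, sn V (x_ k) <= B.
Proof.
move=> dx hphi; apply: contrapT => /forallNP unb.
(* The weight 3^-n of the n-th hump reduces this size to 2 (n + 1), and all later humps together can
   cancel at most half of that. *)
have /choice[k_ hk] n : exists k, (n%:R + 1) * 3 ^+ n * 2 < sn V (x_ k).
  have /existsNP[k /negP] := unb ((n%:R + 1) * 3 ^+ n * 2).
  by rewrite -ltNge; exists k.
pose u n := x_ (k_ n).
have du n : dom V (u n) by apply: dx.
have u0 n : 0 < sn V (u n).
  by apply: le_lt_trans (hk n); rewrite !mulr_ge0// exprn_ge0.
pose y n : V := (sn V (u n))^-1 *: u n.
have dy n : dom V (y n) by apply: ph_domZ.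
have y1 n : sn V (y n) = 1.
  by rewrite ph_snZ// gtr0_norm ?invr_gt0// mulVf ?gt_eqF.
(* This sign never vanishes, so a hump is added even where the partial sum is 0. *)
pose sg (t : R) : R := if 0 <= t then 1 else -1.
have sg1 t : `|sg t| = 1 by rewrite /sg; case: ifP; rewrite ?normr1 ?normrN1.
pose F := fix F n : V -> R := if n is m.+1 then
  (fun x => F m x + sg (F m (u m)) * (3 ^- m * b x (y m))) else (fun=> 0).
have FS m x : F m.+1 x = F m x + sg (F m (u m)) * (3 ^- m * b x (y m)) by [].
have F_lin n a x z : dom V x -> dom V z -> F n (a *: x + z) = a * F n x + F n z.
  move=> dx' dz; elim: n => [|n IH]; first by rewrite /= mulr0 addr0.
  by rewrite !FS IH lin//; ring.
have p3 m : 0 < 3 ^- m :> R by rewrite invr_gt0 exprn_gt0.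
have F_step n x : dom V x -> `|F n.+1 x - F n x| <= 3 ^- n * sn V x.
  move=> dx'; rewrite FS addrC addKr !normrM sg1 mul1r gtr0_norm//.
  by rewrite ler_pM2l// -[leRHS]mulr1 -(y1 n) ph_cauchy_schwarz.
(* The factor is the sum of the geometric series from 3^-n to 3^-(n+j-1). Keeping the subtracted
   term is what lets the induction close. *)
have F_tail x n j : dom V x ->
    `|F (n + j)%N x - F n x| <= 3 / 2 * (3 ^- n - 3 ^- (n + j)) * sn V x.
  move=> dx'; elim: j => [|j IH]; first by rewrite addn0 !subrr normr0 mulr0 mul0r.
  rewrite addnS -(subrKA (F (n + j)%N x)) (le_trans (ler_normD _ _))//.
  rewrite (le_trans (lerD (F_step _ _ dx') IH))// -mulrDl.
  rewrite ler_wpM2r ?(ph_ge0 phV)// (exprS _ (n + j)) invfM; lra.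
have F_tail' x n j : dom V x ->
    `|F (n + j)%N x - F n x| <= 3 / 2 * 3 ^- n * sn V x.
  move=> dx'; rewrite (le_trans (F_tail _ _ _ dx'))//.
  by rewrite ler_wpM2r ?(ph_ge0 phV)// ler_pM2l// lerBlDr lerDl ltW.
have F_cvg x : dom V x -> cvgn (F^~ x).
  move=> dx'; apply/cauchy_cvgP/cauchy_exP => e e0.
  have : (3 / 2 * sn V x) *: (3^-1 : R) ^+ n @[n --> \oo] --> (3 / 2 * sn V x) *: (0 : R).
    apply: cvgZr; apply: cvg_expr.
    by rewrite gtr0_norm ?invr_gt0// invf_lt1// ltr1n.
  rewrite scaler0 => /cvgrPdist_lt/(_ e e0)[n _ /(_ n (leqnn n))].
  rewrite sub0r normrN => hn.
  exists (F n x); exists n => // m /= nm; rewrite -ball_normE /= distrC.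
  rewrite -(subnKC nm) (le_lt_trans (F_tail' _ _ _ dx'))//.
  apply: le_lt_trans hn; rewrite exprVn; apply: le_trans (ler_norm _).
  by rewrite /GRing.scale /= le_eqVlt; apply/orP; left; apply/eqP; ring.
pose phi x := limn (F^~ x).
have phiP x : dom V x -> F^~ x @ \oo --> phi x by move/F_cvg.
have phi_tail x n : dom V x -> `|phi x - F n x| <= 3 / 2 * 3 ^- n * sn V x.
  move=> dx'.
  have cv : (fun m => `|F m x - F n x|) @ \oo --> `|phi x - F n x|.
    by apply: cvg_norm; apply: cvgB; [exact: phiP|exact: cvg_cst].
  rewrite -(cvg_lim (@Rhausdorff R) cv); apply: limr_le.
    by apply/cvg_ex; eexists; exact: cv.
  by exists n => // m /= nm; rewrite -(subnKC nm) F_tail'.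
have bphi : bounded_functional phi (3 / 2).
  split=> // [a x z dx' dz|x dx'].
    have dxz : dom V (a *: x + z) by apply: (ph_domP phV).
    apply/esym/(cvg_unique _ _ (phiP _ dxz)) => //.
    rewrite (_ : F^~ _ = fun n => a * F n x + F n z); last first.
      by apply/funext => n; exact: F_lin.
    by apply: cvgD; [apply: cvgMr; exact: phiP|exact: phiP].
  by have := phi_tail x 0 dx'; rewrite /= subr0 expr0 invr1 mulr1.
have [B hB] := hphi _ _ bphi.
suff h n : n%:R <= B.
  have B0 : 0 <= B by have := h 0.
  have := h (Num.bound B); have := archi_boundP B0; lra.
apply: le_trans (hB (k_ n)).
(* The n-th term has the sign of the partial sum at [u n], so the earlier terms cannot cancel it. *)
have : 3 ^- n * sn V (u n) <= `|F n.+1 (u n)|.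
  rewrite FS (bfZr ph_bounded_form)// -(ph_sn phV)// expr2 mulKf ?gt_eqF//.
  have h3 : 0 <= 3 ^- n * sn V (u n) by rewrite mulr_ge0 ?(ph_ge0 phV)// ltW.
  rewrite /sg; case: ifPn => [F0|]; first by rewrite mul1r ger0_norm ?addr_ge0// lerDr.
  by rewrite -ltNge => F0; rewrite mulN1r ltr0_norm; lra.
have := phi_tail _ n.+1 (du n); rewrite distrC -/(u n).
rewrite exprS invfM mulrA => h1 h2.
have h3 : 2 * (n%:R + 1) < 3 ^- n * sn V (u n).
  by rewrite ltr_pdivlMl ?exprn_gt0//; apply: le_lt_trans (hk n); lra.
have := ler_normD (F n.+1 (u n) - phi (u n)) (phi (u n)); rewrite subrK.
lra.
Qed.

End prehilbert_theory.

(** * Integrable real functions *)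

Section real_integrable.
Context d (T : measurableType d) (R : realType).
Variable mu : {measure set T -> \bar R}.
Implicit Types (D E : set T) (f g h : T -> R).

Definition rintegrable D f := mu.-integrable D (EFin \o f).

Lemma rintegrable_measurable D f : rintegrable D f -> measurable_fun D f.
Proof. by case/integrableP => /measurable_EFinP. Qed.

Lemma rintegrableD D f g : measurable D -> rintegrable D f -> rintegrable D g ->
  rintegrable D (fun x => f x + g x).
Proof. by move=> mD; exact: integrableD. Qed.

Lemma rintegrableB D f g : measurable D -> rintegrable D f -> rintegrable D g ->
  rintegrable D (fun x => f x - g x).
Proof. by move=> mD; exact: integrableB. Qed.

Lemma rintegrableZ D k f : measurable D -> rintegrable D f ->
  rintegrable D (fun x => k * f x).
Proof. by move=> mD; exact: integrableZl. Qed.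

Lemma rintegrableS D E f : measurable D -> measurable E -> E `<=` D ->
  rintegrable D f -> rintegrable E f.
Proof. exact: integrableS. Qed.

Lemma rintegrable_norm D f : rintegrable D f -> rintegrable D (fun x => `|f x|).
Proof. exact: integrable_norm. Qed.

Lemma le_rintegrable D f g : measurable D -> measurable_fun D f ->
  (forall x, D x -> `|f x| <= g x) -> rintegrable D g -> rintegrable D f.
Proof.
move=> mD mf fg; apply: le_integrable => //; first exact/measurable_EFinP.
by move=> x Dx /=; rewrite lee_fin (le_trans (fg x Dx))// ler_norm.
Qed.

Lemma eq_rintegrable D f g : measurable D -> (forall x, D x -> f x = g x) ->
  rintegrable D f -> rintegrable D g.
Proof.
move=> mD fg; apply: eq_integrable => // x /set_mem Dx /=.
by rewrite fg.
Qed.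

Lemma rintegrable_sum D (I : Type) (s : seq I) (h : I -> T -> R) :
  measurable D -> (forall i, rintegrable D (h i)) ->
  rintegrable D (fun x => \sum_(i <- s) h i x).
Proof.
move=> mD hi; elim: s => [|i s ih].
  by apply: eq_rintegrable (integrable0 mu D) => // x _; rewrite big_nil.
apply: eq_rintegrable (rintegrableD mD (hi i) ih) => // x _.
by rewrite big_cons.
Qed.

Lemma Rintegral_sum D (I : Type) (s : seq I) (h : I -> T -> R) :
  measurable D -> (forall i, rintegrable D (h i)) ->
  \int[mu]_(x in D) (\sum_(i <- s) h i x) = \sum_(i <- s) \int[mu]_(x in D) h i x.
Proof.
move=> mD hi; elim: s => [|i s ih].
  rewrite big_nil -[RHS](mul0r (fine (mu D))) -Rintegral_cst//.
  by apply: eq_Rintegral => x _; rewrite big_nil.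
rewrite big_cons -ih -RintegralD//; [|exact: hi|exact: rintegrable_sum].
by apply: eq_Rintegral => x _; rewrite big_cons.
Qed.

Lemma rintegrable_fin D f : measurable D -> measurable_fun D f ->
  (forall x, D x -> 0 <= f x) -> (\int[mu]_(x in D) (f x)%:E < +oo)%E ->
  rintegrable D f.
Proof.
move=> mD mf f0 foo; apply/integrableP; split; first exact/measurable_EFinP.
rewrite (eq_integral (fun x => (f x)%:E))// => x /set_mem Dx /=.
by rewrite ger0_norm// f0.
Qed.

Lemma rintegrable_lty D f : (forall x, D x -> 0 <= f x) -> rintegrable D f ->
  (\int[mu]_(x in D) (f x)%:E < +oo)%E.
Proof.
move=> f0 /integrableP[_]; rewrite (eq_integral (fun x => (f x)%:E))//.
by move=> x /set_mem Dx /=; rewrite ger0_norm// f0.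
Qed.

Lemma EFin_Rintegral D f : measurable D -> rintegrable D f ->
  (\int[mu]_(x in D) f x)%:E = (\int[mu]_(x in D) (f x)%:E)%E.
Proof. by move=> mD fi; rewrite /Rintegral fineK//; exact: integrable_fin_num. Qed.

Lemma rintegrableM_sqr D f g : measurable D ->
  measurable_fun D f -> measurable_fun D g ->
  rintegrable D (fun x => f x ^+ 2) -> rintegrable D (fun x => g x ^+ 2) ->
  rintegrable D (fun x => f x * g x).
Proof.
move=> mD mf mg f2 g2; apply: le_rintegrable (rintegrableD mD f2 g2) => //.
  exact: measurable_funM.
move=> x _; rewrite normrM -(real_normK (num_real (f x))).
rewrite -(real_normK (num_real (g x))).
by have := sqr_ge0 (`|f x| - `|g x|); have := normr_ge0 (f x);
  have := normr_ge0 (g x); nra.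
Qed.

Lemma Rintegral_cauchy_schwarz D f g : measurable D ->
  measurable_fun D f -> measurable_fun D g ->
  rintegrable D (fun x => f x ^+ 2) -> rintegrable D (fun x => g x ^+ 2) ->
  (\int[mu]_(x in D) (f x * g x)) ^+ 2 <=
  (\int[mu]_(x in D) f x ^+ 2) * (\int[mu]_(x in D) g x ^+ 2).
Proof.
move=> mD mf mg f2 g2; have fg := rintegrableM_sqr mD mf mg f2 g2.
pose I h := \int[mu]_(x in D) h x.
have q t : 0 <= t ^+ 2 * I (fun x => f x ^+ 2) +
    t * (2 * I (fun x => f x * g x)) + I (fun x => g x ^+ 2).
  rewrite /I mulrA -!RintegralZl//.
  rewrite -RintegralD//; [|exact: rintegrableZ|exact: rintegrableZ].
  rewrite -RintegralD//; last by apply: rintegrableD => //; exact: rintegrableZ.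
  apply: Rintegral_ge0 => x _.
  by rewrite (_ : _ + _ = (t * f x + g x) ^+ 2) ?sqr_ge0//; ring.
have I0 h : 0 <= I (fun x => h x ^+ 2).
  by apply: Rintegral_ge0 => x _; exact: sqr_ge0.
have := quadratic_ge0_discr (I0 f) (I0 g) q; rewrite /I.
by rewrite exprMn (_ : 2 ^+ 2 = 4 :> R) -?mulrA ?ler_pM2l//; ring.
Qed.

Lemma Rintegral_cvg0 D (f_ : nat -> T -> R) g : measurable D ->
  (forall n, measurable_fun D (f_ n)) -> rintegrable D g ->
  (forall n x, D x -> `|f_ n x| <= g x) ->
  (forall x, D x -> (fun n => f_ n x) @ \oo --> (0 : R)) ->
  (fun n => \int[mu]_(x in D) f_ n x) @ \oo --> (0 : R).
Proof.
move=> mD mf gi fg fx.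
have [||||_ _] := @dominated_convergence _ T R mu D mD
   (fun n x => (f_ n x)%:E) (cst 0%E) (EFin \o g) _ _ _ gi.
- by move=> n; exact/measurable_EFinP.
- exact: measurable_cst.
- by apply: aeW => x Dx; apply: cvg_EFin; [exact: nearW|exact: fx].
- by apply: aeW => x n Dx /=; rewrite lee_fin fg.
by rewrite integral0 => /fine_cvg.
Qed.

Lemma le_Rintegral_ae D f g : measurable D ->
  rintegrable D f -> rintegrable D g ->
  {ae mu, forall x, D x -> f x <= g x} ->
  \int[mu]_(x in D) f x <= \int[mu]_(x in D) g x.
Proof.
move=> mD fi gi fg.
(* The maximum lies above [f] everywhere and equals [g] almost everywhere, which reduces the claim
   to pointwise monotonicity. *)
pose h x := Num.max (f x) (g x).
have mh : measurable_fun D h.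
  by apply: measurable_maxr; exact: rintegrable_measurable.
have hi : rintegrable D h.
  apply: le_rintegrable (rintegrableD mD (rintegrable_norm fi)
    (rintegrable_norm gi)) => // x _.
  by rewrite /h; case: (leP (f x) (g x)) => _; rewrite (lerDl, lerDr) normr_ge0.
have <- : \int[mu]_(x in D) h x = \int[mu]_(x in D) g x.
  congr fine; apply: ae_eq_integral => //.
  - exact/measurable_EFinP.
  - exact/measurable_EFinP/rintegrable_measurable.
  - by apply: filterS fg => x fgx Dx; congr EFin; apply/max_idPr/fgx.
by apply: le_Rintegral => // x _; rewrite /h le_max lexx.
Qed.

Lemma Rintegral_subset D E f : measurable D -> measurable E -> E `<=` D ->
  (forall x, D x -> 0 <= f x) -> rintegrable D f ->
  \int[mu]_(x in E) f x <= \int[mu]_(x in D) f x.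
Proof.
move=> mD mE ED f0 fi; rewrite -lee_fin !EFin_Rintegral//; last first.
  exact: rintegrableS fi.
apply: ge0_subset_integral => //.
by case/integrableP : fi.
Qed.

End real_integrable.

(** * Simple and strongly measurable functions *)

Lemma squeeze0 (R : realType) (u v : nat -> R) : (forall k, `|u k| <= v k) ->
  v @ \oo --> (0 : R) -> u @ \oo --> (0 : R).
Proof.
move=> uv v0; apply/norm_cvg0P; apply: (squeeze_cvgr _ (cvg_cst 0) v0).
by apply: nearW => k; rewrite normr_ge0 uv.
Qed.

Lemma cvg_sub0P (R : realType) (u : nat -> R) (l : R) :
  (fun k => u k - l) @ \oo --> (0 : R) <-> u @ \oo --> l.
Proof. by split => [/subr_cvg0|?]; [|apply/subr_cvg0]. Qed.

Section lebesgue_finite.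
Variable R : realType.
Local Notation mu := (@lebesgue_measure R).
Implicit Types D : set R.

Lemma rintegrable_cst D (k : R) : measurable D -> (mu D < +oo)%E ->
  rintegrable mu D (fun=> k).
Proof.
move=> mD Doo; apply/integrableP; split; first exact/measurable_EFinP.
by rewrite /= integral_cst// lte_mul_pinfty// ?lee_fin.
Qed.

Lemma rintegrable_indic D (B : set R) : measurable D -> (mu D < +oo)%E ->
  measurable B -> rintegrable mu D (\1_B : R -> R).
Proof.
move=> mD Doo mB; apply: le_rintegrable (rintegrable_cst 1 mD Doo) => //.
by move=> x _; rewrite indicE; case: (_ \in _); rewrite ?normr1 ?normr0.
Qed.

Lemma lebesgue_itvcc_lty (s t : R) : (mu `[s, t] < +oo)%E.
Proof. by rewrite lebesgue_measure_itv/=; case: ifP; rewrite // -EFinD ltry. Qed.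

Lemma fine_lebesgue_itvcc (s t : R) : s <= t -> fine (mu `[s, t]) = t - s.
Proof.
rewrite le_eqVlt lebesgue_measure_itv/= lte_fin => /predU1P[->|->//].
by rewrite ltxx subrr.
Qed.

End lebesgue_finite.

Section simple_functions.
Variables (R : realType) (V : snspace R) (b : V -> V -> R).
Hypothesis phV : prehilbert b.
Local Notation mu := (@lebesgue_measure R).
Implicit Types (s r : simple_fun V) (D : set R).

Lemma sf_eval_dom s t : dom V (sf_eval s t).
Proof.
by apply: (ph_dom_sum phV) => i _; apply: (ph_domZ phV); exact: sf_dom.
Qed.

Lemma sf_integral_dom D s : dom V (sf_integral D s).
Proof.
by apply: (ph_dom_sum phV) => i _; apply: (ph_domZ phV); exact: sf_dom.
Qed.

Definition sf_lin (a : R) s r : simple_fun V.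
Proof.
refine (@SimpleFun R V (sf_card s + sf_card r)
  (fun i => match fintype.split i with inl k => sf_set k | inr k => sf_set k end)
  (fun i => match fintype.split i with inl k => a *: sf_val k | inr k => sf_val k end)
  _ _).
- by move=> i; case: (fintype.split i) => k; exact: sf_meas.
- move=> i; case: (fintype.split i) => k; last exact: sf_dom.
  by apply: (ph_domZ phV); exact: sf_dom.
Defined.

Lemma split_lshift m n (i : 'I_m): fintype.split (lshift n i) = inl i.
Proof. exact: (unsplitK (inl i)). Qed.

Lemma split_rshift m n (i : 'I_n): fintype.split (rshift m i) = inr i.
Proof. exact: (unsplitK (inr i)). Qed.

Lemma sf_eval_lin a s r t :
  sf_eval (sf_lin a s r) t = a *: sf_eval s t + sf_eval r t.
Proof.
rewrite /sf_eval /= big_split_ord/= scaler_sumr; congr (_ + _).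
  by apply: eq_bigr => i _; rewrite split_lshift !scalerA mulrC.
by apply: eq_bigr => i _; rewrite split_rshift.
Qed.

Lemma sf_integral_lin D a s r :
  sf_integral D (sf_lin a s r) = a *: sf_integral D s + sf_integral D r.
Proof.
rewrite /sf_integral /= big_split_ord/= scaler_sumr; congr (_ + _).
  by apply: eq_bigr => i _; rewrite split_lshift !scalerA mulrC.
by apply: eq_bigr => i _; rewrite split_rshift.
Qed.

Definition sf_zero : simple_fun V :=
  @SimpleFun R V 0 (fun=> set0) (fun=> 0) (fun=> measurable0)
    (fun=> ph_dom0 phV).

Definition sf_restrict (B : set R) (mB : measurable B) s : simple_fun V :=
  @SimpleFun R V (sf_card s) (fun i => sf_set i `&` B) (@sf_val R V s)
    (fun i => measurableI _ _ (sf_meas i) mB) (@sf_dom R V s).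

Lemma sf_eval_restrict B (mB : measurable B) s t :
  sf_eval (sf_restrict mB s) t = \1_B t *: sf_eval s t.
Proof.
rewrite /sf_eval /= scaler_sumr; apply: eq_bigr => i _.
by rewrite scalerA indicI mulrC.
Qed.

Lemma functional_sf_eval phi M s t : bounded_functional phi M ->
  phi (sf_eval s t) = \sum_i \1_(sf_set i) t * phi (@sf_val R V s i).
Proof.
move=> bphi; rewrite (bl_sum phV bphi); last first.
  by move=> i; apply: (ph_domZ phV); exact: sf_dom.
by apply: eq_bigr => i _; rewrite (blZ phV bphi)//; exact: sf_dom.
Qed.

Lemma measurable_functional_sf phi M s D : bounded_functional phi M ->
  measurable_fun D (fun t => phi (sf_eval s t)).
Proof.
move=> bphi; under eq_fun do rewrite (functional_sf_eval _ _ bphi).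
apply: measurable_sum => i; apply: measurable_funM; last exact: measurable_cst.
by apply: measurable_indic; exact: sf_meas.
Qed.

Lemma functional_sf_integral phi M s D : bounded_functional phi M ->
  measurable D -> (mu D < +oo)%E ->
  \int[mu]_(t in D) phi (sf_eval s t) = phi (sf_integral D s).
Proof.
move=> bphi mD Doo; rewrite (bl_sum phV bphi); last first.
  by move=> i; apply: (ph_domZ phV); exact: sf_dom.
under eq_Rintegral do rewrite (functional_sf_eval _ _ bphi).
have i1 (i : 'I_(sf_card s)) : rintegrable mu D (\1_(@sf_set R V s i)).
  by apply: rintegrable_indic => //; exact: sf_meas.
have eq1 (i : 'I_(sf_card s)) :
    (fun t => \1_(@sf_set R V s i) t * phi (@sf_val R V s i)) =
    (fun t => phi (@sf_val R V s i) * \1_(@sf_set R V s i) t).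
  by apply/funext => t; rewrite mulrC.
rewrite Rintegral_sum//; last by move=> i; rewrite eq1; exact: rintegrableZ.
apply: eq_bigr => i _; rewrite eq1 RintegralZl//; last exact: i1.
rewrite (blZ phV bphi); last exact: sf_dom.
by rewrite mulrC; congr (_ * _); rewrite /Rintegral integral_indic//; exact: sf_meas.
Qed.

Lemma functional_cvg phi M (x_ : nat -> V) x : bounded_functional phi M ->
  (forall k, dom V (x_ k)) -> dom V x ->
  (fun k => sn V (x_ k - x)) @ \oo --> (0 : R) ->
  (fun k => phi (x_ k)) @ \oo --> phi x.
Proof.
move=> bphi dx_ dx xx; apply/cvg_sub0P.
apply: (squeeze0 (v := fun k => M * sn V (x_ k - x))) => [k|].
  by rewrite -(blB phV bphi)// (bl_le bphi)//; apply: (ph_domB phV).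
by rewrite -[X in _ --> X](mulr0 M); apply: cvgMr.
Qed.

Lemma sn_cvg (x_ : nat -> V) x : (forall k, dom V (x_ k)) -> dom V x ->
  (fun k => sn V (x_ k - x)) @ \oo --> (0 : R) ->
  (fun k => sn V (x_ k)) @ \oo --> sn V x.
Proof.
move=> dx_ dx xx; apply/cvg_sub0P; apply: squeeze0 xx => k.
exact: (ph_dist_sn phV).
Qed.

Lemma form_cvg beta M (x_ y_ : nat -> V) x y : bounded_form beta M ->
  (forall k, dom V (x_ k)) -> dom V x -> (forall k, dom V (y_ k)) -> dom V y ->
  (fun k => sn V (x_ k - x)) @ \oo --> (0 : R) ->
  (fun k => sn V (y_ k - y)) @ \oo --> (0 : R) ->
  (fun k => beta (x_ k) (y_ k)) @ \oo --> beta x y.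
Proof.
move=> bb dx_ dx dy_ dy xx yy; apply/cvg_sub0P.
apply: (squeeze0 (v := fun k => M * sn V (x_ k - x) * sn V (y_ k) +
   M * sn V x * sn V (y_ k - y))) => [k|].
  rewrite -(subrKA (beta x (y_ k))) -(bfBl phV bb)// -(bfBr phV bb)//.
  by rewrite (le_trans (ler_normD _ _))// lerD// (bf_le bb)//; apply: (ph_domB phV).
rewrite -[X in _ --> X](addr0 0); apply: cvgD.
  rewrite -[X in _ --> X](mul0r (sn V y)); apply: cvgM; last exact: sn_cvg.
  by rewrite -[X in _ --> X](mulr0 M); apply: cvgMr.
by rewrite -[X in _ --> X](mulr0 (M * sn V x)); apply: cvgMr.
Qed.

Lemma strongly_measurableP (a : R) D (f g : R -> V) :
  (forall t, D t -> dom V (f t)) -> (forall t, D t -> dom V (g t)) ->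
  strongly_measurable D f -> strongly_measurable D g ->
  strongly_measurable D (a *: f + g).
Proof.
move=> df dg [s hs] [r hr]; exists (fun k => sf_lin a (s k) (r k)) => t Dt.
apply: (squeeze0 (v := fun k => `|a| * sn V (sf_eval (s k) t - f t) +
   sn V (sf_eval (r k) t - g t))) => [k|].
  rewrite ger0_norm ?(ph_ge0 phV)// sf_eval_lin opprD addrACA -scalerBr.
  have d1 := ph_domB phV (sf_eval_dom (s k) t) (df _ Dt).
  have d2 := ph_domB phV (sf_eval_dom (r k) t) (dg _ Dt).
  by rewrite -(ph_snZ phV)// (ph_snD phV)//; apply: (ph_domZ phV).
rewrite -[X in _ --> X](addr0 0); apply: cvgD; last exact: hr.
by rewrite -[X in _ --> X](mulr0 `|a|); apply: cvgMr; exact: hs.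
Qed.

Lemma measurable_functional phi M D (f : R -> V) : bounded_functional phi M ->
  (forall t, D t -> dom V (f t)) -> strongly_measurable D f ->
  measurable_fun D (fun t => phi (f t)).
Proof.
move=> bphi df [s hs].
apply: (measurable_fun_cvg (h := fun k t => phi (sf_eval (s k) t))).
  by move=> k; exact: measurable_functional_sf bphi.
move=> t Dt; apply: (functional_cvg bphi) => //; first by move=> k; exact: sf_eval_dom.
- exact: df.
- exact: hs.
Qed.

Lemma measurable_form beta M D (f g : R -> V) : bounded_form beta M ->
  (forall t, D t -> dom V (f t)) -> (forall t, D t -> dom V (g t)) ->
  strongly_measurable D f -> strongly_measurable D g ->
  measurable_fun D (fun t => beta (f t) (g t)).
Proof.
move=> bb df dg [s hs] [r hr].
apply: (measurable_fun_cvg (h := fun k t => beta (sf_eval (s k) t) (sf_eval (r k) t))).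
  move=> k.
  under eq_fun => t do rewrite (functional_sf_eval _ _
    (bf_functionall phV bb (sf_eval_dom (r k) t))).
  apply: measurable_sum => i; apply: measurable_funM.
    by apply: measurable_indic; exact: sf_meas.
  by apply: measurable_functional_sf; apply: (bf_functionalr phV bb); exact: sf_dom.
move=> t Dt; apply: (form_cvg bb) => //; try by move=> k; exact: sf_eval_dom.
- exact: df.
- exact: dg.
- exact: hs.
- exact: hr.
Qed.

Lemma measurable_sn D (f : R -> V) :
  (forall t, D t -> dom V (f t)) -> strongly_measurable D f ->
  measurable_fun D (fun t => sn V (f t)).
Proof.
move=> df mf; apply: (eq_measurable_fun (fun t => Num.sqrt (b (f t) (f t)))).
  by move=> t /set_mem Dt; rewrite -(ph_sn phV) ?sqrtr_sqr ?ger0_norm ?(ph_ge0 phV)//; exact: df.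
have h := measurable_form (ph_bounded_form phV) df df mf mf.
exact: (measurableT_comp (continuous_measurable_fun (@sqrt_continuous R)) h).
Qed.

Lemma strongly_measurable_sf s D : strongly_measurable D (sf_eval s).
Proof.
exists (fun=> s) => t _; rewrite subrr (ph_sn0 phV); exact: cvg_cst.
Qed.

End simple_functions.

Section simple_map.
Variables (R : realType) (V W : snspace R).
Variables (bV : V -> V -> R) (bW : W -> W -> R).
Hypotheses (phV : prehilbert bV) (phW : prehilbert bW).
Variable L : V -> W.
Hypothesis bL : bounded_linear L.

Let dL x : dom V x -> dom W (L x). Proof. by case: bL => + _ _; exact. Qed.

Definition sf_map (s : simple_fun V) : simple_fun W :=
  @SimpleFun R W (sf_card s) (@sf_set R V s) (fun i => L (@sf_val R V s i))
    (@sf_meas R V s) (fun i => dL (@sf_dom R V s i)).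

(** The defect of linearity of [L] has seminorm 0 and is killed by [phi], so the composition is
    exactly linear. *)
Lemma bounded_linear_comp phi M : bounded_functional phi M ->
  exists M', bounded_functional (phi \o L) M'.
Proof.
move=> bphi; case: bL => _ linL [C hC]; exists (M * `|C|); split.
- move=> a x y dx dy /=.
  have dz : dom V (a *: x + y) by apply: (ph_domP phV).
  have : phi (L (a *: x + y) - (a *: L x + L y)) = 0.
    apply/eqP; rewrite -normr_le0 (le_trans (bl_le bphi _))//.
      by apply: (ph_domB phW); [exact: dL|apply: (ph_domP phW); exact: dL].
    by rewrite linL// mulr0.
  rewrite (blB phW bphi) ?(bl_lin bphi)//; try exact: dL.
    by move/eqP; rewrite subr_eq0 => /eqP.
  by apply: (ph_domP phW); exact: dL.
- by rewrite mulr_ge0// (bl_ge0 bphi).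
- move=> x dx /=; rewrite (le_trans (bl_le bphi (dL dx)))//.
  rewrite -mulrA ler_wpM2l ?(bl_ge0 bphi)// (le_trans (hC _ dx))//.
  by rewrite ler_wpM2r ?(ph_ge0 phV)// ler_norm.
Qed.

End simple_map.

Lemma sqr_cvg0 (R : realType) (u : nat -> R) : u @ \oo --> (0 : R) ->
  (fun k => u k ^+ 2) @ \oo --> (0 : R).
Proof. by move=> u0; rewrite -[X in _ --> X](mulr0 0); exact: cvgM. Qed.

Lemma sqrt_cvg0 (R : realType) (u : nat -> R) : u @ \oo --> (0 : R) ->
  (fun k => Num.sqrt (u k)) @ \oo --> (0 : R).
Proof.
move=> u0; rewrite -[X in _ --> X](sqrtr0 R).
exact: (cvg_comp _ _ u0 (@sqrt_continuous R 0)).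
Qed.

(** * Square-integrable functions of time *)

Section L2T_theory.
Variables (R : realType) (V : snspace R) (b : V -> V -> R) (T : R).
Hypothesis phV : prehilbert b.
Local Notation mu := (@lebesgue_measure R).
Local Notation D := (`[0, T]%classic : set R).
Implicit Types (f g : L2T V T).

Let mD : measurable (D : set (measurableTypeR R)). Proof. exact: measurable_itv. Qed.
Let Doo : (mu D < +oo)%E. Proof. exact: lebesgue_itvcc_lty. Qed.

Lemma L2T_dom f : dom (L2T V T) f -> forall t, D t -> dom V (f t).
Proof. by case. Qed.

Lemma L2T_sm f : dom (L2T V T) f -> strongly_measurable D (f : R -> V).
Proof. by case. Qed.

Lemma L2T_measurable_sn f : dom (L2T V T) f ->
  measurable_fun D (fun t => sn V (f t)).
Proof. by case=> df mf _; exact: measurable_sn phV _ _ df mf. Qed.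

Lemma L2T_rintegrable_sqr f : dom (L2T V T) f ->
  rintegrable mu D (fun t => sn V (f t) ^+ 2).
Proof.
move=> df; have mf := L2T_measurable_sn df; case: df => _ _ foo.
by apply: rintegrable_fin => //; [exact: measurable_funX|move=> x _; exact: sqr_ge0].
Qed.

Lemma L2T_domI f : (forall t, D t -> dom V (f t)) ->
  strongly_measurable D (f : R -> V) ->
  rintegrable mu D (fun t => sn V (f t) ^+ 2) -> dom (L2T V T) f.
Proof.
by move=> df mf fi; split=> //; apply: rintegrable_lty => // t _; exact: sqr_ge0.
Qed.

Lemma L2T_rintegrable_sn f : dom (L2T V T) f ->
  rintegrable mu D (fun t => sn V (f t)).
Proof.
move=> df; have := rintegrableD mD (rintegrable_cst 1 mD Doo) (L2T_rintegrable_sqr df).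
apply: le_rintegrable => //; first exact: L2T_measurable_sn.
move=> t _; rewrite ger0_norm ?(ph_ge0 phV)//.
by have := sqr_ge0 (sn V (f t) - 1); have := ph_ge0 phV (f t); nra.
Qed.

Lemma L2T_rintegrable_form beta M f g : bounded_form beta M ->
  dom (L2T V T) f -> dom (L2T V T) g ->
  rintegrable mu D (fun t => beta (f t) (g t)).
Proof.
move=> bb df dg.
have := rintegrableM_sqr mD (L2T_measurable_sn df) (L2T_measurable_sn dg)
  (L2T_rintegrable_sqr df) (L2T_rintegrable_sqr dg).
move=> /(rintegrableZ M mD); apply: le_rintegrable => //.
  by case: df => ? ? _; case: dg => ? ? _; apply: (measurable_form phV bb).
move=> t Dt; rewrite mulrA; apply: (bf_le bb); exact: L2T_dom.
Qed.

Lemma L2T_rintegrable_functional phi M f : bounded_functional phi M ->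
  dom (L2T V T) f -> rintegrable mu D (fun t => phi (f t)).
Proof.
move=> bphi df.
have := rintegrableZ M mD (L2T_rintegrable_sn df); apply: le_rintegrable => //.
  by case: df => ? ? _; apply: (measurable_functional phV bphi).
move=> t Dt; apply: (bl_le bphi); exact: L2T_dom.
Qed.

Definition formT (beta : V -> V -> R) f g := \int[mu]_(t in D) beta (f t) (g t).

Lemma L2T_sn_sqr f : sn (L2T V T) f ^+ 2 = \int[mu]_(t in D) sn V (f t) ^+ 2.
Proof. by rewrite sqr_sqrtr//; apply: Rintegral_ge0 => t _; exact: sqr_ge0. Qed.

Lemma L2T_dom0 : dom (L2T V T) 0.
Proof.
apply: L2T_domI => [t _||]; first exact: (ph_dom0 phV).
  rewrite (_ : 0 = sf_eval (sf_zero phV)); first exact: (strongly_measurable_sf phV).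
  by apply/funext => t; rewrite /sf_eval big_ord0.
apply: eq_rintegrable (rintegrable_cst 0 mD Doo) => // t _.
by rewrite (ph_sn0 phV) expr0n.
Qed.

Lemma L2T_domP (a : R) f g : dom (L2T V T) f -> dom (L2T V T) g ->
  dom (L2T V T) (a *: f + g).
Proof.
move=> df dg.
have dl t : D t -> dom V ((a *: f + g) t).
  by move=> Dt; apply: (ph_domP phV); [exact: (L2T_dom df)|exact: (L2T_dom dg)].
have ml : strongly_measurable D (a *: f + g : R -> V).
  exact: (strongly_measurableP phV _ (L2T_dom df) (L2T_dom dg) (L2T_sm df) (L2T_sm dg)).
apply: L2T_domI => //.
have := rintegrableD mD (rintegrableZ (2 * a ^+ 2) mD (L2T_rintegrable_sqr df))
  (rintegrableZ 2 mD (L2T_rintegrable_sqr dg)).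
apply: le_rintegrable => //; first by apply: measurable_funX; exact: (measurable_sn phV).
move=> t Dt; rewrite ger0_norm ?sqr_ge0//.
have dft := L2T_dom df Dt; have dgt := L2T_dom dg Dt.
have := ph_snD phV (ph_domZ phV a dft) dgt; rewrite (ph_snZ phV)//.
rewrite -[a ^+ 2](real_normK (num_real a)) => h.
have h0 := ph_ge0 phV (a *: f t + g t).
have h1 : sn V (a *: f t + g t) ^+ 2 <= (`|a| * sn V (f t) + sn V (g t)) ^+ 2.
  by rewrite ler_sqr ?nnegrE// (le_trans h0).
have h2 := sqr_ge0 (`|a| * sn V (f t) - sn V (g t)).
apply: le_trans h1 _; move: h2; nra.
Qed.

Lemma L2T_prehilbert : prehilbert (V := L2T V T) (formT b).
Proof.
have pb := ph_bounded_form phV.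
split.
- exact: L2T_dom0.
- exact: L2T_domP.
- move=> a f g h df dg dh; rewrite /formT.
  rewrite -RintegralZl//; last exact: (L2T_rintegrable_form pb).
  rewrite -RintegralD//; last 2 first.
  + by apply: rintegrableZ => //; exact: (L2T_rintegrable_form pb).
  + exact: (L2T_rintegrable_form pb).
  apply: eq_Rintegral => t /set_mem Dt.
  by apply: (ph_lin phV); apply: L2T_dom.
- move=> f g df dg; apply: eq_Rintegral => t /set_mem Dt.
  by apply: (ph_sym phV); exact: L2T_dom.
- by move=> f; exact: sqrtr_ge0.
- move=> f df; rewrite L2T_sn_sqr; apply: eq_Rintegral => t /set_mem Dt.
  by apply: (ph_sn phV); exact: L2T_dom.
Qed.

Lemma L2T_bounded_form beta M : bounded_form beta M ->
  bounded_form (V := L2T V T) (formT beta) M.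
Proof.
move=> bb; split.
- move=> a f g h df dg dh; rewrite /formT.
  rewrite -RintegralZl//; last exact: (L2T_rintegrable_form bb).
  rewrite -RintegralD//; last 2 first.
  + by apply: rintegrableZ => //; exact: (L2T_rintegrable_form bb).
  + exact: (L2T_rintegrable_form bb).
  apply: eq_Rintegral => t /set_mem Dt.
  by apply: (bf_linl bb); apply: L2T_dom.
- move=> a f g h df dg dh; rewrite /formT.
  rewrite -RintegralZl//; last exact: (L2T_rintegrable_form bb).
  rewrite -RintegralD//; last 2 first.
  + by apply: rintegrableZ => //; exact: (L2T_rintegrable_form bb).
  + exact: (L2T_rintegrable_form bb).
  apply: eq_Rintegral => t /set_mem Dt.
  by apply: (bf_linr bb); apply: L2T_dom.
- exact: (bf_ge0 bb).
- move=> f g df dg.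
  have mf := L2T_measurable_sn df; have mg := L2T_measurable_sn dg.
  have f2 := L2T_rintegrable_sqr df; have g2 := L2T_rintegrable_sqr dg.
  have fg := rintegrableM_sqr mD mf mg f2 g2.
  have bfg := L2T_rintegrable_form bb df dg.
  apply: (@le_trans _ _ (\int[mu]_(t in D) (M * (sn V (f t) * sn V (g t))))).
    rewrite (le_trans (le_normr_Rintegral _ bfg))//.
    apply: le_Rintegral => //; first exact: rintegrable_norm.
      exact: rintegrableZ.
    by move=> t Dt; rewrite mulrA; apply: (bf_le bb); exact: L2T_dom.
  rewrite RintegralZl// -mulrA ler_wpM2l ?(bf_ge0 bb)//.
  rewrite -ler_sqr ?nnegrE; last 2 first.
  + by apply: Rintegral_ge0 => t _; rewrite mulr_ge0 ?(ph_ge0 phV).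
  + by rewrite mulr_ge0// sqrtr_ge0.
  by rewrite exprMn !L2T_sn_sqr; exact: Rintegral_cauchy_schwarz.
Qed.

Lemma L2T_bounded f (M : R) : (forall t, D t -> dom V (f t)) ->
  strongly_measurable D (f : R -> V) -> (forall t, D t -> sn V (f t) <= M) ->
  dom (L2T V T) f.
Proof.
move=> df mf fM; apply: L2T_domI => //.
apply: le_rintegrable (rintegrable_cst (M ^+ 2) mD Doo) => //.
  by apply: measurable_funX; exact: (measurable_sn phV).
move=> t Dt; rewrite ger0_norm ?sqr_ge0// ler_sqr ?nnegrE ?(ph_ge0 phV) ?fM//.
by rewrite (le_trans _ (fM _ Dt)) ?(ph_ge0 phV).
Qed.

Lemma L2T_sf (s : simple_fun V) : dom (L2T V T) (sf_eval s).
Proof.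
apply: (L2T_bounded (M := \sum_i sn V (@sf_val R V s i))).
- by move=> t _; exact: sf_eval_dom phV _ _.
- exact: (strongly_measurable_sf phV).
- move=> t _; suff [] : dom V (sf_eval s t) /\
    sn V (sf_eval s t) <= \sum_i sn V (@sf_val R V s i) by [].
  rewrite /sf_eval; elim/big_rec2 : _ => [|i x y _ [dx xy]].
    by rewrite (ph_sn0 phV); split=> //; exact: (ph_dom0 phV).
  have dv := @sf_dom R V s i; have dz := ph_domZ phV (\1_(sf_set i) t) dv.
  split; first by apply: (ph_domD phV).
  rewrite (le_trans (ph_snD phV dz dx))// lerD//.
  rewrite (ph_snZ phV)// ger0_norm// ler_piMl ?(ph_ge0 phV)//.
Qed.

(* The approximants are cut off where they are further than |f| from f, which
   makes dominated convergence applicable. *)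
Lemma L2T_simple_approx f : dom (L2T V T) f -> exists s : nat -> simple_fun V,
  (fun k => sn (L2T V T) (sf_eval (s k) - f)) @ \oo --> (0 : R).
Proof.
move=> df; have [s hs] := L2T_sm df.
have mdiff k : measurable_fun D (fun t => sn V (f t) - sn V (sf_eval (s k) t - f t)).
  apply: measurable_funB; first exact: L2T_measurable_sn.
  exact: L2T_measurable_sn (ph_domB L2T_prehilbert (L2T_sf (s k)) df).
pose B k := D `&` (fun t => sn V (f t) - sn V (sf_eval (s k) t - f t)) @^-1` `[0, +oo[.
have mB k : measurable (B k) by apply: mdiff => //; exact: measurable_itv.
pose r k := sf_restrict (mB k) (s k).
have rE k t : (sf_eval (r k) - f) t = \1_(B k) t *: sf_eval (s k) t - f t.
  exact: (f_equal (fun z => z - f t) (sf_eval_restrict (mB k) (s k) t)).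
have dr k : dom (L2T V T) (sf_eval (r k) - f).
  exact: (ph_domB L2T_prehilbert (L2T_sf (r k)) df).
have le_r k t : D t -> sn V ((sf_eval (r k) - f) t) <= sn V (f t).
  move=> Dt; have dft := L2T_dom df Dt.
  rewrite rE.
  rewrite indicE; case: (boolP (t \in B k)) => [/set_mem[_]|_].
    by rewrite /= in_itv/= andbT subr_ge0 scale1r.
  by rewrite scale0r sub0r (ph_snN phV).
exists r.
suff h : (fun k => \int[mu]_(t in D) sn V ((sf_eval (r k) - f) t) ^+ 2) @ \oo
  --> (0 : R) by exact: sqrt_cvg0 h.
apply: (Rintegral_cvg0 (mu := mu) (D := D)
  (f_ := fun k t => sn V ((sf_eval (r k) - f) t) ^+ 2)
  (g := fun t => sn V (f t) ^+ 2)) => //.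
- by move=> k; apply: measurable_funX; exact: (L2T_measurable_sn (dr k)).
- exact: L2T_rintegrable_sqr.
- move=> k t Dt; rewrite ger0_norm ?sqr_ge0// ler_sqr ?nnegrE ?(ph_ge0 phV)//.
  exact: le_r.
- move=> t Dt; apply: sqr_cvg0.
  have [f0|f0] := eqVneq (sn V (f t)) 0.
    apply: (squeeze0 (v := fun=> 0)) => [k|]; last exact: cvg_cst.
    by rewrite ger0_norm ?(ph_ge0 phV)// -f0 le_r.
  have fp : 0 < sn V (f t) by rewrite lt_def f0 (ph_ge0 phV).
  apply: cvg_trans (hs t Dt); apply: near_eq_cvg.
  have /cvgrPdist_lt/(_ _ fp) := hs t Dt; apply: filterS => k.
  rewrite sub0r normrN ger0_norm ?(ph_ge0 phV)// => hk.
  rewrite rE.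
  by rewrite indicE mem_set ?scale1r//; split => //=; rewrite in_itv/= andbT subr_ge0 ltW.
Qed.

End L2T_theory.

(** * Real integrals over subintervals *)

Section interval_integral.
Variables (R : realType) (T : R).
Local Notation mu := (@lebesgue_measure R).

Lemma rintegrable_sub_itv (f : R -> R) (s t : R) : rintegrable mu `[0, T] f ->
  0 <= s -> t <= T -> rintegrable mu `[s, t] f.
Proof.
move=> fi s0 tT; apply: rintegrableS fi => //; try exact: measurable_itv.
by apply: subset_itv; rewrite bnd_simp.
Qed.

Lemma Rintegral_itvcc_sub (f : R -> R) (s t : R) : rintegrable mu `[0, T] f ->
  0 <= s -> s <= t -> t <= T ->
  \int[mu]_(x in `[s, t]) f x =
  \int[mu]_(x in `[0, t]) f x - \int[mu]_(x in `[0, s]) f x.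
Proof.
move=> fi s0 st tT; rewrite Rintegral_itvB ?bnd_simp//; last first.
  exact: rintegrable_sub_itv fi _ _.
by rewrite Rintegral_itv_obnd_cbnd//; apply: rintegrableS
  (rintegrable_sub_itv fi s0 tT) => //; try exact: measurable_itv; exact: subset_itv_oc_cc.
Qed.

(* Telescoping over equidistant partitions. *)
Lemma eq_of_small_increments (e G : R -> R) (K s t : R) : 0 <= K -> s <= t ->
  (forall x y, s <= x -> x <= y -> y <= t ->
     `|e y - e x| <= K * Num.sqrt (y - x) * (G y - G x)) ->
  e t = e s.
Proof.
move=> K0 st h; pose x N i := s + i%:R / N.+1%:R * (t - s).
have xS N i : x N i.+1 - x N i = N.+1%:R^-1 * (t - s).
  by rewrite /x -(natr1 i); ring.
have xle N i : (i <= N.+1)%N -> s <= x N i <= t.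
  move=> iN; rewrite lerDl mulr_ge0 ?divr_ge0 ?subr_ge0//=.
  rewrite -lerBrDl ler_piMl ?subr_ge0// ler_pdivrMr ?ltr0n// mul1r ler_nat//.
have x0 N : x N 0%N = s by rewrite /x mul0r mul0r addr0.
have xN N : x N N.+1 = t by rewrite /x divff ?mul1r ?pnatr_eq0// subrKC.
(* All pieces share the factor square root of the mesh, the increments of [G] add up to [G t - G s],
   and the mesh tends to 0. *)
have bound N : `|e t - e s| <= K * Num.sqrt (N.+1%:R^-1 * (t - s)) * (G t - G s).
  have hi i : (i <= N.+1)%N ->
      `|e (x N i) - e s| <= K * Num.sqrt (N.+1%:R^-1 * (t - s)) * (G (x N i) - G s).
    elim: i => [_|i ih iN]; first by rewrite x0 !subrr normr0 mulr0.
    rewrite -(subrKA (e (x N i))) (le_trans (ler_normD _ _))//.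
    rewrite -[G _ - G s](subrKA (G (x N i))) mulrDr lerD ?ih 1?ltnW//.
    rewrite -(xS N i); apply: h.
    - by have /andP[] := xle N i (ltnW iN).
    - by rewrite -subr_ge0 xS mulr_ge0 ?subr_ge0.
    - by have /andP[] := xle N i.+1 iN.
  by have := hi N.+1 (leqnn _); rewrite xN.
apply/eqP; rewrite -subr_eq0 -normr_le0.
have cv : (fun N => K * Num.sqrt (N.+1%:R^-1 * (t - s)) * (G t - G s)) @ \oo --> (0 : R).
  rewrite -[X in _ --> X](mul0r (G t - G s)); apply: cvgMl.
  rewrite -[X in _ --> X](mulr0 K); apply: cvgMr; apply: sqrt_cvg0.
  by rewrite -[X in _ --> X](mul0r (t - s)); apply: cvgMl; exact: cvg_harmonic.
rewrite -(cvg_lim (@Rhausdorff R) cv); apply: limr_ge.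
  by apply/cvg_ex; eexists; exact: cv.
exact: nearW.
Qed.

End interval_integral.

(** * Bounded linear maps applied pointwise in time *)

Section bounded_linear_L2T.
Variables (R : realType) (V W : snspace R).
Variables (bV : V -> V -> R) (bW : W -> W -> R).
Hypotheses (phV : prehilbert bV) (phW : prehilbert bW).
Variable L : V -> W.
Hypothesis bL : bounded_linear L.

Let dL x : dom V x -> dom W (L x). Proof. by case: bL => + _ _; exact. Qed.

(** [L x - L y] and [L (x - y)] are different representatives; their difference has seminorm 0, and
    the triangle inequality absorbs it. *)
Lemma bounded_linear_sub x y : dom V x -> dom V y ->
  sn W (L x - L y) <= sn W (L (x - y)).
Proof.
move=> dx dy; have [_ linL _] := bL; have dxy := ph_domB phV dx dy.
have := linL 1 (x - y) y dxy dy; rewrite !scale1r subrK => h.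
rewrite (_ : L x - L y = (L x - (L (x - y) + L y)) + L (x - y)); last first.
  by rewrite opprD !addrA addrAC subrK.
have d1 : dom W (L x - (L (x - y) + L y)).
  by apply: (ph_domB phW); [exact: dL|apply: (ph_domD phW); exact: dL].
by rewrite (le_trans (ph_snD phW d1 (dL dxy)))// h add0r.
Qed.

Lemma bounded_linear_dist : exists2 C : R, 0 <= C &
  forall x y, dom V x -> dom V y -> sn W (L x - L y) <= C * sn V (x - y).
Proof.
have [_ _ [C hC]] := bL; exists `|C| => // x y dx dy.
have dxy := ph_domB phV dx dy.
rewrite (le_trans (bounded_linear_sub dx dy))// (le_trans (hC _ dxy))//.
by rewrite ler_wpM2r ?(ph_ge0 phV)// ler_norm.
Qed.

Let Lsum (I : Type) (r : seq I) (c : I -> R) (v : I -> V) :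
  (forall i, dom V (v i)) ->
  sn W (\sum_(i <- r) c i *: L (v i) - L (\sum_(i <- r) c i *: v i)) = 0.
Proof.
move=> dv; have le0 x : sn W x <= 0 -> sn W x = 0.
  by move=> x0; apply/eqP; rewrite eq_le x0 (ph_ge0 phW).
case: bL => _ linL [C hC]; elim: r => [|i r ih].
  have d0 := ph_dom0 phV; rewrite !big_nil sub0r (ph_snN phW); last exact: dL.
  by apply: le0; rewrite (le_trans (hC _ d0))// (ph_sn0 phV) mulr0.
have dS : dom V (\sum_(j <- r) c j *: v j).
  by apply: (ph_dom_sum phV) => j _; apply: (ph_domZ phV).
have dLS : dom W (\sum_(j <- r) c j *: L (v j)).
  by apply: (ph_dom_sum phW) => j _; apply: (ph_domZ phW); exact: dL.
rewrite !big_cons; apply: le0.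
have := linL (c i) _ _ (dv i) dS; set X := L (_ *: _ + _) => hX.
have dX : dom W X by apply: dL; apply: (ph_domP phV).
have dci : dom W (c i *: L (v i)) by apply: (ph_domZ phW); exact: dL.
have dY : dom W (c i *: L (v i) + L (\sum_(j <- r) c j *: v j)).
  by apply: (ph_domD phW) => //; exact: dL.
have dZ := ph_domD phW dci dLS.
apply: (le_trans (ph_snB3 phW dZ dY dX)).
rewrite (ph_snBC phW dY dX) hX addr0 opprD addrACA subrr add0r.
by rewrite ih.
Qed.

(** The image of a simple function is a simple function only up to seminorm 0, which does not
    disturb the limit. *)
Lemma strongly_measurable_map D (f : R -> V) : (forall t, D t -> dom V (f t)) ->
  strongly_measurable D f -> strongly_measurable D (L \o f).
Proof.
move=> df [s hs]; have [C C0 hC] := bounded_linear_dist.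
exists (fun k => sf_map bL (s k)) => t Dt.
apply: (squeeze0 (v := fun k => C * sn V (sf_eval (s k) t - f t))) => [k|].
  rewrite ger0_norm ?(ph_ge0 phW)//.
  have d1 := sf_eval_dom phW (sf_map bL (s k)) t.
  have d2 := sf_eval_dom phV (s k) t.
  rewrite (le_trans (ph_snB3 phW d1 (dL d2) (dL (df _ Dt))))//.
  rewrite [X in X + _](_ : _ = 0) ?add0r; first by apply: hC => //; exact: df.
  by apply: Lsum => i; exact: sf_dom.
by rewrite -[X in _ --> X](mulr0 C); apply: cvgMr; exact: hs.
Qed.

Lemma L2T_map (T : R) (f : L2T V T) : dom (L2T V T) f -> dom (L2T W T) (L \o f).
Proof.
move=> df; have df' := L2T_dom df.
have dLf t : `[0, T]%classic t -> dom W ((L \o f) t) by move=> Dt; exact/dL/df'.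
have mLf := strongly_measurable_map df' (L2T_sm df).
suff h : rintegrable (@lebesgue_measure R) `[0, T] (fun t => sn W ((L \o f) t) ^+ 2).
  exact: (@L2T_domI R W T (L \o f) dLf mLf h).
case: bL => _ _ [C hC].
have mD : measurable (`[0, T]%classic : set (measurableTypeR R)) by exact: measurable_itv.
have := rintegrableZ (C ^+ 2) mD (L2T_rintegrable_sqr phV df).
apply: le_rintegrable => //; first by apply: measurable_funX; exact: (measurable_sn phW).
move=> t Dt; rewrite ger0_norm ?sqr_ge0// -exprMn.
have := hC _ (df' _ Dt); have := ph_ge0 phW (L (f t)) => h1 h2.
by rewrite ler_sqr ?nnegrE// (le_trans h1).
Qed.

Lemma L2T_map_dist (T : R) (C : R) (f g : L2T V T) : 0 <= C ->
  (forall x y, dom V x -> dom V y -> sn W (L x - L y) <= C * sn V (x - y)) ->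
  dom (L2T V T) f -> dom (L2T V T) g ->
  sn (L2T W T) ((L \o f) - (L \o g)) <= C * sn (L2T V T) (f - g).
Proof.
move=> C0 hC df dg; have dfg := ph_domB (L2T_prehilbert T phV) df dg.
have dL2 := ph_domB (L2T_prehilbert T phW) (L2T_map df) (L2T_map dg).
rewrite -ler_sqr ?nnegrE ?mulr_ge0 ?sqrtr_ge0// exprMn !L2T_sn_sqr.
have mD : measurable (`[0, T]%classic : set (measurableTypeR R)) by exact: measurable_itv.
have i1 := L2T_rintegrable_sqr phV dfg; have i2 := L2T_rintegrable_sqr phW dL2.
rewrite -RintegralZl//; apply: le_Rintegral => //; first exact: rintegrableZ.
move=> t Dt; rewrite -exprMn ler_sqr ?nnegrE ?mulr_ge0 ?(ph_ge0 phV) ?(ph_ge0 phW)//.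
by apply: hC; [exact: (L2T_dom df)|exact: (L2T_dom dg)].
Qed.

End bounded_linear_L2T.

Section continuous_strongly_measurable.
Variables (R : realType) (V : snspace R) (b : V -> V -> R) (T : R).
Hypotheses (phV : prehilbert b) (T0 : 0 < T).
Local Notation D := (`[0, T]%classic : set R).

Lemma strongly_measurable_continuous (u : R -> V) :
  (forall t, D t -> dom V (u t)) ->
  (forall e, 0 < e -> exists2 d, 0 < d & forall s t, D s -> D t ->
     `|t - s| < d -> sn V (u t - u s) < e) ->
  strongly_measurable D u.
Proof.
move=> du uc; pose h k : R := T / k.+1%:R.
have h0 k : 0 < h k by rewrite divr_gt0.
have Dh k (i : 'I_k.+2) : D (i%:R * h k).
  rewrite /= in_itv/= mulr_ge0 ?(ltW (h0 k))//= mulrCA ler_piMr ?(ltW T0)//.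
  by rewrite ler_pdivrMr ?ltr0n// mul1r ler_nat -ltnS.
(* The mesh is T/(k+1), yet there are k+2 half-open intervals: the last one starts at T and is there
   to cover the endpoint t = T. *)
pose s k : simple_fun V := @SimpleFun R V k.+2
  (fun i => `[i%:R * h k, i.+1%:R * h k[%classic) (fun i => u (i%:R * h k))
  (fun i => measurable_itv _) (fun i => du _ (Dh k i)).
exists s => t Dt.
have sE k : exists2 r, D r & `|r - t| < h k /\ sf_eval (s k) t = u r.
  have t0 : 0 <= t / h k.
    by move: Dt; rewrite /= in_itv/= => /andP[t0 _]; rewrite divr_ge0// ltW.
  have /andP[n1 n2] := truncn_itv t0; set n := Num.truncn _ in n1 n2.
  have nk : (n < k.+2)%N.
    rewrite -(@ltr_nat R) (le_lt_trans n1)// ltr_pdivrMr// mulrCA.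
    move: Dt; rewrite /= in_itv/= => /andP[_ tT]; rewrite (le_lt_trans tT)//.
    by rewrite ltr_pMr// ltr_pdivlMr ?ltr0n// mul1r ltr_nat.
  exists (n%:R * h k); first exact: (Dh k (Ordinal nk)).
  rewrite ler_pdivlMr// in n1; rewrite ltr_pdivrMr// in n2; split.
    rewrite distrC ger0_norm ?subr_ge0// ltrBlDl -[X in _ + X]mul1r -mulrDl natr1//.
  rewrite /sf_eval (bigD1 (Ordinal nk))//= big1 ?addr0 => [|i /eqP ni].
    by rewrite indicE mem_set ?scale1r//= in_itv/= n1 n2.
  rewrite indicE memNset ?scale0r//= in_itv/= => /andP[i1 i2]; apply: ni.
  apply/val_inj => /=; apply/eqP; rewrite eqn_leq.
  apply/andP; split; rewrite -ltnS -(@ltr_nat R) -(ltr_pM2r (h0 k)).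
    exact: le_lt_trans i1 n2.
  exact: le_lt_trans n1 i2.
apply/cvgrPdist_lt => e e0; have [d d0 hd] := uc e e0.
have : (fun k => h k) @ \oo --> (0 : R).
  by rewrite -[X in _ --> X](mulr0 T); apply: cvgMr; exact: cvg_harmonic.
move=> /cvgrPdist_lt/(_ d d0); apply: filterS => k.
rewrite !sub0r !normrN ger0_norm ?(ltW (h0 k))// ger0_norm ?(ph_ge0 phV)// => hk.
have [r Dr [rt ->]] := sE k; apply: hd => //.
exact: lt_trans hk.
Qed.

End continuous_strongly_measurable.

(** * Primitives and Sobolev functions in time *)

Section primitive_theory.
Variables (R : realType) (V : snspace R) (b : V -> V -> R) (T : R).
Hypotheses (phV : prehilbert b) (T0 : 0 < T).
Local Notation mu := (@lebesgue_measure R).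
Local Notation D := (`[0, T]%classic : set R).

Let mD : measurable (D : set (measurableTypeR R)). Proof. exact: measurable_itv. Qed.
Let Doo : (mu D < +oo)%E. Proof. exact: lebesgue_itvcc_lty. Qed.
Let mI (s t : R) : measurable (`[s, t]%classic : set (measurableTypeR R)).
Proof. exact: measurable_itv. Qed.

(* [u] is a primitive of [u'] when tested with bounded functionals. Unlike the
   Bochner integral this passes to images under maps that are linear only
   modulo the seminorm. *)
Definition primitive (u u' : R -> V) :=
  [/\ dom (L2T V T) u',
      forall t, D t -> dom V (u t) &
      forall phi M, bounded_functional phi M ->
        forall s t, 0 <= s -> s <= t -> t <= T ->
          phi (u t - u s) = \int[mu]_(x in `[s, t]) phi (u' x)].

Let in_D (t : R) : 0 <= t -> t <= T -> D t.
Proof. by move=> t0 tT; rewrite /= in_itv/= t0 tT. Qed.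

Let sub_D (s t x : R) : 0 <= s -> t <= T -> `[s, t]%classic x -> D x.
Proof.
move=> s0 tT; rewrite /= !in_itv/= => /andP[sx xt].
by rewrite (le_trans s0 sx) (le_trans xt tT).
Qed.

(** For simple functions a functional commutes with the integral by finite additivity; both sides
    are limits of these values, with error at most [M] times the integral of the seminorm of the
    approximation error. *)
Lemma bochner_integral_functional (phi : V -> R) M (g : L2T V T) (v : V) (s t : R) :
  bounded_functional phi M -> dom (L2T V T) g -> dom V v ->
  0 <= s -> t <= T ->
  bochner_integral `[s, t] (g : R -> V) v ->
  phi v = \int[mu]_(x in `[s, t]) phi (g x).
Proof.
move=> bphi dg dv s0 tT [r [r1 r2]].
have dk k := L2T_sf T phV (r k).
have dd k := ph_domB (L2T_prehilbert T phV) (dk k) dg.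
pose e k x := sn V (sf_eval (r k) x - g x).
have ie k : rintegrable mu `[s, t] (e k).
  exact: (rintegrable_sub_itv (L2T_rintegrable_sn phV (dd k)) s0 tT).
have e0 : (fun k => \int[mu]_(x in `[s, t]) e k x) @ \oo --> (0 : R) by exact: (fine_cvg r1).
have p1 : (fun k => phi (sf_integral `[s, t] (r k))) @ \oo --> phi v.
  by apply: (functional_cvg phV bphi) => // k; exact: (sf_integral_dom phV).
apply: (cvg_unique (@Rhausdorff R) p1); apply/cvg_sub0P.
apply: (squeeze0 (v := fun k => M * \int[mu]_(x in `[s, t]) e k x)) => [k|]; last first.
  by rewrite -[X in _ --> X](mulr0 M); apply: cvgMr.
have i1 := rintegrable_sub_itv (L2T_rintegrable_functional phV bphi (dk k)) s0 tT.
have i2 := rintegrable_sub_itv (L2T_rintegrable_functional phV bphi dg) s0 tT.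
rewrite -(functional_sf_integral phV (r k) bphi (mI s t)) ?lebesgue_itvcc_lty//.
rewrite -RintegralB//; have i3 := rintegrableB (mI s t) i1 i2.
rewrite (le_trans (le_normr_Rintegral _ i3))// -RintegralZl//; last exact: ie.
apply: le_Rintegral => //; [exact: rintegrable_norm|exact: rintegrableZ|].
move=> x sx; have Dx := sub_D s0 tT sx.
have d1 := L2T_dom (dk k) Dx; have d2 := L2T_dom dg Dx.
by rewrite -(blB phV bphi)//; apply: (bl_le bphi); apply: (ph_domB phV).
Qed.

Lemma H1T_primitive (u : H1T V T) : dom (H1T V T) u -> primitive u.1 u.2.
Proof.
move=> [du' du hu]; split=> // phi M bphi s t s0 st tT.
apply: (bochner_integral_functional bphi) => //; last exact: hu.
by apply: (ph_domB phV); apply: du; apply: in_D => //; [exact: le_trans st|exact: le_trans tT].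
Qed.

Section one.
Variables u u' : R -> V.
Hypothesis pu : primitive u u'.

Let du' : dom (L2T V T) u'. Proof. by case: pu. Qed.
Lemma primitive_dom t : D t -> dom V (u t). Proof. by case: pu => _ + _; exact. Qed.
Let du := primitive_dom.
Local Notation N := (sn (L2T V T) u').

(** Testing with the functional [b^~ w] for the increment [w] itself bounds its square by [sn V w]
    times the integral; then divide by [sn V w]. *)
Lemma primitive_sn_le s t : 0 <= s -> s <= t -> t <= T ->
  sn V (u t - u s) <= \int[mu]_(x in `[s, t]) sn V (u' x).
Proof.
move=> s0 st tT; set w := u t - u s.
have dw : dom V w.
  by apply: (ph_domB phV); apply: du; apply: in_D => //; [exact: le_trans st|exact: le_trans tT].
have is' := rintegrable_sub_itv (L2T_rintegrable_sn phV du') s0 tT.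
have [w0|wn0] := eqVneq (sn V w) 0.
  by rewrite w0; apply: Rintegral_ge0 => x _; exact: (ph_ge0 phV).
have wp : 0 < sn V w by rewrite lt_def wn0 (ph_ge0 phV).
rewrite -(ler_pM2l wp) -expr2 (ph_sn phV)// -RintegralZl//.
have bw := bf_functionall phV (ph_bounded_form phV) dw.
case: pu => _ _ /(_ _ _ bw s t s0 st tT) ->.
apply: le_Rintegral => //.
- exact: rintegrable_sub_itv (L2T_rintegrable_functional phV bw du') s0 tT.
- exact: rintegrableZ.
- move=> x sx; rewrite (le_trans (ler_norm _))// (le_trans (bl_le bw _)) ?mul1r//.
  exact: (L2T_dom du' (sub_D s0 tT sx)).
Qed.

Lemma primitive_sn_sqr_le s t : 0 <= s -> s <= t -> t <= T ->
  sn V (u t - u s) ^+ 2 <= (t - s) * \int[mu]_(x in `[s, t]) sn V (u' x) ^+ 2.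
Proof.
move=> s0 st tT; have h := primitive_sn_le s0 st tT.
have I0 : 0 <= \int[mu]_(x in `[s, t]) sn V (u' x).
  by apply: Rintegral_ge0 => x _; exact: (ph_ge0 phV).
apply: (@le_trans _ _ ((\int[mu]_(x in `[s, t]) sn V (u' x)) ^+ 2)).
  by rewrite ler_sqr ?nnegrE// (ph_ge0 phV).
have i1 := rintegrable_cst 1 (mI s t) (lebesgue_itvcc_lty s t).
have i2 := rintegrable_sub_itv (L2T_rintegrable_sn phV du') s0 tT.
have i3 := rintegrable_sub_itv (L2T_rintegrable_sqr phV du') s0 tT.
have := Rintegral_cauchy_schwarz (f := fun=> 1) (mI s t) (measurable_cst _)
  (rintegrable_measurable i2) _ i3.
under [X in rintegrable _ _ X -> _]eq_fun do rewrite expr1n.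
move=> /(_ i1); under eq_Rintegral do rewrite mul1r.
by under [X in _ <= X * _]eq_Rintegral do rewrite expr1n;
  rewrite Rintegral_cst// mul1r fine_lebesgue_itvcc.
Qed.

Lemma primitive_holder s t : D s -> D t ->
  sn V (u t - u s) <= Num.sqrt `|t - s| * N.
Proof.
wlog st : s t / s <= t => [hwlog Ds Dt|Ds Dt].
  have [st|/ltW st] := leP s t; first exact: hwlog.
  by rewrite (ph_snBC phV (du Dt) (du Ds)) distrC; exact: hwlog.
have [s0 tT] : 0 <= s /\ t <= T.
  by move: Ds Dt; rewrite /= !in_itv/= => /andP[? _] /andP[_ ?].
rewrite -ler_sqr ?nnegrE ?mulr_ge0 ?sqrtr_ge0 ?(ph_ge0 phV)//.
rewrite exprMn sqr_sqrtr// ger0_norm ?subr_ge0// L2T_sn_sqr.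
apply: le_trans (primitive_sn_sqr_le s0 st tT) _.
rewrite ler_wpM2l ?subr_ge0//; apply: Rintegral_subset => //.
- by move=> x; exact: (sub_D s0 tT).
- by move=> x _; exact: sqr_ge0.
- exact: (L2T_rintegrable_sqr phV).
Qed.

Lemma primitive_bound t : D t -> sn V (u t) <= sn V (u 0) + Num.sqrt T * N.
Proof.
move=> Dt; have D0 : D 0 by apply: in_D => //; exact: ltW.
rewrite (le_trans (ph_sn_le phV (du Dt) (du D0)))// lerD2l.
rewrite (le_trans (primitive_holder D0 Dt))// ler_wpM2r ?sqrtr_ge0//.
move: Dt; rewrite /= in_itv/= => /andP[t0 tT].
by rewrite subr0 ger0_norm// ler_sqrt// (le_trans t0).
Qed.

Lemma primitive_uniform_continuous e : 0 < e -> exists2 d, 0 < d &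
  forall s t, D s -> D t -> `|t - s| < d -> sn V (u t - u s) < e.
Proof.
move=> e0; have N0 : 0 <= N by exact: sqrtr_ge0.
have N1 : 0 < N + 1 by rewrite ltr_wpDl.
exists ((e / (N + 1)) ^+ 2) => [|s t Ds Dt h]; first by rewrite exprn_gt0// divr_gt0.
rewrite (le_lt_trans (primitive_holder Ds Dt))//.
have : Num.sqrt `|t - s| < e / (N + 1).
  by rewrite -ltr_sqr ?nnegrE ?sqrtr_ge0 ?divr_ge0 ?(ltW e0) ?(ltW N1)// sqr_sqrtr.
rewrite ltr_pdivlMr//; apply: le_lt_trans.
by rewrite ler_wpM2l ?sqrtr_ge0// lerDl.
Qed.

Lemma primitive_L2T : dom (L2T V T) u.
Proof.
apply: (L2T_bounded phV du (M := sn V (u 0) + Num.sqrt T * N)); last exact: primitive_bound.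
exact: strongly_measurable_continuous phV T0 _ du primitive_uniform_continuous.
Qed.

Lemma primitive_rintegrable_functional phi M s t : bounded_functional phi M ->
  0 <= s -> t <= T -> rintegrable mu `[s, t] (fun x => phi (u' x)).
Proof.
move=> bphi s0 tT.
exact: rintegrable_sub_itv (L2T_rintegrable_functional phV bphi du') s0 tT.
Qed.

End one.

Lemma primitiveP (a : R) (u u' v v' : R -> V) : primitive u u' -> primitive v v' ->
  primitive (a *: u + v) (a *: u' + v').
Proof.
move=> pu pv; have [du' du hu] := pu; have [dv' dv hv] := pv; split.
- exact: (L2T_domP phV).
- by move=> t Dt; apply: (ph_domP phV); [exact: du|exact: dv].
- move=> phi M bphi s t s0 st tT.
  have Ds : D s by apply: in_D => //; exact: le_trans tT.
  have Dt : D t by apply: in_D => //; exact: le_trans st.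
  rewrite [X in phi X](_ : _ = a *: (u t - u s) + (v t - v s)); last first.
    by rewrite scalerBr addrACA -opprD.
  rewrite (bl_lin bphi); [|by apply: (ph_domB phV); (exact: du || exact: dv)..].
  rewrite (hu _ _ bphi)// (hv _ _ bphi)//.
  have i1 := primitive_rintegrable_functional pu bphi s0 tT.
  have i2 := primitive_rintegrable_functional pv bphi s0 tT.
  rewrite -RintegralZl// -RintegralD//; last exact: rintegrableZ.
  apply: eq_Rintegral => x /set_mem /(sub_D s0 tT) Dx; rewrite (bl_lin bphi)//.
    exact: (L2T_dom du').
  exact: (L2T_dom dv').
Qed.

Lemma primitiveB (u u' v v' : R -> V) : primitive u u' -> primitive v v' ->
  primitive (u - v) (u' - v').
Proof.
move=> pu pv; have := primitiveP (-1) pv pu.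
by rewrite !scaleN1r ![- _ + _]addrC.
Qed.

Lemma primitive_product beta M (u u' v v' : R -> V) (t : R) :
  bounded_form beta M -> primitive u u' -> primitive v v' -> 0 <= t -> t <= T ->
  \int[mu]_(x in `[0, t]) (beta (u' x) (v x) + beta (u x) (v' x)) =
  beta (u t) (v t) - beta (u 0) (v 0).
Proof.
move=> bb pu pv t0 tT; have [du' du hu] := pu; have [dv' dv hv] := pv.
have dLu := primitive_L2T pu; have dLv := primitive_L2T pv.
pose f x := beta (u' x) (v x) + beta (u x) (v' x).
have fi : rintegrable mu D f.
  by apply: rintegrableD => //; exact: (L2T_rintegrable_form phV bb).
pose g x := sn V (u' x) + sn V (v' x).
have gi : rintegrable mu D g.
  by apply: rintegrableD => //; exact: (L2T_rintegrable_sn phV).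
pose e x := beta (u x) (v x) - \int[mu]_(r in `[0, x]) f r.
pose G x := \int[mu]_(r in `[0, x]) g r.
suff h : e t = e 0.
  move: h; rewrite /e set_itv1 Rintegral_set1 subr0 => <-.
  by rewrite opprB addrC subrK.
have [Nu Nu0 holder_u] : exists2 N, 0 <= N & forall r1 r2, D r1 -> D r2 ->
    sn V (u r2 - u r1) <= Num.sqrt `|r2 - r1| * N.
  by exists (sn (L2T V T) u'); [exact: sqrtr_ge0|exact: primitive_holder].
have [Nv Nv0 holder_v] : exists2 N, 0 <= N & forall r1 r2, D r1 -> D r2 ->
    sn V (v r2 - v r1) <= Num.sqrt `|r2 - r1| * N.
  by exists (sn (L2T V T) v'); [exact: sqrtr_ge0|exact: primitive_holder].
apply: (eq_of_small_increments (G := G)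
  (K := M * (Nu + Nv))) => //.
  by rewrite mulr_ge0 ?(bf_ge0 bb) ?addr_ge0.
move=> x y x0 xy yt; have yT := le_trans yt tT.
have Dx : D x by apply: in_D => //; exact: le_trans yT.
have Dy : D y by apply: in_D => //; exact: le_trans xy.
have bl1 := bf_functionall phV bb (dv _ Dy).
have bl2 := bf_functionalr phV bb (du _ Dx).
have i1 := primitive_rintegrable_functional pu bl1 x0 yT.
have i2 := primitive_rintegrable_functional pv bl2 x0 yT.
have fxy := rintegrable_sub_itv fi x0 yT.
have gxy := rintegrable_sub_itv gi x0 yT.
rewrite /G -(Rintegral_itvcc_sub gi x0 xy yT).
have -> : e y - e x = \int[mu]_(r in `[x, y])
    (beta (u' r) (v y) + beta (u x) (v' r) - f r).
  rewrite RintegralB//; last exact: rintegrableD.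
  rewrite RintegralD//.
  rewrite -(hu _ _ bl1 x y x0 xy yT) -(hv _ _ bl2 x y x0 xy yT).
  rewrite (Rintegral_itvcc_sub fi x0 xy yT) /e.
  rewrite (bfBl phV bb) ?(bfBr phV bb)//; try by [exact: du|exact: dv].
  by ring.
set I1 := (fun r => _ - f r).
have iI : rintegrable mu `[x, y] I1 by apply: rintegrableB => //; exact: rintegrableD.
rewrite (le_trans (le_normr_Rintegral _ iI))// -RintegralZl//.
apply: le_Rintegral => //; [exact: rintegrable_norm|exact: rintegrableZ|].
move=> r rxy; have Dr := sub_D x0 yT rxy.
have du'r := L2T_dom du' Dr; have dv'r := L2T_dom dv' Dr.
have -> : I1 r = beta (u' r) (v y - v r) - beta (u r - u x) (v' r).
  rewrite /I1 /f (bfBr phV bb) ?(bfBl phV bb)//; try by [exact: du|exact: dv].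
  by ring.
have dvv := ph_domB phV (dv _ Dy) (dv _ Dr).
have duu := ph_domB phV (du _ Dr) (du _ Dx).
rewrite (le_trans (ler_normB _ _))//.
rewrite (le_trans (lerD (bf_le bb du'r dvv) (bf_le bb duu dv'r)))//.
have sq a c : x <= a -> a <= c -> c <= y -> Num.sqrt `|c - a| <= Num.sqrt (y - x).
  by move=> xa ac cy; rewrite ger0_norm ?subr_ge0// ler_sqrt ?subr_ge0// lerB.
move: rxy; rewrite /= in_itv/= => /andP[xr ry].
have h1 : sn V (v y - v r) <= Num.sqrt (y - x) * Nv.
  rewrite (le_trans (holder_v _ _ Dr Dy))// ler_wpM2r//.
  exact: sq.
have h2 : sn V (u r - u x) <= Num.sqrt (y - x) * Nu.
  rewrite (le_trans (holder_u _ _ Dx Dr))// ler_wpM2r//.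
  exact: sq.
rewrite -!mulrA -mulrDr ler_wpM2l ?(bf_ge0 bb)// /g.
have a1 := ph_ge0 phV (u' r); have a2 := ph_ge0 phV (v' r).
have a3 := sqrtr_ge0 (y - x).
have k1 := ler_wpM2l a1 h1; have k2 := ler_wpM2r a2 h2.
rewrite (le_trans (lerD k1 k2))//.
have p1 : 0 <= Num.sqrt (y - x) * (Nu * sn V (u' r)) by rewrite !mulr_ge0.
have p2 : 0 <= Num.sqrt (y - x) * (Nv * sn V (v' r)) by rewrite !mulr_ge0.
rewrite -subr_ge0; move: (addr_ge0 p1 p2); congr (0 <= _); ring.
Qed.

End primitive_theory.

Lemma primitive_map (R : realType) (V W : snspace R) (bV : V -> V -> R)
    (bW : W -> W -> R) (L : V -> W) (T : R) (u u' : R -> V) :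
  prehilbert bV -> prehilbert bW -> bounded_linear L ->
  primitive T u u' -> primitive T (L \o u) (L \o u').
Proof.
move=> phV phW bL [du' du hu]; have dL x : dom V x -> dom W (L x) by case: bL => + _ _; exact.
split.
- exact: (L2T_map phV phW bL du').
- by move=> t /du; exact: dL.
- move=> phi M bphi s t s0 st tT.
  have [M' bphi'] := bounded_linear_comp phV phW bL bphi.
  rewrite -(hu _ _ bphi')//= (blB phW bphi) -?(blB phV bphi')//.
  + by apply: du; rewrite /= in_itv/= (le_trans s0)//.
  + by apply: du; rewrite /= in_itv/= s0 (le_trans st).
  + by apply/dL/du; rewrite /= in_itv/= (le_trans s0)//.
  + by apply/dL/du; rewrite /= in_itv/= s0 (le_trans st).
Qed.

(** * Sobolev functions of time as a space with an inner product *)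

Section H1T_theory.
Variables (R : realType) (V : snspace R) (b : V -> V -> R) (T : R).
Hypotheses (phV : prehilbert b) (T0 : 0 < T).
Local Notation mu := (@lebesgue_measure R).
Local Notation D := (`[0, T]%classic : set R).

Let mI (s t : R) : measurable (`[s, t]%classic : set (measurableTypeR R)).
Proof. exact: measurable_itv. Qed.

Let sub_D (s t x : R) : 0 <= s -> t <= T -> `[s, t]%classic x -> D x.
Proof.
move=> s0 tT; rewrite /= !in_itv/= => /andP[sx xt].
by rewrite (le_trans s0 sx) (le_trans xt tT).
Qed.

Let D0 : D 0. Proof. by rewrite /= in_itv/= lexx ltW. Qed.
Let DT : D T. Proof. by rewrite /= in_itv/= lexx ltW. Qed.

(** This makes [dom (H1T V T)] a linear subspace, as its definition asks for Bochner integrals and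
    not for tested ones. *)
Lemma bochner_integralP (a : R) (f g : L2T V T) (v w : V) (s t : R) :
  dom (L2T V T) f -> dom (L2T V T) g -> dom V v -> dom V w ->
  0 <= s -> t <= T ->
  bochner_integral `[s, t] (f : R -> V) v ->
  bochner_integral `[s, t] (g : R -> V) w ->
  bochner_integral `[s, t] (a *: f + g : R -> V) (a *: v + w).
Proof.
move=> df dg dv dw s0 tT [p [p1 p2]] [q [q1 q2]].
have phL := L2T_prehilbert T phV.
have ie (h : L2T V T) (r : simple_fun V) : dom (L2T V T) h ->
    rintegrable mu `[s, t] (fun x => sn V (sf_eval r x - h x)).
  move=> dh; have dd := ph_domB phL (L2T_sf T phV r) dh.
  exact: (rintegrable_sub_itv (L2T_rintegrable_sn phV dd) s0 tT).
exists (fun k => sf_lin phV a (p k) (q k)); split; last first.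
  apply: (squeeze0 (v := fun k => `|a| * sn V (sf_integral `[s, t] (p k) - v) +
     sn V (sf_integral `[s, t] (q k) - w))) => [k|].
    rewrite ger0_norm ?(ph_ge0 phV)// sf_integral_lin opprD addrACA -scalerBr.
    have d1 := ph_domB phV (sf_integral_dom phV `[s, t] (p k)) dv.
    have d2 := ph_domB phV (sf_integral_dom phV `[s, t] (q k)) dw.
    by rewrite -(ph_snZ phV)// (ph_snD phV)//; apply: (ph_domZ phV).
  rewrite -[X in _ --> X](addr0 0); apply: cvgD => //.
  by rewrite -[X in _ --> X](mulr0 `|a|); apply: cvgMr.
have dl := ph_domP phL a df dg.
have iel k := ie (a *: f + g) (sf_lin phV a (p k) (q k)) dl.
under eq_fun => k do rewrite -(EFin_Rintegral (mI s t) (iel k)).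
apply: cvg_EFin; first exact: nearW.
apply: (squeeze0 (v := fun k =>
  `|a| * (\int[mu]_(x in `[s, t]) sn V (sf_eval (p k) x - f x)) +
  \int[mu]_(x in `[s, t]) sn V (sf_eval (q k) x - g x))); last first.
  rewrite -[X in _ --> X](addr0 0); apply: cvgD; last exact: (fine_cvg q1).
  by rewrite -[X in _ --> X](mulr0 `|a|); apply: cvgMr; exact: (fine_cvg p1).
move=> k; rewrite ger0_norm; last first.
  by apply: Rintegral_ge0 => x _; exact: (ph_ge0 phV).
have i1 := ie f (p k) df; have i2 := ie g (q k) dg.
have i3 := rintegrableZ `|a| (mI s t) i1.
rewrite -RintegralZl// -RintegralD//; apply: le_Rintegral => //.
- exact: iel.
- exact: rintegrableD.
move=> x /(sub_D s0 tT) Dx.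
have d1 := ph_domB phV (sf_eval_dom phV (p k) x) (L2T_dom df Dx).
have d2 := ph_domB phV (sf_eval_dom phV (q k) x) (L2T_dom dg Dx).
rewrite -(ph_snZ phV)//.
apply: (le_trans _ (ph_snD phV (ph_domZ phV a d1) d2)).
by rewrite sf_eval_lin scalerBr opprD addrACA.
Qed.

Lemma bochner_integral0 (s t : R) : bochner_integral `[s, t] (0 : R -> V) 0.
Proof.
exists (fun=> sf_zero phV); split; last first.
  rewrite /sf_integral big_ord0 subr0 (ph_sn0 phV); exact: cvg_cst.
rewrite (_ : (fun _ => _) = cst 0%E); first exact: cvg_cst.
apply/funext => k; apply: integral0_eq => x _.
by rewrite /sf_eval big_ord0 subr0 (ph_sn0 phV).
Qed.

Definition formH1 (u v : H1T V T) : R :=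
  @formT R V T b u.1 v.1 + @formT R V T b u.2 v.2.

Lemma H1T_L2T (u : H1T V T) : dom (H1T V T) u -> dom (L2T V T) u.1.
Proof. by move=> du; exact: (primitive_L2T phV T0 (H1T_primitive phV du)). Qed.

Lemma H1T_L2T_der (u : H1T V T) : dom (H1T V T) u -> dom (L2T V T) u.2.
Proof. by case. Qed.

Lemma H1T_sn_sqr (u : H1T V T) :
  sn (H1T V T) u ^+ 2 = sn (L2T V T) u.1 ^+ 2 + sn (L2T V T) u.2 ^+ 2.
Proof. by rewrite sqr_sqrtr// addr_ge0 ?sqr_ge0. Qed.

Lemma H1T_sn_der (u : H1T V T) : sn (L2T V T) u.2 <= sn (H1T V T) u.
Proof.
rewrite -ler_sqr ?nnegrE ?sqrtr_ge0//.
by rewrite H1T_sn_sqr lerDr sqr_ge0.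
Qed.

Lemma H1T_sn_le (u : H1T V T) (B1 B2 : R) :
  sn (L2T V T) u.1 <= B1 -> sn (L2T V T) u.2 <= B2 -> sn (H1T V T) u <= B1 + B2.
Proof.
have x0 : 0 <= sn (L2T V T) u.1 by exact: sqrtr_ge0.
have y0 : 0 <= sn (L2T V T) u.2 by exact: sqrtr_ge0.
move=> h1 h2; have b1 := le_trans x0 h1; have b2 := le_trans y0 h2.
rewrite -ler_sqr ?nnegrE ?sqrtr_ge0 ?addr_ge0// H1T_sn_sqr.
apply: (@le_trans _ _ (B1 ^+ 2 + B2 ^+ 2)).
  by apply: lerD; rewrite ler_sqr// nnegrE.
by rewrite sqrrD lerD2r lerDl mulrn_wge0// mulr_ge0.
Qed.

Lemma H1T_prehilbert : prehilbert formH1.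
Proof.
have phL := L2T_prehilbert T phV; split.
- split; first exact: (L2T_dom0 T phV).
    by move=> t _; exact: (ph_dom0 phV).
  by move=> s t _ _ _; rewrite subr0; exact: bochner_integral0.
- move=> a u v du dv; have [du2 du1 hu] := du; have [dv2 dv1 hv] := dv; split.
  + exact: (L2T_domP phV a du2 dv2).
  + by move=> t Dt; apply: (ph_domP phV); [exact: du1|exact: dv1].
  + move=> s t s0 st tT.
    rewrite [X in bochner_integral _ _ X](_ : _ = a *: (u.1 t - u.1 s) + (v.1 t - v.1 s)); last first.
      by rewrite scalerBr addrACA -opprD.
    have Ds : D s by rewrite /= in_itv/= s0 (le_trans st).
    have Dt : D t by rewrite /= in_itv/= tT (le_trans s0).
    apply: bochner_integralP => //; try by [exact: hu|exact: hv].
      by apply: (ph_domB phV); exact: du1.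
    by apply: (ph_domB phV); exact: dv1.
- move=> a u v w du dv dw; rewrite /formH1.
  rewrite (ph_lin phL)//; try exact: H1T_L2T.
  rewrite (ph_lin phL)//; try exact: H1T_L2T_der.
  by rewrite mulrDr addrACA.
- move=> u v du dv; rewrite /formH1 (ph_sym phL); try exact: H1T_L2T.
  by congr (_ + _); rewrite (ph_sym phL)//; exact: H1T_L2T_der.
- by move=> u; exact: sqrtr_ge0.
- move=> u du; rewrite H1T_sn_sqr /formH1 -!(ph_sn phL)//.
    exact: H1T_L2T_der.
  exact: H1T_L2T.
Qed.

Lemma H10T_prehilbert : prehilbert (V := H10T V T) formH1.
Proof.
have phH := H1T_prehilbert; split.
- by split; [exact: (ph_dom0 phH)|rewrite /= (ph_sn0 phV)].
- move=> a u v [du [u0 uT]] [dv [v0 vT]]; split; first exact: (ph_domP phH).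
  have [_ du1 _] := du; have [_ dv1 _] := dv.
  have eq0 t : D t -> sn V (u.1 t) = 0 -> sn V (v.1 t) = 0 -> sn V ((a *: u + v).1 t) = 0.
    move=> Dt ut vt; apply/eqP; rewrite eq_le (ph_ge0 phV) andbT.
    rewrite (le_trans (ph_snD phV (ph_domZ phV a (du1 _ Dt)) (dv1 _ Dt)))//.
    by rewrite (ph_snZ phV) ?ut ?vt ?mulr0 ?addr0//; exact: du1.
  by split; exact: eq0.
- by move=> a u v w [du _] [dv _] [dw _]; exact: (ph_lin phH).
- by move=> u v [du _] [dv _]; exact: (ph_sym phH).
- by move=> u; exact: (ph_ge0 phH).
- by move=> u [du _]; exact: (ph_sn phH).
Qed.

Lemma H10T_primitive (u : H10T V T) : dom (H10T V T) u -> primitive T u.1 u.2.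
Proof. by case=> du _; exact: (H1T_primitive phV). Qed.

(** Evaluation at a fixed time is bounded on functions vanishing at 0; thus weak convergence in time
    passes to weak convergence at each time. *)
Lemma H10T_eval_bound (u : H10T V T) t : dom (H10T V T) u -> D t ->
  sn V (u.1 t) <= Num.sqrt T * sn (H10T V T) u.
Proof.
move=> du Dt; have pu := H10T_primitive du; have [_ [u0 _]] := du.
rewrite (le_trans (primitive_bound phV T0 pu Dt))// u0 add0r.
by rewrite ler_wpM2l ?sqrtr_ge0//; exact: H1T_sn_der.
Qed.

End H1T_theory.

(** * Weak convergence in L^2 in time *)

Lemma cvg0_approx (R : realType) (u : nat -> R) :
  (forall e, 0 < e -> exists2 v : nat -> R, v @ \oo --> (0 : R) &
     forall k, `|u k - v k| <= e) ->
  u @ \oo --> (0 : R).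
Proof.
move=> h; apply/cvgrPdist_lt => e e0; have e2 : 0 < e / 2 by rewrite divr_gt0.
have [v /cvgrPdist_lt/(_ _ e2) v0 uv] := h _ e2.
apply: filterS v0 => k; rewrite !sub0r !normrN => vk.
rewrite -[u k](subrK (v k)) (le_lt_trans (ler_normD _ _))// [ltRHS]splitr.
by rewrite ler_ltD.
Qed.

Lemma cvg0_sum (R : realType) (I : Type) (r : seq I) (u : I -> nat -> R) :
  (forall i, u i @ \oo --> (0 : R)) ->
  (fun k => \sum_(i <- r) u i k) @ \oo --> (0 : R).
Proof.
move=> u0; elim: r => [|i r ih].
  by under eq_fun do rewrite big_nil; exact: cvg_cst.
rewrite (_ : (fun k => _) = fun k => u i k + \sum_(j <- r) u j k); last first.
  by apply/funext => k; rewrite big_cons.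
by rewrite -[X in _ --> X](addr0 0); apply: cvgD.
Qed.

Section weak_L2T.
Variables (R : realType) (V : snspace R) (b : V -> V -> R) (T : R).
Hypotheses (phV : prehilbert b) (T0 : 0 < T).
Local Notation mu := (@lebesgue_measure R).
Local Notation D := (`[0, T]%classic : set R).

Let mD : measurable (D : set (measurableTypeR R)). Proof. exact: measurable_itv. Qed.
Let Doo : (mu D < +oo)%E. Proof. exact: lebesgue_itvcc_lty. Qed.

Variables (g : nat -> L2T V T) (B : R).
Hypothesis dg : forall k, dom (L2T V T) (g k).
Hypothesis gB : forall k, sn (L2T V T) (g k) <= B.
Hypothesis g_itv : forall phi M, bounded_functional phi M ->
  forall s t, 0 <= s -> s <= t -> t <= T ->
    (fun k => \int[mu]_(x in `[s, t]) phi (g k x)) @ \oo --> (0 : R).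

Section functional.
Variables (phi : V -> R) (M : R).
Hypothesis bphi : bounded_functional phi M.

Let I (A : set R) k := \int[mu]_(x in D) (\1_A x * phi (g k x)).

Let iphi k : rintegrable mu D (fun x => phi (g k x)).
Proof. exact: (L2T_rintegrable_functional phV bphi). Qed.

Let iI (A : set R) k : measurable A -> rintegrable mu D (fun x => \1_A x * phi (g k x)).
Proof.
move=> mA; apply: le_rintegrable (rintegrable_norm (iphi k)) => //.
  apply: measurable_funM; first exact: measurable_indic.
  exact: rintegrable_measurable (iphi k).
move=> x _; rewrite normrM ler_piMl// indicE.
by case: (_ \in _); rewrite ?normr1 ?normr0.
Qed.

Let I_ray (a : R) : I `[a, +oo[%classic @ \oo --> (0 : R).
Proof.
have E k : I `[a, +oo[%classic k =
    \int[mu]_(x in `[Num.max a 0, T]) phi (g k x).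
  rewrite /I (_ : [set` `[Num.max a 0, T]] = D `&` `[a, +oo[%classic); last first.
    apply/seteqP; split => x /=; rewrite !in_itv/= andbT ge_max.
      by move=> /andP[/andP[-> ->] ->].
    by move=> [/andP[-> ->] ->].
  rewrite Rintegral_mkcondr; apply: eq_Rintegral => x _.
  by rewrite patchE indicE; case: (_ \in _); rewrite ?mul1r ?mul0r.
rewrite (_ : I _ = fun k => \int[mu]_(x in `[Num.max a 0, T]) phi (g k x)); last exact/funext.
have [aT|Ta] := leP (Num.max a 0) T.
  by apply: (g_itv bphi) => //; rewrite le_max lexx orbT.
rewrite set_itv_ge ?bnd_simp -?ltNge//.
by under eq_fun do rewrite Rintegral_set0; exact: cvg_cst.
Qed.

(** Uniform integrability: the bound depends on [A] only through the measure of its part in [0, T],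
    and not on [k]. *)
Let I_bound (A : set R) k : measurable A ->
  `|I A k| <= M * (Num.sqrt (\int[mu]_(x in D) \1_A x) * B).
Proof.
move=> mA; have i1 := iI k mA; have mg := L2T_measurable_sn phV (dg k).
have g2 := L2T_rintegrable_sqr phV (dg k).
have i1A := rintegrable_indic mD Doo mA.
have sq1 : (fun x => \1_A x ^+ 2) = (\1_A : R -> R).
  by apply/funext => x; rewrite indicE; case: (_ \in _); rewrite ?expr1n ?expr0n.
have m1A : measurable_fun D (\1_A : R -> R) by exact: measurable_indic.
have i1A2 : rintegrable mu D (fun x => \1_A x ^+ 2) by rewrite sq1.
have i2 := rintegrableM_sqr mD m1A mg i1A2 g2.
apply: (@le_trans _ _ (\int[mu]_(x in D) (M * (\1_A x * sn V (g k x))))).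
  rewrite (le_trans (le_normr_Rintegral _ i1))//.
  apply: le_Rintegral => //; [exact: rintegrable_norm|exact: rintegrableZ|].
  move=> x Dx; rewrite normrM mulrCA ger0_norm// ler_wpM2l//.
  by apply: (bl_le bphi); exact: (L2T_dom (dg k)).
rewrite RintegralZl// ler_wpM2l ?(bl_ge0 bphi)//.
have B0 : 0 <= B by rewrite (le_trans _ (gB k)) ?sqrtr_ge0.
rewrite -ler_sqr ?nnegrE; last 2 first.
- by apply: Rintegral_ge0 => x _; rewrite mulr_ge0 ?(ph_ge0 phV).
- by rewrite mulr_ge0 ?sqrtr_ge0.
rewrite (le_trans (Rintegral_cauchy_schwarz mD m1A mg i1A2 g2))// sq1.
rewrite exprMn sqr_sqrtr; last by apply: Rintegral_ge0 => x _.
rewrite ler_wpM2l//; first by apply: Rintegral_ge0 => x _.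
by rewrite -(L2T_sn_sqr (g k)) ler_sqr ?nnegrE ?sqrtr_ge0.
Qed.

(** The part of the union beyond the first N sets has measure tending to 0 within [0, T], so by
    [I_bound] it is negligible uniformly in k; the finitely many remaining sets are treated one by
    one. *)
Let I_bigcup (F : nat -> set R) : (forall n, measurable (F n)) ->
  trivIset setT F -> (forall n, I (F n) @ \oo --> (0 : R)) ->
  I (\bigcup_n F n) @ \oo --> (0 : R).
Proof.
move=> mF tF hF; pose tail N := (\bigcup_n F n) `\` \big[setU/set0]_(n < N) F n.
have mtail N : measurable (tail N).
  by apply: measurableD; [exact: bigcup_measurable|exact: bigsetU_measurable].
have tail0 : (fun N => \int[mu]_(x in D) \1_(tail N) x) @ \oo --> (0 : R).
  apply: (Rintegral_cvg0 (mu := mu) (f_ := fun N x => \1_(tail N) x) (g := fun=> 1)) => //.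
  - by move=> N; exact: (@measurable_indic _ (measurableTypeR R) R D _ (mtail N)).
  - exact: rintegrable_cst.
  - by move=> N x _; rewrite ger0_norm ?indicE//; case: (_ \in _).
  - move=> x _; have [[n _ Fnx]|nFx] := pselect ((\bigcup_n F n) x).
      apply: cvg_near_cst; exists n.+1 => // N /= nN.
      rewrite indicE memNset// => -[_]; apply.
      by rewrite -bigcup_mkord; exists n.
    by apply: cvg_near_cst; apply: nearW => N; rewrite indicE memNset// => -[].
apply: cvg0_approx => e e0.
have : (fun N => M * (Num.sqrt (\int[mu]_(x in D) \1_(tail N) x) * B)) @ \oo --> (0 : R).
  rewrite -[X in _ --> X](mulr0 M); apply: cvgMr.
  by rewrite -[X in _ --> X](mul0r B); apply: cvgMl; exact: sqrt_cvg0.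
move=> /cvgrPdist_lt/(_ _ e0)[N _ /(_ N (leqnn N))]; rewrite sub0r normrN => hN.
exists (fun k => \sum_(n < N) I (F n) k); first exact: cvg0_sum.
move=> k; rewrite (_ : _ - _ = I (tail N) k).
  by rewrite (le_trans (I_bound _ _))// (le_trans _ (ltW hN))// ler_norm.
apply/eqP; rewrite subr_eq /I -Rintegral_sum//; last by move=> i; exact: iI.
rewrite -RintegralD//; [|exact: iI|by apply: rintegrable_sum => // i; exact: iI].
apply/eqP/eq_Rintegral => x _; rewrite -mulr_suml -mulrDl; congr (_ * _).
have [[m mN Fmx]|nF] := pselect (exists2 m, (m < N)%N & F m x).
  have tx : ~ tail N x.
    by move=> [_]; apply; rewrite -bigcup_mkord; exists m.
  have Ux : (\bigcup_n F n) x by exists m.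
  rewrite [\1_(tail N) x]indicE (memNset tx) add0r.
  rewrite (bigD1 (Ordinal mN))//= big1 ?addr0 => [|i /eqP im].
    by rewrite !indicE (mem_set Ux) (mem_set Fmx).
  rewrite indicE memNset// => Fix; apply: im; apply/val_inj => /=.
  by apply: (tF i m) => //; exists x.
rewrite big1 ?addr0 => [|i _]; last first.
  by rewrite indicE memNset// => Fix; apply: nF; exists i.
have [Ux|nUx] := pselect ((\bigcup_n F n) x); last first.
  have tx : ~ tail N x by case.
  by rewrite !indicE (memNset tx) (memNset nUx).
have tx : tail N x.
  by split=> //; rewrite -bigcup_mkord => -[m mN Fmx]; apply: nF; exists m.
by rewrite !indicE (mem_set tx) (mem_set Ux).
Qed.

(** The sets for which the convergence holds form a Dynkin class containing the rays [a, +oo[, a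
    generating family stable under intersection. *)
Lemma weak_L2T_indic (A : set R) : measurable A ->
  (fun k => \int[mu]_(x in D) (\1_A x * phi (g k x))) @ \oo --> (0 : R).
Proof.
rewrite -/(I A) => mA; have I_T : I setT @ \oo --> (0 : R).
  rewrite (_ : I setT = fun k => \int[mu]_(x in D) phi (g k x)).
    exact: (g_itv bphi (lexx 0) (ltW T0) (lexx T)).
  by apply/funext => k; apply: eq_Rintegral => x _; rewrite indicT mul1r.
suff h : forall S, <<s @RGenCInfty.G R >> S -> I S @ \oo --> (0 : R).
  have E : <<s @RGenCInfty.G R >> = (@ocitv R).-sigma.-measurable.
    by rewrite RGenCInfty.measurableE.
  by apply: h; rewrite E.
apply: (@dynkin_induction _ (measurableTypeR R) (@RGenCInfty.G R)
  (fun A => I A @ \oo --> (0 : R))) => //.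
- exact: RGenCInfty.measurableE.
- move=> _ _ [x ->] [y ->]; exists (Num.max x y).
  by apply/seteqP; split => z /=; rewrite !in_itv/= !andbT ge_max => /andP.
- by move=> _ [x ->]; exact: I_ray.
- move=> S mS IS.
  rewrite (_ : I (~` S) = fun k => I setT k - I S k).
    by rewrite -[X in _ --> X](subr0 0); apply: cvgB.
  apply/funext => k; rewrite /I -RintegralB//; [|exact: iI..].
  apply: eq_Rintegral => x _; rewrite -mulrBl indicT indicC indicE.
  by case: (_ \in _); rewrite ?subrr ?subr0.
Qed.

End functional.

(** Indicator functions give convergence against simple functions; these approximate [r] in L^2, and
    the bound [B] makes the error uniform in k. *)
Lemma weak_L2T_form beta M (r : L2T V T) : bounded_form beta M ->
  dom (L2T V T) r -> (fun k => formT beta r (g k)) @ \oo --> (0 : R).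
Proof.
move=> bb dr; have [s s0] := L2T_simple_approx phV dr.
have bT := L2T_bounded_form T phV bb; have phL := L2T_prehilbert T phV.
have B0 : 0 <= B by rewrite (le_trans _ (gB 0)) ?sqrtr_ge0.
have MB0 : 0 < M * B + 1 by rewrite ltr_wpDl// mulr_ge0// (bf_ge0 bb).
apply: cvg0_approx => e e0.
have e1 : 0 < e / (M * B + 1) by rewrite divr_gt0.
have /cvgrPdist_lt/(_ _ e1)[N _ /(_ N (leqnn N))] := s0.
rewrite sub0r normrN => hN; have ds := L2T_sf T phV (s N).
exists (fun k => formT beta (sf_eval (s N)) (g k)) => [|k]; last first.
  rewrite -(bfBl phL bT)// (le_trans (bf_le bT (ph_domB phL dr ds) (dg k)))//.
  rewrite (ph_snBC phL)// -[leRHS](divfK (lt0r_neq0 MB0)) [leRHS]mulrC.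
  rewrite mulrAC; apply: ler_pM.
  - by rewrite mulr_ge0 ?sqrtr_ge0// (bf_ge0 bb).
  - exact: sqrtr_ge0.
  - have := ler_wpM2l (bf_ge0 bb) (gB k); lra.
  - by rewrite (le_trans (ler_norm _))// ltW.
have iv i k : rintegrable mu D
    (fun x => \1_(@sf_set R V (s N) i) x * beta (@sf_val R V (s N) i) (g k x)).
  have bi := bf_functionalr phV bb (@sf_dom R V (s N) i).
  have := rintegrable_norm (L2T_rintegrable_functional phV bi (dg k)).
  have mi : measurable_fun D (\1_(@sf_set R V (s N) i) : R -> R).
    by apply: measurable_indic; exact: sf_meas.
  apply: le_rintegrable => //.
    apply: measurable_funM => //.
    exact: rintegrable_measurable (L2T_rintegrable_functional phV bi (dg k)).
  move=> x _; rewrite normrM ler_piMl// indicE.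
  by case: (_ \in _); rewrite ?normr1 ?normr0.
rewrite (_ : (fun k => _) = fun k => \sum_i \int[mu]_(x in D)
    (\1_(@sf_set R V (s N) i) x * beta (@sf_val R V (s N) i) (g k x))).
  apply: cvg0_sum => i.
  apply: (weak_L2T_indic (bf_functionalr phV bb (@sf_dom R V (s N) i))).
  exact: sf_meas.
apply/funext => k; rewrite -Rintegral_sum//.
apply: eq_Rintegral => x /set_mem Dx.
by rewrite (functional_sf_eval phV _ _ (bf_functionall phV bb (L2T_dom (dg k) Dx))).
Qed.

End weak_L2T.

(** * Difference quotients *)

Section difference_quotients.
Variable R : realType.
Local Notation mu := (@lebesgue_measure R).

Lemma continuous_shift (F : R -> R) (h : R) : continuous F ->
  continuous (fun x => F (x + h)).
Proof.
move=> cF x; apply: continuous_comp; last exact: cF.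
by apply: continuousD; [exact: cvg_id|exact: cvg_cst].
Qed.

Lemma continuous_difference (F : R -> R) (h : R) : continuous F ->
  continuous (fun x => F (x + h) - F x).
Proof. by move=> cF x; apply: cvgB; [exact: continuous_shift|exact: cF]. Qed.

Lemma rintegrable_continuous (F : R -> R) (s t : R) : continuous F ->
  rintegrable mu `[s, t] F.
Proof.
move=> cF; apply: continuous_compact_integrable; first exact: segment_compact.
exact: continuous_subspaceT.
Qed.

Lemma continuous_primitive (F : R -> R) (a x : R) : continuous F -> a < x ->
  is_derive x (1 : R) (fun y => \int[mu]_(r in `[a, y]) F r) (F x).
Proof.
move=> cF ax; have xu : x < x + 1 by rewrite ltrDl.
have [dP PF] := continuous_FTC1_closed xu (rintegrable_continuous a (x + 1) cF) ax (cF x).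
by rewrite -PF derive1E; exact: derivableP.
Qed.

(** A change of variables read off from the fundamental theorem of calculus. The base point lies
    strictly to the left of s + h so that the primitive is differentiable at the left end too. *)
Lemma Rintegral_shift (F : R -> R) (a s t h : R) : continuous F -> s < t ->
  a < s + h ->
  \int[mu]_(x in `[s, t]) F (x + h) =
  (\int[mu]_(r in `[a, t + h]) F r) - \int[mu]_(r in `[a, s + h]) F r.
Proof.
move=> cF st ash; pose P y := \int[mu]_(r in `[a, y]) F r.
have dQ x : s <= x -> is_derive x (1 : R) (P \o (fun y => y + h)) (F (x + h)).
  move=> sx; have axh : a < x + h by rewrite (lt_le_trans ash)// lerD2r.
  have dP := continuous_primitive cF axh.
  have dS : is_derive x (1 : R) (fun y : R => y + h) 1.
    by apply: is_derive_eq; rewrite addr0.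
  by have := @is_derive1_comp R P _ x _ _ dP dS; rewrite mulr1.
have cQ x : s <= x -> {for x, continuous (P \o (fun y => y + h))}.
  move=> sx; apply: differentiable_continuous.
  by apply/derivable1_diffP; have [] := dQ x sx.
rewrite /Rintegral (@continuous_FTC2 _ _ (P \o (fun y => y + h)))//.
- by apply: continuous_subspaceT; exact: continuous_shift.
- split.
  + by move=> x; rewrite in_itv/= => /andP[sx _]; have [] := dQ x (ltW sx).
  + exact/cvg_at_right_filter/cQ.
  + exact/cvg_at_left_filter/cQ/ltW.
- move=> x; rewrite in_itv/= => /andP[sx _].
  by rewrite derive1E; have [] := dQ x (ltW sx).
Qed.

(** After the shift, the integral is the difference of the quotients of one primitive of [F] at [t]
    and at [s], and these tend to [F t] and [F s]. *)
Lemma Rintegral_difference_quotient (F : R -> R) (s t : R) (h : nat -> R) :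
  continuous F -> s <= t -> h @ \oo --> (0 : R) -> (forall n, h n != 0) ->
  (fun n => \int[mu]_(x in `[s, t]) ((h n)^-1 * (F (x + h n) - F x))) @ \oo
    --> F t - F s.
Proof.
move=> cF; rewrite le_eqVlt => /predU1P[<- _ _|st h0 hn].
  rewrite subrr set_itv1.
  by under eq_fun do rewrite Rintegral_set1; exact: cvg_cst.
(* The shifts may be negative; once they are below 1 in absolute value, the points s + h n stay to
   the right of this base point. *)
pose a := s - 2; pose P y := \int[mu]_(r in `[a, y]) F r.
have q x : s <= x -> (fun n => (h n)^-1 * (P (x + h n) - P x)) @ \oo --> F x.
  move=> sx; have ax : a < x by rewrite (lt_le_trans _ sx)// ltrBlDr ltrDl.
  have [dP PF] := continuous_primitive cF ax.
  have : (fun k : R => k^-1 *: ((P \o shift x) (k *: (1 : R)) - P x)) @ (0 : R)^' --> F x.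
    by rewrite -PF; exact: dP.
  move=> /cvgr_dnbhsP/(_ h (conj hn h0)); apply: cvg_trans; apply: near_eq_cvg.
  apply: nearW => n /=; rewrite /GRing.scale/= mulr1.
  by rewrite [h n + x]addrC.
apply: cvg_trans (cvgB (q t (ltW st)) (q s (lexx s))); apply: near_eq_cvg.
have a1 : a + 1 < s by rewrite /a; lra.
have /cvgrPdist_lt/(_ 1 ltr01) := h0; apply: filterS => n.
rewrite sub0r normrN ltr_norml => /andP[h1 h2].
have cFh := continuous_shift (h := h n) cF.
have i1 := rintegrable_continuous s t cFh.
have i2 := rintegrable_continuous s t cF.
rewrite RintegralZl//; last exact: rintegrableB.
rewrite RintegralB// (@Rintegral_shift _ a)//; last by lra.
have := @Rintegral_shift _ a s t 0 cF st; rewrite !addr0.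
under eq_Rintegral do rewrite addr0.
move=> ->; last by lra.
rewrite -!/(P _).
transitivity ((h n)^-1 * (P (t + h n) - P t) - (h n)^-1 * (P (s + h n) - P s)).
  by [].
ring.
Qed.

Variables (V : snspace R) (b : V -> V -> R) (T : R).
Hypotheses (phV : prehilbert b) (T0 : 0 < T).
Local Notation D := (`[0, T]%classic : set R).

Let mD : measurable (D : set (measurableTypeR R)). Proof. exact: measurable_itv. Qed.

(** Composition with this retraction extends a function on [0, T] by constants, so a shifted value
    is still a value taken on [0, T] and hence an admissible test element. *)
Definition clamp (x : R) := Num.min (Num.max x 0) T.

Lemma clamp_D x : D (clamp x).
Proof.
by rewrite /= in_itv/= /clamp ge_min lexx orbT andbT le_min le_max lexx orbT ltW.
Qed.

Lemma clamp_id x : D x -> clamp x = x.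
Proof.
rewrite /= in_itv/= /clamp => /andP[x0 xT].
by rewrite max_l// min_l.
Qed.

Lemma clamp_mono x y : x <= y -> clamp x <= clamp y.
Proof.
rewrite /clamp /Num.min /Num.max => xy.
by repeat case: ifPn; rewrite -?leNgt => *; lra.
Qed.

Lemma clamp_lipschitz x y : `|clamp x - clamp y| <= `|x - y|.
Proof.
wlog xy : x y / y <= x => [hw|].
  by have [/hw//|/ltW /hw] := leP y x; rewrite distrC [leRHS]distrC.
rewrite !ger0_norm ?subr_ge0 ?clamp_mono//.
rewrite /clamp /Num.min /Num.max.
by repeat case: ifPn; rewrite -?leNgt => *; lra.
Qed.

Lemma continuous_clamp (F : R -> R) :
  (forall e, 0 < e -> exists2 d, 0 < d &
    forall s t, D s -> D t -> `|t - s| < d -> `|F t - F s| < e) ->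
  continuous (fun x => F (clamp x)).
Proof.
move=> cF x; apply/cvgrPdist_lt => e e0; have [d d0 hd] := cF e e0.
have /cvgrPdist_lt/(_ _ d0) : y @[y --> x] --> x by exact: cvg_id.
apply: filterS => y xy; apply: hd; try exact: clamp_D.
exact: le_lt_trans (clamp_lipschitz _ _) xy.
Qed.

Lemma Rintegral_continuous_clamp (g : R -> R) : rintegrable mu D g ->
  continuous (fun x => \int[mu]_(r in `[0, clamp x]) g r).
Proof.
move=> gi x.
have /subspace_continuousP/(_ _ (clamp_D x)) := parameterized_integral_continuous (ltW T0) gi.
rewrite /parameterized_integral /continuous_at => h.
have cc : clamp y @[y --> x] --> within D (nbhs (clamp x)).
  move=> A /= [d d0 hA]; exists d => // y xy; apply: hA; last exact: clamp_D.
  exact: le_lt_trans (clamp_lipschitz _ _) xy.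
exact: (cvg_comp _ _ cc h).
Qed.

Definition difference_quotient (u : R -> V) (h : R) : R -> V :=
  fun x => h^-1 *: (u (clamp (x + h)) - u x).

Section quotient.
Variables u u' : R -> V.
Hypothesis pu : primitive T u u'.

Let du' : dom (L2T V T) u'. Proof. by case: pu. Qed.
Let du t : D t -> dom V (u t). Proof. by case: pu => _ + _; exact. Qed.
Let phL := L2T_prehilbert T phV.

Lemma L2T_difference_quotient h : dom (L2T V T) (difference_quotient u h).
Proof.
have d1 : dom (L2T V T) (fun x => u (clamp (x + h))).
  apply: (L2T_bounded phV (M := sn V (u 0) + Num.sqrt T * sn (L2T V T) u')).
  - by move=> t _; exact/du/clamp_D.
  - apply: (strongly_measurable_continuous phV T0) => [t _|e e0]; first exact/du/clamp_D.
    have [d d0 hd] := primitive_uniform_continuous phV pu e0.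
    exists d => // s t _ _ st; apply: hd; try exact: clamp_D.
    rewrite (le_lt_trans (clamp_lipschitz _ _))//.
    by rewrite (_ : t + h - (s + h) = t - s)//; ring.
  - by move=> t _; apply: (primitive_bound phV T0 pu); exact: clamp_D.
have := ph_domZ phL h^-1 (ph_domB phL d1 (primitive_L2T phV T0 pu)).
exact.
Qed.

Let Phi x := \int[mu]_(r in `[0, clamp x]) (sn V (u' r) ^+ 2).

(** Cauchy-Schwarz on the interval between x and the clamped x + h, whose length is at most |h|. For
    negative h both factors on the right change sign. *)
Let sn_quotient h x : h != 0 -> D x ->
  sn V (difference_quotient u h x) ^+ 2 <= h^-1 * (Phi (x + h) - Phi x).
Proof.
move=> h0 Dx; rewrite (ph_snZ phV); last first.
  by apply: (ph_domB phV); [exact/du/clamp_D|exact: du].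
rewrite exprMn real_normK ?num_real//.
have i2 := L2T_rintegrable_sqr phV du'.
have key s t : D s -> D t -> s <= t ->
    sn V (u t - u s) ^+ 2 <= (t - s) *
      ((\int[mu]_(r in `[0, t]) (sn V (u' r) ^+ 2)) - \int[mu]_(r in `[0, s]) (sn V (u' r) ^+ 2)) /\
    0 <= (\int[mu]_(r in `[0, t]) (sn V (u' r) ^+ 2)) - \int[mu]_(r in `[0, s]) (sn V (u' r) ^+ 2).
  rewrite /= !in_itv/= => /andP[s0 _] /andP[_ tT] st.
  rewrite -(Rintegral_itvcc_sub i2 s0 st tT); split.
    exact: (primitive_sn_sqr_le phV pu).
  by apply: Rintegral_ge0 => r _; exact: sqr_ge0.
have h2 : 0 < h^-1 ^+ 2 by rewrite exprn_even_gt0//= invr_eq0.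
have Dc := clamp_D (x + h).
have hh : h^-1 = h^-1 ^+ 2 * h by rewrite expr2 -mulrA mulVf// mulr1.
rewrite [in leRHS]hh -mulrA ler_pM2l// /Phi (clamp_id Dx).
have := clamp_lipschitz (x + h) x; rewrite (clamp_id Dx) [x + h]addrC addrK.
rewrite [h + x]addrC.
have [hp|hn] := leP 0 h.
  have xc : x <= clamp (x + h) by rewrite -{1}(clamp_id Dx) clamp_mono// lerDl.
  have [k1 k2] := key _ _ Dx Dc xc.
  rewrite !ger0_norm ?subr_ge0// => k3.
  by rewrite (le_trans k1)// ler_wpM2r.
have xc : clamp (x + h) <= x by rewrite -{2}(clamp_id Dx) clamp_mono// gerDl ltW.
have [k1 k2] := key _ _ Dc Dx xc.
rewrite distrC ger0_norm ?subr_ge0// ltr0_norm// => k3.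
rewrite (ph_snBC phV) ?(le_trans k1)//; [|exact/du/clamp_D|exact: du].
by rewrite -[leRHS]mulrNN opprB ler_wpM2r.
Qed.

Variables (h : nat -> R).
Hypotheses (h0 : h @ \oo --> (0 : R)) (hn : forall n, h n != 0).

Let T00 : 0 <= T := ltW T0.

(** The pointwise bounds are difference quotients of the continuous function [Phi]; their integrals
    converge, hence are bounded in n. *)
Let quotient_bounded :
  exists B, forall n, sn (L2T V T) (difference_quotient u (h n)) <= B.
Proof.
have cPhi : continuous Phi := Rintegral_continuous_clamp (L2T_rintegrable_sqr phV du').
have cv := Rintegral_difference_quotient cPhi T00 h0 hn.
have /cvg_seq_bounded[B [_ hB]] : cvgn (fun n => \int[mu]_(x in `[0, T])
    ((h n)^-1 * (Phi (x + h n) - Phi x))).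
  by apply/cvg_ex; eexists; exact: cv.
have {hB} hB n : \int[mu]_(x in `[0, T]) ((h n)^-1 * (Phi (x + h n) - Phi x)) <= B + 1.
  by rewrite (le_trans (ler_norm _))// hB// ltrDl.
have B0 : 0 <= B + 1.
  apply: le_trans (hB 0); apply: Rintegral_ge0 => x Dx.
  by rewrite (le_trans _ (sn_quotient (hn 0) Dx))// sqr_ge0.
exists (Num.sqrt (B + 1)) => n.
rewrite -ler_sqr ?nnegrE ?sqrtr_ge0// L2T_sn_sqr sqr_sqrtr//.
apply: le_trans (hB n); apply: le_Rintegral => //.
- exact: (L2T_rintegrable_sqr phV (L2T_difference_quotient (h n))).
- apply: rintegrableZ => //; apply: rintegrable_continuous.
  exact: (continuous_difference (h := h n) cPhi).
- by move=> x Dx; exact: sn_quotient.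
Qed.

(** Bounded quotients only have to be tested on intervals [s, t], where the integral of phi of the
    quotient tends to phi (u t) - phi (u s), the integral of phi (u'). *)
Lemma difference_quotient_weak beta M (r : L2T V T) : bounded_form beta M ->
  dom (L2T V T) r ->
  (fun n => formT beta (r : L2T V T) (difference_quotient u (h n))) @ \oo
    --> formT beta (r : L2T V T) (u' : L2T V T).
Proof.
move=> bb dr; apply/cvg_sub0P; have [B hB] := quotient_bounded.
have bT := L2T_bounded_form T phV bb.
have dq n := L2T_difference_quotient (h n).
have dqu n := ph_domB phL (dq n) du'.
rewrite (_ : (fun n => _) =
    fun n => formT beta r (difference_quotient u (h n) - u' : L2T V T)); last first.
  by apply/funext => n; rewrite (bfBr phL bT).
apply: (weak_L2T_form phV T0 dqu (B := B + sn (L2T V T) u')) bb dr => [n|].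
  by rewrite (le_trans (ph_snB phL (dq n) du'))// lerD2r.
move=> phi M' bphi s t s0 st tT.
have Ds : D s by rewrite /= in_itv/= s0 (le_trans st).
have Dt : D t by rewrite /= in_itv/= tT (le_trans s0).
pose F x := phi (u (clamp x)).
have cF : continuous F.
  apply: (@continuous_clamp (fun x => phi (u x))) => e e0.
  have M1 : 0 < M' + 1 by rewrite ltr_wpDl// (bl_ge0 bphi).
  have [d d0 hd] := primitive_uniform_continuous phV pu (divr_gt0 e0 M1).
  exists d => // x y Dx Dy /(hd _ _ Dx Dy); rewrite ltr_pdivlMr//.
  have duu := ph_domB phV (du Dy) (du Dx).
  apply: le_lt_trans; rewrite -(blB phV bphi) ?(le_trans (bl_le bphi duu))//; try exact: du.
  by rewrite mulrC ler_wpM2l ?(ph_ge0 phV)// lerDl.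
have cv := Rintegral_difference_quotient cF st h0 hn.
rewrite -[X in _ --> X](subrr (F t - F s)).
have cst_cv : (fun n : nat => F t - F s) @ \oo --> F t - F s by exact: cvg_cst.
apply: cvg_trans (cvgB cv cst_cv); apply: near_eq_cvg; apply: nearW => n.
transitivity ((\int[mu]_(x in `[s, t]) ((h n)^-1 * (F (x + h n) - F x))) -
  (F t - F s)); first by [].
have [_ _ /(_ phi M' bphi s t s0 st tT)] := pu.
rewrite (blB phV bphi); try exact: du.
rewrite /F (clamp_id Ds) (clamp_id Dt) => ->.
rewrite -RintegralB//.
- apply: eq_Rintegral => x; rewrite inE/= in_itv/= => /andP[sx xt].
  have Dx : D x by rewrite /= in_itv/= (le_trans s0 sx) (le_trans xt tT).
  rewrite (blB phV bphi); last 2 first.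
  + exact: (L2T_dom (dq n) Dx).
  + exact: (L2T_dom du' Dx).
  rewrite (blZ phV bphi) ?(blB phV bphi)//; try exact/du/clamp_D; try exact/du.
    by rewrite (clamp_id Dx).
  by apply: (ph_domB phV); [exact/du/clamp_D|exact: du].
- apply: rintegrableZ => //; apply: rintegrable_continuous.
  exact: (continuous_difference (h := h n) cF).
- exact: (primitive_rintegrable_functional phV pu bphi).
Qed.

End quotient.

End difference_quotients.

(** * The evolution variational inequality *)

Section ae_interval.
Variables (R : realType) (T : R).
Hypothesis T0 : 0 < T.
Local Notation mu := (@lebesgue_measure R).
Local Notation D := (`[0, T]%classic : set R).

Lemma ae_neq (a : R) : {ae mu, forall t, t != a}.
Proof.
exists [set a]; split => //; first by rewrite lebesgue_measure_set1.
by move=> t /=; move/negP; rewrite negbK => /eqP.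
Qed.

(** Every neighbourhood of a point of [0, T] meets ]0, T[ in a nonempty open interval, and such an
    interval does not fit into a null set. *)
Lemma ae_dense (P : R -> Prop) :
  {ae mu, forall t, `]0, T[%classic t -> P t} ->
  forall s, D s -> forall d, 0 < d -> exists r, [/\ D r, `|r - s| < d & P r].
Proof.
move=> [N [mN N0 hN]] s; rewrite /= in_itv/= => /andP[s0 sT] d d0.
apply: contrapT => /forallNP nr.
pose a := Num.max 0 (s - d); pose c := Num.min T (s + d).
have ac : a < c.
  rewrite /a /c gt_max !lt_min T0 (ltr_wpDl s0 d0) ltrBlDr (le_lt_trans sT) ?ltrDl//=.
  by rewrite ltrBlDr -addrA ltrDl addr_gt0.
have sub : `]a, c[%classic `<=` N.
  move=> r; rewrite /= in_itv/= /a /c gt_max lt_min => /andP[/andP[r0 rs] /andP[rT rsd]].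
  apply: hN => /= Pr; apply: (nr r); split.
  - by rewrite /= in_itv/= !ltW.
  - by rewrite ltr_norml; apply/andP; split; lra.
  - by apply: Pr; rewrite /= in_itv/= r0 rT.
have mac : measurable (`]a, c[%classic : set (measurableTypeR R)) by exact: measurable_itv.
have : (mu `]a, c[%classic <= 0)%E.
  by rewrite -[leRHS]N0; exact: (le_measure mu (mem_set mac) (mem_set mN) sub).
by rewrite lebesgue_measure_itv/= lte_fin ac -EFinD lee_fin leNgt subr_gt0 ac.
Qed.

End ae_interval.

Section evolution_inequality.
Variables (R : realType) (V : snspace R) (b : V -> V -> R) (T : R).
Hypotheses (phV : prehilbert b) (T0 : 0 < T).
Local Notation mu := (@lebesgue_measure R).
Local Notation D := (`[0, T]%classic : set R).

Let mD : measurable (D : set (measurableTypeR R)). Proof. exact: measurable_itv. Qed.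
Let mI (s t : R) : measurable (`[s, t]%classic : set (measurableTypeR R)).
Proof. exact: measurable_itv. Qed.
Let phL := L2T_prehilbert T phV.

Lemma L2T_cvg0 (g : nat -> L2T V T) (B : R) : (forall n, dom (L2T V T) (g n)) ->
  (forall n t, D t -> sn V (g n t) <= B) ->
  (forall t, D t -> (fun n => sn V (g n t)) @ \oo --> (0 : R)) ->
  (fun n => sn (L2T V T) (g n)) @ \oo --> (0 : R).
Proof.
move=> dg gB g0.
suff h : (fun n => \int[mu]_(t in D) (sn V (g n t) ^+ 2)) @ \oo --> (0 : R).
  exact: sqrt_cvg0 h.
apply: (Rintegral_cvg0 (mu := mu) (D := D) (f_ := fun n t => sn V (g n t) ^+ 2)
  (g := fun=> B ^+ 2)) => //.
- by move=> n; apply: measurable_funX; exact: (L2T_measurable_sn phV (dg n)).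
- by apply: rintegrable_cst => //; exact: lebesgue_itvcc_lty.
- move=> n t Dt; rewrite ger0_norm ?sqr_ge0// ler_sqr ?nnegrE ?(ph_ge0 phV) ?gB//.
  by rewrite (le_trans _ (gB n _ Dt)) ?(ph_ge0 phV).
- by move=> t Dt; apply: sqr_cvg0; exact: g0.
Qed.

(* Testing with [u (t + h)] and [u (t - h)] and letting [h] tend to 0 gives the
   two inequalities. *)
Lemma energy_identity (u u' : R -> V) (r1 r2 : L2T V T) beta1 M1 beta2 M2 :
  primitive T u u' -> bounded_form beta1 M1 -> bounded_form beta2 M2 ->
  dom (L2T V T) r1 -> dom (L2T V T) r2 ->
  {ae mu, forall t, `]0, T[%classic t -> forall s, D s ->
     0 <= beta1 (r1 t) (u s - u t) - beta2 (r2 t) (u s - u t)} ->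
  formT beta1 r1 (u' : L2T V T) = formT beta2 r2 (u' : L2T V T).
Proof.
move=> pu b1 b2 d1 d2 hae; have [du' du _] := pu.
have dq h := L2T_difference_quotient phV T0 pu h.
have i1 h := L2T_rintegrable_form phV b1 d1 (dq h).
have i2 h := L2T_rintegrable_form phV b2 d2 (dq h).
(* Multiplying by h cancels the division in the quotient, so the integrand is the hypothesis at the
   time [clamp T (t + h)] and one inequality serves both signs of h. *)
have key h : h != 0 -> 0 <= h * (formT beta1 r1 (difference_quotient T u h : L2T V T) -
    formT beta2 r2 (difference_quotient T u h : L2T V T)).
  move=> h0; have j1 := i1 h; have j2 := i2 h.
  rewrite /formT -RintegralB// -RintegralZl//; last exact: rintegrableB.
  apply: (@le_trans _ _ (\int[mu]_(x in D) (0 : R))).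
    by rewrite Rintegral_cst// mul0r.
  apply: (le_Rintegral_ae (mu := mu)) => //.
  - by apply: rintegrable_cst => //; exact: lebesgue_itvcc_lty.
  - by apply: rintegrableZ => //; exact: rintegrableB.
  have aeF := ae_filter_ringOfSetsType mu.
  apply: filterS3 hae (ae_neq 0) (ae_neq T) => t ht t0 tT Dt.
  have Dt' : `]0, T[%classic t.
    move: Dt; rewrite /= !in_itv/= !lt_neqAle => /andP[-> ->].
    by rewrite eq_sym t0 tT.
  have := ht Dt' _ (clamp_D T0 (t + h)).
  have ds := ph_domB phV (du _ (clamp_D T0 (t + h))) (du _ Dt).
  rewrite /difference_quotient (bfZr phV b1) ?(bfZr phV b2)//; try exact: L2T_dom Dt.
  by rewrite -mulrBr mulrA mulfV// mul1r.
pose hp n : R := n.+1%:R^-1; pose hm n : R := - n.+1%:R^-1.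
have hp0 : hp @ \oo --> (0 : R) by exact: cvg_harmonic.
have hm0 : hm @ \oo --> (0 : R) by rewrite -[X in _ --> X]oppr0; exact: cvgN.
have hpn n : hp n != 0 by rewrite invr_eq0 pnatr_eq0.
have hmn n : hm n != 0 by rewrite oppr_eq0 invr_eq0 pnatr_eq0.
have lim h (h0 : h @ \oo --> (0 : R)) (hn : forall n, h n != 0) :
    (fun n => formT beta1 r1 (difference_quotient T u (h n) : L2T V T) -
    formT beta2 r2 (difference_quotient T u (h n) : L2T V T)) @ \oo -->
    formT beta1 r1 (u' : L2T V T) - formT beta2 r2 (u' : L2T V T).
  by apply: cvgB; [exact: (difference_quotient_weak phV T0 pu h0 hn b1 d1)|
    exact: (difference_quotient_weak phV T0 pu h0 hn b2 d2)].
apply/eqP; rewrite -subr_eq0 eq_le; apply/andP; split.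
  have cv := lim _ hm0 hmn; rewrite -(cvg_lim (@Rhausdorff R) cv); apply: limr_le.
    by apply/cvg_ex; eexists; exact: cv.
  apply: nearW => n; have := key _ (hmn n).
  by rewrite /hm mulNr oppr_ge0 pmulr_rle0// invr_gt0.
have cv := lim _ hp0 hpn; rewrite -(cvg_lim (@Rhausdorff R) cv); apply: limr_ge.
  by apply/cvg_ex; eexists; exact: cv.
by apply: nearW => n; have := key _ (hpn n); rewrite /hp pmulr_rge0// invr_gt0.
Qed.

Variables (bA : V -> V -> R) (M c : R) (EK : set V).
Hypotheses (bbA : bounded_form bA M)
  (bA_sym : forall x y, dom V x -> dom V y -> bA x y = bA y x)
  (c_gt0 : 0 < c)
  (bA_coer : forall x, dom V x -> c * sn V x ^+ 2 <= bA x x).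

Let bb := ph_bounded_form phV.

Definition evolution_inequality (f u u' : R -> V) :=
  [/\ primitive T u u', dom (L2T V T) f &
      {ae mu, forall t, `]0, T[%classic t -> EK (u t) /\
         forall tau, EK tau -> dom V tau ->
           0 <= bA (u' t) (tau - u t) - b (f t) (tau - u t)}].

(** [energy_identity] wants [u s] as test element for every s in [0, T], while [EK (u s)] is known
    for almost every s. For fixed t both pairings are continuous in the test element and u is
    continuous in s, so a dense set of times suffices. *)
Lemma evi_energy f u u' : evolution_inequality f u u' ->
  formT bA (u' : L2T V T) (u' : L2T V T) = formT b (f : L2T V T) (u' : L2T V T).
Proof.
move=> [pu df hae]; have [du' du _] := pu.
apply: (energy_identity pu bbA bb du' df).
have dense := ae_dense T0 hae.
have aeF := ae_filter_ringOfSetsType mu.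
apply: filterS hae => t ht Dt' s Ds; have [_ {}ht] := ht Dt'.
have Dt : D t by move: Dt'; apply: subset_itv_oo_cc.
have du't : dom V (u' t) := L2T_dom du' Dt.
have dft : dom V (f t) := L2T_dom df Dt.
(* A negative value g at s would remain negative at a nearby admissible time r, as the pairings
   change by at most [K * sn V (u r - u s)]. *)
rewrite leNgt; apply/negP => neg.
set g := (X in X < 0) in neg.
pose K := M * sn V (u' t) + sn V (f t).
have K1 : 0 < K + 1.
  by rewrite ltr_wpDl// addr_ge0 ?mulr_ge0 ?(bf_ge0 bbA) ?(ph_ge0 phV).
have e0 : 0 < - g / (K + 1) by rewrite divr_gt0// oppr_gt0.
have [d d0 hd] := primitive_uniform_continuous phV pu e0.
have [r [Dr rs [EKr _]]] := dense _ Ds _ d0.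
have := ht _ EKr (du _ Dr); have := hd _ _ Ds Dr rs.
rewrite ltr_pdivlMr// => sm h.
have dsr := ph_domB phV (du _ Dr) (du _ Ds).
have dst := ph_domB phV (du _ Ds) (du _ Dt).
have h1 := le_trans (ler_norm _) (bf_le bbA du't dsr).
have h2 := le_trans (ler_norm _) (bf_le bb (ph_domN phV dft) dsr).
rewrite (bfNl phV bb)// (ph_snN phV)// mul1r in h2.
move: h; rewrite -(subrKA (u s)) (bfDr phV bbA)// (bfDr phV bb)//.
have h3 := ph_ge0 phV (u r - u s).
suff : bA (u' t) (u r - u s) - b (f t) (u r - u s) < - g by rewrite /g; lra.
apply: le_lt_trans sm; rewrite /K; lra.
Qed.

(** Coercivity, the energy identity and Cauchy-Schwarz give c |u'|^2 <= |f| |u'|. *)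
Lemma evi_bound f u u' : evolution_inequality f u u' ->
  sn (L2T V T) u' <= sn (L2T V T) f / c.
Proof.
move=> evi; have E := evi_energy evi; have [[du' _ _] df _] := evi.
have coer : c * sn (L2T V T) u' ^+ 2 <= formT bA (u' : L2T V T) (u' : L2T V T).
  rewrite L2T_sn_sqr -RintegralZl//; last exact: (L2T_rintegrable_sqr phV du').
  apply: le_Rintegral => //.
  - by apply: rintegrableZ => //; exact: (L2T_rintegrable_sqr phV du').
  - exact: (L2T_rintegrable_form phV bbA du' du').
  - by move=> t Dt; apply: bA_coer; exact: (L2T_dom du').
rewrite ler_pdivlMr// mulrC.
have := le_trans (ler_norm _) (ph_cauchy_schwarz phL df du').
rewrite -E => h; have := le_trans coer h; rewrite expr2 mulrA.
have [->|n0] := eqVneq (sn (L2T V T) u') 0; first by rewrite !mulr0 (ph_ge0 phL).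
by rewrite ler_pM2r// lt_def n0 sqrtr_ge0.
Qed.

(** Each solution is a test element in the inequality of the other. The sum of the two bounds bA
    (w', w) by b (f1 - f2, w) for the difference w, and the product rule for bA (w, w) yields the
    factor 2. *)
Lemma evi_compare f1 u1 u1' f2 u2 u2' t :
  evolution_inequality f1 u1 u1' -> evolution_inequality f2 u2 u2' ->
  sn V (u1 0 - u2 0) = 0 -> 0 <= t -> t <= T ->
  c * sn V (u1 t - u2 t) ^+ 2 <=
  2 * \int[mu]_(x in `[0, t]) b (f1 x - f2 x) (u1 x - u2 x).
Proof.
move=> [pu1 df1 h1] [pu2 df2 h2] w0 t0 tT.
have pw := primitiveB phV pu1 pu2; have [dw' dw _] := pw.
have [du1' du1 _] := pu1; have [du2' du2 _] := pu2.
have df := ph_domB phL df1 df2.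
have Dt : D t by rewrite /= in_itv/= t0.
have D0 : D 0 by rewrite /= in_itv/= lexx ltW.
rewrite (le_trans (bA_coer (dw _ Dt)))//.
have prod := primitive_product phV T0 bbA pw pw t0 tT.
have bA0 : bA ((u1 - u2) 0) ((u1 - u2) 0) = 0.
  apply/eqP; rewrite -normr_le0 (le_trans (bf_le bbA (dw _ D0) (dw _ D0)))//.
  by rewrite [sn V _]w0 mulr0.
rewrite bA0 subr0 in prod; rewrite -[leLHS]prod.
have dLw := primitive_L2T phV T0 pw.
have i1 := rintegrable_sub_itv (L2T_rintegrable_form phV bbA dw' dLw) (lexx 0) tT.
have i1' := rintegrable_sub_itv (L2T_rintegrable_form phV bbA dLw dw') (lexx 0) tT.
have i2 := rintegrable_sub_itv (L2T_rintegrable_form phV bb df dLw) (lexx 0) tT.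
rewrite -RintegralZl//; apply: le_Rintegral_ae => //.
- exact: rintegrableD.
- exact: rintegrableZ.
have aeF := ae_filter_ringOfSetsType mu.
apply: filterS3 (ae_neq 0) (ae_neq T) (filterI h1 h2) => x x0 xT [k1 k2] xt.
have Dx : D x.
  by move: xt; rewrite /= !in_itv/= => /andP[-> /le_trans]; apply.
have Dx' : `]0, T[%classic x.
  move: Dx; rewrite /= !in_itv/= !lt_neqAle => /andP[-> ->].
  by rewrite eq_sym x0 xT.
have [EK1 {}k1] := k1 Dx'; have [EK2 {}k2] := k2 Dx'.
have := k1 _ EK2 (du2 _ Dx); have := k2 _ EK1 (du1 _ Dx).
rewrite (bA_sym (dw _ Dx) (L2T_dom dw' Dx)).
have d1 : dom V (u1 x) := du1 _ Dx. have d2 : dom V (u2 x) := du2 _ Dx.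
have e1 : dom V (f1 x) := L2T_dom df1 Dx. have e2 : dom V (f2 x) := L2T_dom df2 Dx.
have d1' : dom V (u1' x) := L2T_dom du1' Dx. have d2' : dom V (u2' x) := L2T_dom du2' Dx.
rewrite [(u1 - u2) x]/(u1 x - u2 x) [(u1' - u2') x]/(u1' x - u2' x).
have d12 := ph_domB phV d1 d2.
rewrite -[u2 x - u1 x]opprB (bfNr phV bbA)// (bfNr phV bb)//.
rewrite (bfBl phV bbA)// (bfBl phV bb)//.
lra.
Qed.

(** * Stability of solutions along a sequence of data *)

Section sequence.
Variables (f u u' : R -> V) (f_ u_ u_' : nat -> R -> V) (E_ : nat -> R -> V).
Variables (B : R).
Hypotheses (evi : evolution_inequality f u u')
  (evi_ : forall n, evolution_inequality (f_ n) (u_ n) (u_' n))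
  (init : forall n, sn V (u_ n 0 - u 0) = 0)
  (pE : forall n, primitive T (E_ n) (f_ n - f))
  (fB : forall n, sn (L2T V T) (f_ n - f) <= B)
  (EB : forall n t, D t -> sn V (E_ n t) <= B)
  (E0 : forall t, D t -> (fun n => sn V (E_ n t)) @ \oo --> (0 : R)).

Let pu : primitive T u u'. Proof. by case: evi. Qed.
Let pu_ n : primitive T (u_ n) (u_' n). Proof. by case: (evi_ n). Qed.
Let pw n := primitiveB phV (pu_ n) pu.
Let df : dom (L2T V T) f. Proof. by case: evi. Qed.
Let df_ n : dom (L2T V T) (f_ n). Proof. by case: (evi_ n). Qed.
Let du' : dom (L2T V T) u'. Proof. by case: pu. Qed.
Let du_' n : dom (L2T V T) (u_' n). Proof. by case: (pu_ n). Qed.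
Let dw' n : dom (L2T V T) (u_' n - u'). Proof. by case: (pw n). Qed.
Let dw n t : D t -> dom V (u_ n t - u t). Proof. by case: (pw n) => _ + _; exact. Qed.

Lemma evi_derivative_bounded : exists B', forall n, sn (L2T V T) (u_' n - u') <= B'.
Proof.
exists ((B + sn (L2T V T) f) / c + sn (L2T V T) u') => n.
rewrite (le_trans (ph_snB phL (du_' n) du'))// lerD2r.
rewrite (le_trans (evi_bound (evi_ n)))// ler_pM2r ?invr_gt0//.
by rewrite (le_trans (ph_sn_le phL (df_ n) df))// addrC lerD2r.
Qed.

Let bound_w B' : (forall n, sn (L2T V T) (u_' n - u') <= B') -> forall n t, D t ->
  sn V (u_ n t - u t) <= Num.sqrt T * B'.
Proof.
move=> hB n t Dt.
rewrite (le_trans (primitive_bound phV T0 (pw n) Dt))// [sn V _]init add0r.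
by rewrite ler_wpM2l ?sqrtr_ge0.
Qed.

(** The data difference is only bounded, but its primitive [E_ n] tends to 0: the product rule moves
    the time derivative from [E_ n] to the difference of the solutions, whose derivative is
    bounded. *)
Lemma evi_pointwise_cvg t : D t -> (fun n => sn V (u_ n t - u t)) @ \oo --> (0 : R).
Proof.
move=> Dt; have [B' hB] := evi_derivative_bounded.
have hw := bound_w hB.
have dE n := primitive_L2T phV T0 (pE n).
have nE := L2T_cvg0 dE EB E0.
have [t0 tT] : 0 <= t /\ t <= T by move: Dt; rewrite /= in_itv/= => /andP[].
have D0 : D 0 by rewrite /= in_itv/= lexx ltW.
(* The two summands bound the boundary term at t, where sqrt T * B' dominates the difference of the
   solutions, and the integral of b (E_n, w'). *)
pose v n := 2 / c * (sn V (E_ n t) * (Num.sqrt T * B') + sn (L2T V T) (E_ n) * B').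
have v0 : v @ \oo --> (0 : R).
  rewrite -[X in _ --> X](mulr0 (2 / c)); apply: cvgMr.
  rewrite -[X in _ --> X](addr0 0); apply: cvgD.
    by rewrite -[X in _ --> X](mul0r (Num.sqrt T * B')); apply: cvgMl; exact: E0.
  by rewrite -[X in _ --> X](mul0r B'); apply: cvgMl.
suff h n : sn V (u_ n t - u t) ^+ 2 <= v n.
  have : (fun n => sn V (u_ n t - u t) ^+ 2) @ \oo --> (0 : R).
    by apply: squeeze0 v0 => n; rewrite ger0_norm ?sqr_ge0.
  move=> /sqrt_cvg0; apply: cvg_trans; apply: near_eq_cvg; apply: nearW => n.
  by rewrite sqrtr_sqr ger0_norm// (ph_ge0 phV).
have vE : c * v n =
    2 * (sn V (E_ n t) * (Num.sqrt T * B') + sn (L2T V T) (E_ n) * B').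
  by rewrite /v mulrA mulrCA divff ?mulr1// gt_eqF.
rewrite -(ler_pM2l c_gt0) vE.
apply: (le_trans (evi_compare (evi_ n) evi (init n) t0 tT)); rewrite ler_pM2l//.
have dn' : dom (L2T V T) (f_ n - f) := ph_domB phL (df_ n) df.
have dLw := primitive_L2T phV T0 (pw n).
have [_ dEp _] := pE n.
have i1 := rintegrable_sub_itv (L2T_rintegrable_form phV bb dn' dLw) (lexx 0) tT.
have i2 := rintegrable_sub_itv (L2T_rintegrable_form phV bb (dE n) (dw' n)) (lexx 0) tT.
have prod := primitive_product phV T0 bb (pE n) (pw n) t0 tT.
rewrite RintegralD// in prod.
have b0 : b (E_ n 0) ((u_ n - u) 0) = 0.
  apply/eqP; rewrite -normr_le0 (le_trans (ph_cauchy_schwarz phV (dEp _ D0) (dw n D0)))//.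
  by rewrite [X in _ * X]init mulr0.
rewrite b0 subr0 in prod.
rewrite (_ : \int[mu]_(x in `[0, t]) b (f_ n x - f x) (u_ n x - u x) =
  b (E_ n t) (u_ n t - u t) - \int[mu]_(x in `[0, t]) b (E_ n x) ((u_' n - u') x)); last first.
  by apply/eqP; rewrite eq_sym subr_eq; apply/eqP; rewrite -[LHS]prod.
apply: lerD.
  rewrite (le_trans (ler_norm _))// (le_trans (ph_cauchy_schwarz phV (dEp _ Dt) (dw n Dt)))//.
  by rewrite ler_wpM2l ?(ph_ge0 phV)// hw.
have m1 := L2T_measurable_sn phV (dE n); have m2 := L2T_measurable_sn phV (dw' n).
have q1 := L2T_rintegrable_sqr phV (dE n); have q2 := L2T_rintegrable_sqr phV (dw' n).
have q3 := rintegrableM_sqr mD m1 m2 q1 q2.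
rewrite -mulN1r in i2 *; rewrite mulN1r.
rewrite (le_trans (ler_norm _))// normrN (le_trans (le_normr_Rintegral _ i2))//.
apply: (@le_trans _ _ (\int[mu]_(x in `[0, t]) (sn V (E_ n x) * sn V ((u_' n - u') x)))).
  apply: le_Rintegral => //; first exact: rintegrable_norm.
    exact: (rintegrable_sub_itv q3 (lexx 0) tT).
  move=> x; rewrite /= in_itv/= => /andP[x0 xt].
  have Dx : D x by rewrite /= in_itv/= x0 (le_trans xt).
  exact: (ph_cauchy_schwarz phV (dEp _ Dx) (L2T_dom (dw' n) Dx)).
apply: (@le_trans _ _ (\int[mu]_(x in D) (sn V (E_ n x) * sn V ((u_' n - u') x)))).
  apply: Rintegral_subset => //.
  - by apply: subset_itv; rewrite bnd_simp.
  - by move=> x _; rewrite mulr_ge0 ?(ph_ge0 phV).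
apply: (@le_trans _ _ (sn (L2T V T) (E_ n) * sn (L2T V T) (u_' n - u'))); last first.
  by rewrite ler_wpM2l ?sqrtr_ge0.
rewrite -ler_sqr ?nnegrE ?mulr_ge0 ?sqrtr_ge0//; last first.
  by apply: Rintegral_ge0 => x _; rewrite mulr_ge0 ?(ph_ge0 phV).
by rewrite exprMn !L2T_sn_sqr; exact: Rintegral_cauchy_schwarz.
Qed.

Lemma evi_L2T_cvg : (fun n => sn (L2T V T) (u_ n - u)) @ \oo --> (0 : R).
Proof.
have [B' hB] := evi_derivative_bounded.
apply: (L2T_cvg0 (fun n => primitive_L2T phV T0 (pw n)) (bound_w hB)).
exact: evi_pointwise_cvg.
Qed.

(** Over an interval the derivative of the difference integrates to an increment of the difference,
    which tends to 0; boundedness extends this to all test functions in L^2. *)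
Lemma evi_weak_derivative beta M' (r : L2T V T) : bounded_form beta M' ->
  dom (L2T V T) r ->
  (fun n => formT beta r (u_' n - u' : L2T V T)) @ \oo --> (0 : R).
Proof.
move=> bbeta dr; have [B' hB] := evi_derivative_bounded.
apply: (weak_L2T_form phV T0 dw' hB _ bbeta dr) => phi C bphi s t s0 st tT.
have Ds : D s by rewrite /= in_itv/= s0 (le_trans st).
have Dt : D t by rewrite /= in_itv/= tT (le_trans s0).
apply: (squeeze0 (v := fun n => C * (sn V (u_ n t - u t) + sn V (u_ n s - u s)))) => [n|].
  have [_ _ /(_ phi C bphi s t s0 st tT) <-] := pw n.
  have d1 := dw n Dt; have d2 := dw n Ds.
  rewrite (le_trans (bl_le bphi (ph_domB phV d1 d2)))// ler_wpM2l ?(bl_ge0 bphi)//.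
  exact: (ph_snB phV).
rewrite -[X in _ --> X](mulr0 C); apply: cvgMr.
by rewrite -[X in _ --> X](addr0 0); apply: cvgD; exact: evi_pointwise_cvg.
Qed.

(** For w' = u_n' - u' the two energy identities combine to bA (w', w') = (f_n - f, u_n') + (f, w')
    - 2 bA (u', w'), integrated in time. The first term is small by strong convergence of the data,
    the others by weak convergence of w'. *)
Lemma evi_strong_derivative :
  (fun n => sn (L2T V T) (f_ n - f)) @ \oo --> (0 : R) ->
  (fun n => sn (L2T V T) (u_' n - u')) @ \oo --> (0 : R).
Proof.
move=> fn0; have [B' hB] := evi_derivative_bounded.
have bTA := L2T_bounded_form T phV bbA; have bT := L2T_bounded_form T phV bb.
have symA (x y : L2T V T) : dom (L2T V T) x -> dom (L2T V T) y -> formT bA x y = formT bA y x.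
  move=> dx dy; apply: eq_Rintegral => t /set_mem Dt.
  by apply: bA_sym; [exact: (L2T_dom dx)|exact: (L2T_dom dy)].
pose v n := c^-1 * (sn (L2T V T) (f_ n - f) * (B' + sn (L2T V T) u') +
  formT b (f : L2T V T) (u_' n - u' : L2T V T) -
  2 * formT bA (u' : L2T V T) (u_' n - u' : L2T V T)).
have v0 : v @ \oo --> (0 : R).
  rewrite -[X in _ --> X](mulr0 c^-1); apply: cvgMr.
  rewrite -[X in _ --> X](subr0 0); apply: cvgB; last first.
    by rewrite -[X in _ --> X](mulr0 2); apply: cvgMr; exact: (evi_weak_derivative bbA du').
  rewrite -[X in _ --> X](addr0 0); apply: cvgD; last exact: (evi_weak_derivative bb df).
  by rewrite -[X in _ --> X](mul0r (B' + sn (L2T V T) u')); apply: cvgMl.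
suff h n : sn (L2T V T) (u_' n - u') ^+ 2 <= v n.
  have : (fun n => sn (L2T V T) (u_' n - u') ^+ 2) @ \oo --> (0 : R).
    by apply: squeeze0 v0 => n; rewrite ger0_norm ?sqr_ge0.
  move=> /sqrt_cvg0; apply: cvg_trans; apply: near_eq_cvg; apply: nearW => n.
  by rewrite sqrtr_sqr ger0_norm// sqrtr_ge0.
rewrite /v -(ler_pM2l c_gt0) mulVKf ?gt_eqF//.
have coer : c * sn (L2T V T) (u_' n - u') ^+ 2 <=
    formT bA (u_' n - u' : L2T V T) (u_' n - u' : L2T V T).
  rewrite L2T_sn_sqr -RintegralZl//; last exact: (L2T_rintegrable_sqr phV (dw' n)).
  apply: le_Rintegral => //.
  - by apply: rintegrableZ => //; exact: (L2T_rintegrable_sqr phV (dw' n)).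
  - exact: (L2T_rintegrable_form phV bbA (dw' n) (dw' n)).
  - by move=> t Dt; apply: bA_coer; exact: (L2T_dom (dw' n)).
rewrite (le_trans coer)//.
have en := evi_energy (evi_ n); have e := evi_energy evi.
rewrite (bfBl phL bTA)// !(bfBr phL bTA)// (bfBr phL bT)// en e.
rewrite (symA (u_' n) u')//.
have dff : dom (L2T V T) (f_ n - f) := ph_domB phL (df_ n) df.
have : formT b (f_ n - f : L2T V T) (u_' n : L2T V T) <=
    sn (L2T V T) (f_ n - f) * (B' + sn (L2T V T) u').
  rewrite (le_trans (ler_norm _))// (le_trans (ph_cauchy_schwarz phL dff (du_' n)))//.
  rewrite ler_wpM2l ?sqrtr_ge0// (le_trans (ph_sn_le phL (du_' n) du'))//.
  by rewrite addrC lerD2r.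
rewrite (bfBl phL bT)//.
lra.
Qed.

End sequence.

End evolution_inequality.

(** * Weak-to-strong continuity by a Banach-Saks argument *)

(** * Compact operators on a Hilbert space *)

Section compact_operator.
Variables (R : realType) (Xc : completeNormedModType R) (ip : {dot Xc for idfun}).
Hypothesis Xc_hilbert : forall x : Xc, `|x| ^+ 2 = ip x x.

Lemma hilbert_prehilbert : prehilbert (V := normed_snspace Xc) ip.
Proof.
split => //=.
- by move=> a x y z _ _ _; rewrite linearPl.
- move=> x y _ _; have := @hermitian_subproof _ _ _ _ ip x y.
  by rewrite expr0 mul1r.
Qed.

Let phX := hilbert_prehilbert.

Variables (X : completeNormedModType R) (j : {linear Xc -> X}).
Hypothesis j_compact : compact (closure (j @` [set x | `|x| <= 1])).

Lemma compact_operator_bounded : exists2 C : R, 0 <= C & forall x, `|j x| <= C * `|x|.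
Proof.
have [M [_ hM]] := compact_bounded j_compact.
have jM x : `|x| <= 1 -> `|j x| <= `|M| + 1.
  move=> x1; apply: hM; first by rewrite (le_lt_trans (ler_norm _))// ltrDl.
  by apply: subset_closure; exists x.
exists (`|M| + 1) => [|x]; first by rewrite addr_ge0.
have [->|x0] := eqVneq x 0; first by rewrite linear0 !normr0 mulr0.
have xp : 0 < `|x| by rewrite normr_gt0.
have := jM (`|x|^-1 *: x); rewrite normrZ normfV normr_id mulVf ?gt_eqF// => /(_ (lexx _)).
by rewrite linearZ normrZ normfV normr_id mulrC ler_pdivrMr.
Qed.

(** Otherwise the images accumulate at some p with |p| >= e > 0. Summing n terms, chosen nearly
    orthogonal to the sum so far and with image near p, gives s with |s| of order sqrt n while |j s|
    is at least n e / 2, against boundedness of [j] for large n. *)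
Lemma compact_operator_unit_ball (z : nat -> Xc) : (forall k, `|z k| <= 1) ->
  (forall h, (fun k => ip (z k) h) @ \oo --> (0 : R)) ->
  (fun k => `|j (z k)|) @ \oo --> (0 : R).
Proof.
move=> z1 z0; apply: contrapT => ncv.
have [e e0 he] : exists2 e : R, 0 < e & forall N, exists2 k, (N <= k)%N & e <= `|j (z k)|.
  apply: contrapT => nex; apply: ncv; apply/cvgrPdist_lt => e e0.
  apply: contrapT => nnear; apply: nex; exists e => // N.
  apply: contrapT => nk; apply: nnear; exists N => // k /= Nk.
  rewrite sub0r normrN normr_id ltNge; apply/negP => ek; apply: nk.
  by exists k.
have /choice[k_ hk] N : exists k, (N <= k)%N /\ e <= `|j (z k)|.
  by have [k ? ?] := he N; exists k.
pose y N := j (z (k_ N)).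
have [|p [_ pcl]] := @j_compact (y @ \oo) (fmap_proper_filter y _).
  by exists 0%N => // N _; apply: subset_closure; exists (z (k_ N)) => //; exact: z1.
have freq (d : R) N : 0 < d -> exists2 m, (N <= m)%N & `|y m - p| < d.
  move=> d0; have [_ [[m Nm <-] hb]] := pcl (y @` [set m | (N <= m)%N]) (ball p d)
    (ltac:(by exists N => // m /= Nm; exists m)) (nbhsx_ballx p d d0).
  by exists m => //; rewrite -ball_normE/= distrC in hb.
have pe : e <= `|p|.
  rewrite leNgt; apply/negP => pe; have d0 : 0 < e - `|p| by rewrite subr_gt0.
  have [m _ hm] := freq _ 0%N d0; have [_ hem] := hk m.
  have := ler_normD (y m - p) p; rewrite subrK.
  by move: hm hem; rewrite -/(y m); lra.
have e2 : 0 < e / 2 by rewrite divr_gt0.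
(* Banach-Saks: sums of n nearly orthogonal terms have norm O(sqrt n). *)
have saks n : exists s : Xc, `|s| ^+ 2 <= 2 * n%:R /\ `|j s - n%:R *: p| <= n%:R * (e / 2).
  elim: n => [|n [s [s1 s2]]].
    by exists 0; rewrite linear0 scale0r subr0 !normr0 !mulr0 mul0r expr0n lexx.
  (* An inner product below 1/2 with the current sum raises the square of the norm by at most 1 + 1,
     whence the constant 2 n. *)
  have /cvgrPdist_lt/(_ (2^-1)) := z0 s; rewrite invr_gt0 => /(_ (ltr0n _ 2))[N _ hN].
  have [m Nm hm] := freq _ N e2; exists (s + z (k_ m)); split.
    have := ph_sqD phX (x := s) (y := z (k_ m)) I I; rewrite /= => ->.
    rewrite (ph_sym phX (x := s))//.
    have := hN (k_ m) (leq_trans Nm (hk m).1); rewrite sub0r normrN => h1.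
    have := le_lt_trans (ler_norm _) h1 => h2.
    have h3 : `|z (k_ m)| ^+ 2 <= 1 by rewrite expr_le1.
    by rewrite -natr1; move: s1 h2 h3; lra.
  rewrite linearD -natr1 scalerDl scale1r opprD addrACA mulrDl mul1r.
  by rewrite (le_trans (ler_normD _ _))// lerD// ltW.
have [C C0 hC] := compact_operator_bounded.
(* From n e / 2 <= C |s| and |s|^2 <= 2 n: squaring and dividing by n leaves 8 C^2. *)
have main n : n%:R * e ^+ 2 <= 8 * C ^+ 2 + 1.
  have [->|n0] := posnP n; first by rewrite mul0r addr_ge0// mulr_ge0// sqr_ge0.
  have np : 0 < n%:R :> R by rewrite ltr0n.
  have [s [s1 s2]] := saks n.
  have h1 : n%:R * `|p| <= n%:R * (e / 2) + C * `|s|.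
    rewrite -[n%:R in leLHS]ger0_norm// -normrZ -[n%:R *: p](subKr (j s)).
    by rewrite (le_trans (ler_normB _ _))// addrC lerD// hC.
  have h2 : n%:R * (e / 2) <= C * `|s|.
    have := ler_wpM2l (ltW np) pe; lra.
  have h3 : (n%:R * (e / 2)) ^+ 2 <= C ^+ 2 * (2 * n%:R).
    apply: (@le_trans _ _ ((C * `|s|) ^+ 2)).
      by rewrite ler_sqr ?nnegrE// mulr_ge0 ?ler0n ?(ltW e2).
    by rewrite exprMn ler_wpM2l ?sqr_ge0.
  apply: (@le_trans _ _ (8 * C ^+ 2)); last by rewrite lerDl.
  rewrite -(ler_pM2l np); move: h3; nra.
have ee : 0 < e ^+ 2 by rewrite exprn_gt0.
have := main (Num.bound ((8 * C ^+ 2 + 1) / e ^+ 2)).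
rewrite leNgt => /negP; apply; rewrite -ltr_pdivrMr//.
by apply: archi_boundP; rewrite divr_ge0 ?sqr_ge0// addr_ge0// mulr_ge0 ?sqr_ge0.
Qed.

Lemma compact_operator_weak_strong (z : nat -> Xc) (B : R) :
  (forall k, `|z k| <= B) ->
  (forall h, (fun k => ip (z k) h) @ \oo --> (0 : R)) ->
  (fun k => `|j (z k)|) @ \oo --> (0 : R).
Proof.
move=> zB z0; have B1 : 0 < B + 1 by rewrite ltr_wpDl// (le_trans _ (zB 0%N)).
have := @compact_operator_unit_ball (fun k => (B + 1)^-1 *: z k) _ _.
have k1 k : `|(B + 1)^-1 *: z k| <= 1.
  rewrite normrZ gtr0_norm ?invr_gt0// ler_pdivrMl// mulr1.
  by rewrite (le_trans (zB k))// lerDl.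
have k2 h : (fun k => ip ((B + 1)^-1 *: z k) h) @ \oo --> (0 : R).
  rewrite (_ : (fun _ => _) = fun k => (B + 1)^-1 * ip (z k) h).
    by rewrite -[X in _ --> X](mulr0 (B + 1)^-1); apply: cvgMr; exact: z0.
  by apply/funext => k; rewrite linearZl_LR.
move=> /(_ k1 k2) h.
rewrite (_ : (fun k => _) = fun k => (B + 1) * `|j ((B + 1)^-1 *: z k)|).
  by rewrite -[X in _ --> X](mulr0 (B + 1)); exact: cvgMr.
apply/funext => k.
by rewrite linearZ normrZ gtr0_norm ?invr_gt0// mulVKf// gt_eqF.
Qed.

End compact_operator.

(** * Stresses and the compliance form *)

Section open_measurable_mx.
Variables (R : realType) (m n : nat).

(** The sigma-algebra is generated by the coordinates, and an open set is the union of the boxes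
    with rational centre and radius 1/(k+1) that it contains; these are countably many. *)
Lemma open_measurable_mx (O : set 'M[R]_(m, n)) : open O -> measurable O.
Proof.
move=> oO.
pose box (p : {ffun 'I_m * 'I_n -> rat} * nat) : set 'M[R]_(m, n) :=
  [set x | forall i j, `|x i j - ratr (p.1 (i, j))| < p.2.+1%:R^-1].
have mbox p : measurable (box p).
  rewrite (_ : box p = \bigcap_(k in [set: 'I_m * 'I_n])
      ((fun x : 'M[R]_(m, n) => x k.1 k.2) @^-1` ball (ratr (p.1 k) : R) (p.2.+1%:R^-1))).
    apply: fin_bigcap_measurable => [|k _]; first exact: finite_finset.
    rewrite -[X in measurable X]setTI; apply: measurable_mx_coord => //.
    exact: measurable_ball.
  apply/seteqP; split => x /=.
    by move=> h [i k] _ /=; rewrite -ball_normE/= distrC.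
  by move=> h i k; have := h (i, k) I; rewrite -ball_normE/= distrC.
rewrite (_ : O = \bigcup_(p in [set p | box p `<=` O]) box p).
  rewrite bigcup_mkcond; apply: countable_bigcupT_measurable => //.
  by move=> p; case: ifP => _ //; exact: mbox.
apply/seteqP; split => [x Ox|x [p /= pO px]]; last exact: pO.
have /nbhs_ballP[e /= e0 heO] : nbhs x O by exact: open_nbhs_nbhs.
have [k _ /(_ k (leqnn k))] : \forall k \near \oo, k.+1%:R^-1 < e / 2.
  have /cvgrPdist_lt/(_ (e / 2)) := @cvg_harmonic R; rewrite divr_gt0// => /(_ isT).
  by apply: filterS => k; rewrite sub0r normrN gtr0_norm ?invr_gt0 ?ltr0n.
rewrite /= => ke; have k0 : 0 < k.+1%:R^-1 :> R by rewrite invr_gt0 ltr0n.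
have /choice[q hq] (ij : 'I_m * 'I_n) : exists r : rat,
    `|x ij.1 ij.2 - ratr r| < k.+1%:R^-1.
  have : x ij.1 ij.2 - k.+1%:R^-1 < x ij.1 ij.2 + k.+1%:R^-1 by rewrite ltrBlDr -addrA ltrDl addr_gt0.
  move=> /rat_in_itvoo[r]; rewrite in_itv/= => /andP[r1 r2]; exists r.
  rewrite distrC ltr_norml; move: r1 r2; move: (k.+1%:R^-1) (ratr r) => e1 e2 r1 r2.
  by apply/andP; split; lra.
exists ([ffun ij => q ij], k) => /= [y hy|i l]; last by rewrite ffunE; exact: (hq (i, l)).
apply: heO; split => // i l; rewrite -ball_normE/=.
have := hy i l; rewrite ffunE => h1; have h2 := hq (i, l); rewrite distrC in h1.
rewrite -(subrKA (ratr (q (i, l)))) (le_lt_trans (ler_normD _ _))//.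
by rewrite [ltRHS]splitr; apply: ltrD; apply: lt_trans ke.
Qed.

Lemma measurable_fun_mxP d (T : measurableType d) (D : set T) (f : T -> 'M[R]_(m, n)) :
  measurable_fun D f <-> forall i j, measurable_fun D (fun x => f x i j).
Proof.
split => [mf i j|mf].
  exact: (measurableT_comp (measurable_mx_coord i j) mf).
have [mD|nD] := pselect (measurable D); last by move=> /nD.
have mE : @measurable _ 'M[R]_(m, n) = @mx_measurable R m n by [].
by apply: (measurability _ mE) => _ [_ [i [j [B [mB ->]]]] <-]; exact: (mf i j mD).
Qed.

End open_measurable_mx.

Section mxdot_theory.
Variables (R : realType) (m n : nat).
Implicit Types A B C : 'M[R]_(m, n).

Lemma mxdotP (a : R) A B C : mxdot (a *: A + B) C = a * mxdot A C + mxdot B C.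
Proof.
rewrite /mxdot mulr_sumr -big_split; apply: eq_bigr => i _ /=.
rewrite mulr_sumr -big_split; apply: eq_bigr => k _ /=.
by rewrite !mxE mulrDl mulrA.
Qed.

Lemma mxdotC A B : mxdot A B = mxdot B A.
Proof. by apply: eq_bigr => i _; apply: eq_bigr => k _; rewrite mulrC. Qed.

Lemma mxdot_ge0 A : 0 <= mxdot A A.
Proof. by apply: sumr_ge0 => i _; apply: sumr_ge0 => k _; exact: sqr_ge0. Qed.

Lemma mxdot_prehilbert :
  prehilbert (V := @SNSpace R 'M[R]_(m, n) setT (@enorm R m n)) (@mxdot R m n).
Proof.
split => //=.
- by move=> *; exact: mxdotP.
- by move=> *; exact: mxdotC.
- by move=> x; exact: sqrtr_ge0.
- by move=> x _; rewrite sqr_sqrtr// mxdot_ge0.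
Qed.

Lemma mxdot_cauchy_schwarz A B : `|mxdot A B| <= enorm A * enorm B.
Proof. exact: (ph_cauchy_schwarz mxdot_prehilbert (x := A) (y := B) I I). Qed.

Lemma enorm_sqr A : enorm A ^+ 2 = mxdot A A.
Proof. by rewrite sqr_sqrtr// mxdot_ge0. Qed.

Lemma sqr_entry_le A i k : A i k ^+ 2 <= mxdot A A.
Proof.
rewrite /mxdot (bigD1 i)//= (bigD1 k)//= -expr2 -addrA lerDl addr_ge0//.
  by apply: sumr_ge0 => l _; exact: sqr_ge0.
by apply: sumr_ge0 => l _; apply: sumr_ge0 => p _; exact: sqr_ge0.
Qed.

Lemma entry_le_enorm A i k : `|A i k| <= enorm A.
Proof.
rewrite -ler_sqr ?nnegrE ?sqrtr_ge0// enorm_sqr real_normK ?num_real//.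
exact: sqr_entry_le.
Qed.

Lemma measurable_mxdot d (T : measurableType d) (D : set T) (f g : T -> 'M[R]_(m, n)) :
  measurable_fun D f -> measurable_fun D g ->
  measurable_fun D (fun x => mxdot (f x) (g x)).
Proof.
move=> /measurable_fun_mxP mf /measurable_fun_mxP mg.
apply: measurable_sum => i; apply: measurable_sum => k.
exact: measurable_funM.
Qed.

End mxdot_theory.

Lemma mxdotT (R : realType) (m n : nat) (A B : 'M[R]_(m, n)) : mxdot A^T B^T = mxdot A B.
Proof.
rewrite /mxdot exchange_big; apply: eq_bigr => i _; apply: eq_bigr => k _.
by rewrite !mxE.
Qed.

(** * Square-integrable matrix fields *)

Section L2_theory.
Variables (R : realType) (d : nat) (Omega : set 'rV[R]_d).
Hypothesis mOmega : measurable Omega.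
Local Notation mu := (@lebesgue_rV R d).

Section mn.
Variables m n : nat.
Implicit Types f g : L2 Omega m n.

Lemma L2_rintegrable_sqr f : dom (L2 Omega m n) f ->
  rintegrable mu Omega (fun x => mxdot (f x) (f x)).
Proof.
move=> [mf foo]; apply: rintegrable_fin => //; first exact: measurable_mxdot.
by move=> x _; exact: mxdot_ge0.
Qed.

Lemma L2_domI f : measurable_fun Omega f ->
  rintegrable mu Omega (fun x => mxdot (f x) (f x)) -> dom (L2 Omega m n) f.
Proof.
move=> mf fi; split => //; apply: rintegrable_lty => // x _; exact: mxdot_ge0.
Qed.

Lemma L2_rintegrable f g : dom (L2 Omega m n) f -> dom (L2 Omega m n) g ->
  rintegrable mu Omega (fun x => mxdot (f x) (g x)).
Proof.
move=> df dg.
have := rintegrableD mOmega (L2_rintegrable_sqr df) (L2_rintegrable_sqr dg).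
have [mf _] := df; have [mg _] := dg.
apply: le_rintegrable => //; first exact: measurable_mxdot.
move=> x _; rewrite (le_trans (mxdot_cauchy_schwarz _ _))// -!enorm_sqr.
have := sqr_ge0 (enorm (f x) - enorm (g x)).
have : 0 <= enorm (f x) by exact: sqrtr_ge0.
have : 0 <= enorm (g x) by exact: sqrtr_ge0.
nra.
Qed.

Lemma L2_prehilbert : prehilbert (V := L2 Omega m n) (@L2ip R d Omega m n).
Proof.
split.
- apply: L2_domI; first exact: measurable_cst.
  apply: eq_rintegrable (integrable0 mu Omega) => // x _.
  have := mxdotP 0 (0 : 'M[R]_(m, n)) 0 0.
  by rewrite scaler0 addr0 mul0r add0r => _; rewrite /mxdot big1// => i _; rewrite big1// => k _; rewrite !mxE mul0r.
- move=> a f g df dg; have [mf _] := df; have [mg _] := dg.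
  have ml : measurable_fun Omega (a *: f + g).
    apply/measurable_fun_mxP => i k.
    rewrite (_ : (fun x => _) = fun x => a * f x i k + g x i k); last first.
      by apply/funext => x; rewrite !mxE.
    apply: measurable_funD; last by move/measurable_fun_mxP : mg; exact.
    by apply: measurable_funM; [exact: measurable_cst|move/measurable_fun_mxP : mf; exact].
  apply: L2_domI => //.
  have i1 := L2_rintegrable_sqr df; have i2 := L2_rintegrable df dg.
  have i3 := L2_rintegrable_sqr dg.
  have := rintegrableD mOmega (rintegrableD mOmega (rintegrableZ (a ^+ 2) mOmega i1)
    (rintegrableZ (2 * a) mOmega i2)) i3.
  apply: eq_rintegrable => // x _.
  rewrite [(a *: f + g) x]/(a *: f x + g x) mxdotP (mxdotC (f x) (_ + _)).
  rewrite (mxdotC (g x) (_ + _)) !mxdotP (mxdotC (g x)); ring.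
- move=> a f g h df dg dh; rewrite /L2ip.
  have i1 := L2_rintegrable df dh; have i2 := L2_rintegrable dg dh.
  rewrite -RintegralZl// -RintegralD//; last exact: rintegrableZ.
  by apply: eq_Rintegral => x _; exact: mxdotP.
- by move=> f g _ _; apply: eq_Rintegral => x _; exact: mxdotC.
- by move=> f; exact: sqrtr_ge0.
- move=> f df; rewrite sqr_sqrtr//; apply: Rintegral_ge0 => x _; exact: mxdot_ge0.
Qed.

End mn.

Lemma L2sym_prehilbert : prehilbert (V := L2sym Omega) (@L2ip R d Omega d d).
Proof.
have ph := @L2_prehilbert d d; split.
- split; first exact: (ph_dom0 ph).
  by move=> x _; rewrite /symmx/= trmx0.
- move=> a f g [df sf] [dg sg]; split; first exact: (ph_domP ph).
  move=> x Ox; rewrite /symmx/= linearD linearZ/=.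
  by rewrite (sf x Ox) (sg x Ox).
- by move=> a f g h [df _] [dg _] [dh _]; exact: (ph_lin ph).
- by move=> f g [df _] [dg _]; exact: (ph_sym ph).
- by move=> f; exact: (ph_ge0 ph).
- by move=> f [df _]; exact: (ph_sn ph).
Qed.

End L2_theory.

Section symmetric_linear_map.
Variables (R : realType) (d : nat) (L : 'M[R]_d -> 'M[R]_d).
Hypothesis linL : forall (a : R) s t, symmx s -> symmx t ->
  L (a *: s + t) = a *: L s + L t.

Let sym0 : symmx (0 : 'M[R]_d). Proof. by rewrite /symmx/= trmx0. Qed.

Let symP (a : R) (s t : 'M[R]_d) : symmx s -> symmx t -> symmx (a *: s + t).
Proof. by rewrite /symmx/= => hs ht; rewrite linearD linearZ/= hs ht. Qed.

Let L0 : L 0 = 0.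
Proof.
have := linL 1 sym0 sym0; rewrite !scale1r addr0.
by move/eqP; rewrite addrC -subr_eq subrr eq_sym => /eqP.
Qed.

Definition sym_delta (k : 'I_d * 'I_d) : 'M[R]_d :=
  2^-1 *: (delta_mx k.1 k.2 + (delta_mx k.1 k.2)^T).

Let sym_delta_sym k : symmx (sym_delta k).
Proof. by rewrite /symmx/= /sym_delta linearZ/= linearD/= trmxK addrC. Qed.

Lemma sym_decomposition s : symmx s -> s = \sum_k s k.1 k.2 *: sym_delta k.
Proof.
move=> ss; have hs : s = \sum_k s k.1 k.2 *: delta_mx k.1 k.2.
  by rewrite {1}[s]matrix_sum_delta pair_bigA.
transitivity (2^-1 *: (s + s^T)).
  by rewrite ss -[s + s]mulr2n -[s *+ 2]scaler_nat scalerA mulVf ?scale1r// pnatr_eq0.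
rewrite {1 2}hs linear_sum -big_split scaler_sumr; apply: eq_bigr => k _ /=.
by rewrite linearZ/= -scalerDr !scalerA mulrC.
Qed.

Lemma sym_linear_decomposition s : symmx s -> L s = \sum_k s k.1 k.2 *: L (sym_delta k).
Proof.
move=> ss; rewrite {1}(sym_decomposition ss).
suff [] : symmx (\sum_k s k.1 k.2 *: sym_delta k) /\
    L (\sum_k s k.1 k.2 *: sym_delta k) = \sum_k s k.1 k.2 *: L (sym_delta k) by [].
elim/big_rec2 : _ => [|k x y _ [sy Ly]]; first by split.
by split; [exact: symP|rewrite linL// Ly].
Qed.

Lemma mxdot_sym_linear s t : symmx s ->
  mxdot (L s) t = \sum_k s k.1 k.2 * mxdot (L (sym_delta k)) t.
Proof.
move=> ss; rewrite (sym_linear_decomposition ss).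
have bt := bf_functionall (mxdot_prehilbert R d d)
  (ph_bounded_form (mxdot_prehilbert R d d)) (z := t) I.
rewrite (bl_sum (mxdot_prehilbert R d d) bt)//.
by apply: eq_bigr => k _; rewrite (blZ (mxdot_prehilbert R d d) bt).
Qed.

Lemma sym_linear_bounded : exists2 M : R, 0 <= M &
  forall s t, symmx s -> `|mxdot (L s) t| <= M * enorm s * enorm t.
Proof.
exists (\sum_k enorm (L (sym_delta k))).
  by apply: sumr_ge0 => k _; exact: sqrtr_ge0.
move=> s t ss; rewrite (mxdot_sym_linear t ss) (le_trans (ler_norm_sum _ _ _))//.
rewrite -mulrA mulr_suml; apply: ler_sum => k _; rewrite normrM mulrCA.
apply: ler_pM => //; first exact: entry_le_enorm.
exact: mxdot_cauchy_schwarz.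
Qed.

End symmetric_linear_map.

(** * Linearity, symmetry and coercivity of the inverse tensor *)

Section inverse_tensor.
Variables (R : realType) (d : nat) (C A : 'M[R]_d -> 'M[R]_d).
Hypotheses (C_elast : elasticity_tensor C) (CA_inv : inverse_tensor C A).

Let As s : symmx s -> symmx (A s). Proof. by move/CA_inv => []. Qed.
Let AC s : symmx s -> A (C s) = s. Proof. by move/CA_inv => []. Qed.
Let CA s : symmx s -> C (A s) = s. Proof. by move/CA_inv => []. Qed.

Let symP (a : R) (s t : 'M[R]_d) : symmx s -> symmx t -> symmx (a *: s + t).
Proof. by rewrite /symmx/= => hs ht; rewrite linearD linearZ/= hs ht. Qed.

Lemma inverse_tensor_linear (a : R) s t : symmx s -> symmx t ->
  A (a *: s + t) = a *: A s + A t.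
Proof.
move=> ss st; have [_ linC _ _] := C_elast.
have sA := symP a (As ss) (As st).
by rewrite -{1}(CA ss) -{1}(CA st) -(linC _ _ _ (As ss) (As st)) (AC sA).
Qed.

Lemma inverse_tensor_sym s t : symmx s -> symmx t -> mxdot (A s) t = mxdot s (A t).
Proof.
move=> ss st; have [_ _ symC _] := C_elast.
by rewrite -{1}(CA st) -(symC _ _ (As ss) (As st)) (CA ss).
Qed.

Lemma inverse_tensor_coercive : exists2 c : R, 0 < c &
  forall s, symmx s -> c * mxdot s s <= mxdot (A s) s.
Proof.
have [symC linC _ [c c0 hc]] := C_elast.
have [M M0 hM] := sym_linear_bounded linC.
(* Coercivity of [C] at [A s] gives c |A s|^2 <= (s, A s), and |s| = |C (A s)| <= M |A s|; the
   summand 1 keeps the quotient meaningful for M = 0. *)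
exists (c / (M ^+ 2 + 1)) => [|s ss].
  by rewrite divr_gt0// ltr_wpDl// sqr_ge0.
have M1 : 0 < M ^+ 2 + 1 by rewrite ltr_wpDl// sqr_ge0.
have h1 := hc _ (As ss); rewrite (CA ss) mxdotC in h1.
rewrite mulrAC ler_pdivrMr//.
have e0 : 0 <= enorm s by exact: sqrtr_ge0.
have e1 : 0 <= enorm (A s) by exact: sqrtr_ge0.
have h2 : enorm s <= M * enorm (A s).
  have := hM (A s) s (As ss); rewrite (CA ss) -enorm_sqr ger0_norm ?sqr_ge0// expr2.
  have [->|n0] := eqVneq (enorm s) 0; first by rewrite mulr_ge0.
  by rewrite ler_pM2r// lt_def n0.
have h3 : mxdot s s <= M ^+ 2 * mxdot (A s) (A s).
  by rewrite -!enorm_sqr -exprMn ler_sqr ?nnegrE// mulr_ge0.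
have h4 : 0 <= mxdot (A s) (A s) by exact: mxdot_ge0.
have h5 : 0 <= M ^+ 2 by exact: sqr_ge0.
have k1 := ler_wpM2l (ltW c0) h3.
have k2 := ler_wpM2r (ltW M1) h1.
have k3 : 0 <= c * mxdot (A s) (A s) by rewrite mulr_ge0// ltW.
rewrite (le_trans k1)// (le_trans _ k2)//; lra.
Qed.

End inverse_tensor.

Section compliance_form.
Variables (R : realType) (d : nat) (Omega : set 'rV[R]_d).
Hypothesis mOmega : measurable Omega.
Local Notation mu := (@lebesgue_rV R d).
Variables (C A : 'M[R]_d -> 'M[R]_d).
Hypotheses (C_elast : elasticity_tensor C) (CA_inv : inverse_tensor C A).

Let linA := inverse_tensor_linear C_elast CA_inv.
Let phS := L2sym_prehilbert mOmega.
Local Notation S := (L2sym Omega).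

Definition compliance_form (f g : S) : R := L2ip Omega (fun x => A (f x)) g.

Lemma compliance_rintegrable (f g : S) : dom S f -> dom S g ->
  rintegrable mu Omega (fun x => mxdot (A (f x)) (g x)).
Proof.
move=> [df sf] [dg _]; have [M M0 hM] := sym_linear_bounded linA.
have [mf _] := df; have [mg _] := dg.
have i1 := L2_rintegrable_sqr mOmega df; have i2 := L2_rintegrable_sqr mOmega dg.
have := rintegrableZ M mOmega (rintegrableD mOmega i1 i2).
apply: le_rintegrable => //.
  (* Nothing is known of [A] outside the symmetric matrices, so measurability is read off from the
     expansion in [sym_delta], a finite sum over entries of [f]. *)
  apply: (eq_measurable_fun (fun x => \sum_k f x k.1 k.2 * mxdot (A (sym_delta R k)) (g x))).
    by move=> x /set_mem Ox; rewrite (mxdot_sym_linear linA)//; exact: sf.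
  apply: measurable_sum => k; apply: measurable_funM.
    by move/measurable_fun_mxP : mf; exact.
  by apply: measurable_mxdot => //; exact: measurable_cst.
move=> x Ox; rewrite (le_trans (hM _ _ (sf x Ox)))// -mulrA ler_wpM2l// -!enorm_sqr.
have := sqr_ge0 (enorm (f x) - enorm (g x)).
have : 0 <= enorm (f x) by exact: sqrtr_ge0.
have : 0 <= enorm (g x) by exact: sqrtr_ge0.
nra.
Qed.

Lemma compliance_sym (f g : S) : dom S f -> dom S g ->
  compliance_form f g = compliance_form g f.
Proof.
move=> [_ sf] [_ sg]; apply: eq_Rintegral => x /set_mem Ox.
by rewrite (inverse_tensor_sym C_elast CA_inv) ?(mxdotC (f x))//; [exact: sf|exact: sg].
Qed.

Lemma compliance_bounded_form : exists M : R, bounded_form (V := S) compliance_form M.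
Proof.
have [M M0 hM] := sym_linear_bounded linA; exists M.
have linl (a : R) (f g h : S) : dom S f -> dom S g -> dom S h ->
    compliance_form (a *: f + g) h = a * compliance_form f h + compliance_form g h.
  move=> df dg dh; rewrite /compliance_form /L2ip.
  have i1 := compliance_rintegrable df dh; have i2 := compliance_rintegrable dg dh.
  rewrite -RintegralZl// -RintegralD//; last exact: rintegrableZ.
  apply: eq_Rintegral => x /set_mem Ox.
  by rewrite -mxdotP -linA//; [exact: (df.2 x Ox)|exact: (dg.2 x Ox)].
split=> //.
- move=> a f g h df dg dh.
  have dl := ph_domP phS a df dg.
  by rewrite (compliance_sym dh dl) linl// !(compliance_sym _ dh).
- move=> f g df dg; have i1 := compliance_rintegrable df dg.
  have [[mf _] sf] := df; have [[mg _] _] := dg.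
  have e2 (m1 n1 : nat) (B : 'M[R]_(m1, n1)) : enorm B ^+ 2 = mxdot B B by exact: enorm_sqr.
  have j1 : rintegrable mu Omega (fun x => enorm (f x) ^+ 2).
    by apply: eq_rintegrable (L2_rintegrable_sqr mOmega df.1) => // x _; rewrite e2.
  have j2 : rintegrable mu Omega (fun x => enorm (g x) ^+ 2).
    by apply: eq_rintegrable (L2_rintegrable_sqr mOmega dg.1) => // x _; rewrite e2.
  have me (h : S) : measurable_fun Omega (h : 'rV[R]_d -> 'M[R]_d) ->
      measurable_fun Omega (fun x => enorm (h x)).
    move=> mh.
    exact: (measurableT_comp (continuous_measurable_fun (@sqrt_continuous R)) (measurable_mxdot mh mh)).
  have m1 := me _ mf; have m2 := me _ mg.
  have j3 := rintegrableM_sqr mOmega m1 m2 j1 j2.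
  rewrite (le_trans (le_normr_Rintegral _ i1))//.
  apply: (@le_trans _ _ (\int[mu]_(x in Omega) (M * (enorm (f x) * enorm (g x))))).
    apply: le_Rintegral => //; [exact: rintegrable_norm|exact: rintegrableZ|].
    by move=> x Ox; rewrite mulrA; apply: hM; exact: sf.
  rewrite RintegralZl// -mulrA ler_wpM2l//.
  rewrite -ler_sqr ?nnegrE ?mulr_ge0 ?(ph_ge0 phS)//; last first.
    by apply: Rintegral_ge0 => x _; rewrite mulr_ge0 ?sqrtr_ge0.
  rewrite (le_trans (Rintegral_cauchy_schwarz mOmega m1 m2 j1 j2))//.
  rewrite exprMn !(ph_sn phS)//; apply: ler_pM => //.
  + by apply: Rintegral_ge0 => x _; exact: sqr_ge0.
  + by apply: Rintegral_ge0 => x _; exact: sqr_ge0.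
  + by rewrite /L2ip le_eqVlt; apply/orP; left; apply/eqP/eq_Rintegral => x _; rewrite e2.
  + by rewrite /L2ip le_eqVlt; apply/orP; left; apply/eqP/eq_Rintegral => x _; rewrite e2.
Qed.

Lemma compliance_coercive : exists2 c : R, 0 < c &
  forall f : S, dom S f -> c * sn S f ^+ 2 <= compliance_form f f.
Proof.
have [c c0 hc] := inverse_tensor_coercive C_elast CA_inv; exists c => // f df.
rewrite (ph_sn phS)// /L2ip -RintegralZl//; last exact: (L2_rintegrable_sqr mOmega df.1).
apply: le_Rintegral => //.
- by apply: rintegrableZ => //; exact: (L2_rintegrable_sqr mOmega df.1).
- exact: compliance_rintegrable.
- by move=> x Ox; apply: hc; exact: (df.2 x Ox).
Qed.

Lemma compliance_L2ipB (f g h k : S) : dom S f -> dom S g -> dom S h -> dom S k ->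
  L2ip Omega (fun x => A (f x) - g x) (fun x => h x - k x) =
  compliance_form f (h - k) - L2ip Omega g (h - k).
Proof.
move=> df dg dh dk; have dhk := ph_domB phS dh dk.
have i1 := compliance_rintegrable df dhk; have i2 := L2_rintegrable mOmega dg.1 dhk.1.
rewrite /compliance_form /L2ip -RintegralB//.
apply: eq_Rintegral => x _; rewrite [(h - k) x]/(h x - k x).
have := mxdotP (-1) (g x) (A (f x)) (h x - k x).
by rewrite scaleN1r addrC mulN1r addrC => ->; rewrite addrC.
Qed.

End compliance_form.

Section symmetric_part.
Variables (R : realType) (d : nat) (Omega : set 'rV[R]_d).
Hypothesis mOmega : measurable Omega.
Local Notation mu := (@lebesgue_rV R d).

(** [symgrad Omega v] is by definition [symmetric_part] of [v.2]; working with the gradient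
    component stays inside L^2, where an inner product is at hand. *)
Definition symmetric_part (f : L2 Omega d d) : L2sym Omega :=
  fun x => 2^-1 *: (f x + (f x)^T).

Lemma symmetric_partP (a : R) (f g : L2 Omega d d) :
  symmetric_part (a *: f + g) = a *: symmetric_part f + symmetric_part g.
Proof.
apply/funext => x; rewrite /symmetric_part.
rewrite [(a *: f + g) x]/(a *: f x + g x).
rewrite [RHS]/(a *: (2^-1 *: (f x + (f x)^T)) + 2^-1 *: (g x + (g x)^T)).
by apply/matrixP => i k; rewrite !mxE; ring.
Qed.

(** The difference of the two sides is the square of the antisymmetric part. *)
Lemma mxdot_symmetric_part_le (B : 'M[R]_d) :
  mxdot (2^-1 *: (B + B^T)) (2^-1 *: (B + B^T)) <= mxdot B B.
Proof.
have ph := mxdot_prehilbert R d d; have bb := ph_bounded_form ph.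
rewrite (bfZl ph bb)// (bfZr ph bb)// (bfDl ph bb)// !(bfDr ph bb)// mxdotT.
have := sqr_ge0 (enorm (B - B^T)); rewrite enorm_sqr.
rewrite (bfBl ph bb)// !(bfBr ph bb)// mxdotT.
by rewrite (mxdotC B^T B); lra.
Qed.

Lemma symmetric_part_bounded_linear :
  bounded_linear (V := L2 Omega d d) (W := L2sym Omega) symmetric_part.
Proof.
have dS (f : L2 Omega d d) : dom (L2 Omega d d) f -> dom (L2sym Omega) (symmetric_part f).
  move=> df; have [mf _] := df; split; last first.
    by move=> x _; rewrite /symmx/= /symmetric_part linearZ/= linearD/= trmxK addrC.
  have ms : measurable_fun Omega (symmetric_part f).
    apply/measurable_fun_mxP => i k.
    rewrite (_ : (fun x => _) = fun x => 2^-1 * (f x i k + f x k i)); last first.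
      by apply/funext => x; rewrite /symmetric_part !mxE.
    move/measurable_fun_mxP : mf => mf.
    by apply: measurable_funM; [exact: measurable_cst|exact: measurable_funD].
  apply: L2_domI => //; apply: le_rintegrable (L2_rintegrable_sqr mOmega df) => //.
    exact: measurable_mxdot.
  by move=> x _; rewrite ger0_norm ?mxdot_ge0//; exact: mxdot_symmetric_part_le.
split=> //.
- move=> a f g df dg; rewrite symmetric_partP subrr.
  exact: (ph_sn0 (L2sym_prehilbert mOmega)).
- exists 1 => f df; rewrite mul1r ler_sqrt; last first.
    by apply: Rintegral_ge0 => x _; exact: mxdot_ge0.
  apply: le_Rintegral => //.
  + exact: (L2_rintegrable_sqr mOmega (dS f df).1).
  + exact: (L2_rintegrable_sqr mOmega df).
  + by move=> x _; exact: mxdot_symmetric_part_le.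
Qed.

End symmetric_part.

(** Used for the two components of [H1 Omega], a space for which no [prehilbert] is set up; exact
    linearity of [p] makes up for it. *)
Lemma strongly_measurable_proj (R : realType) (V W : snspace R)
    (bW : W -> W -> R) (p : V -> W) (D : set R) (f : R -> V) :
  prehilbert bW ->
  (forall (a : R) x y, p (a *: x + y) = a *: p x + p y) ->
  (forall x, dom V x -> dom W (p x)) ->
  (forall x, sn W (p x) <= sn V x) ->
  strongly_measurable D f -> strongly_measurable D (p \o f).
Proof.
move=> phW lin dp hp [s hs].
have p0 : p 0 = 0.
  have := lin 1 0 0; rewrite !scale1r addr0.
  by move/eqP; rewrite addrC -subr_eq subrr eq_sym => /eqP.
pose r k : simple_fun W := @SimpleFun R W (sf_card (s k)) (@sf_set R V (s k))
  (fun i => p (@sf_val R V (s k) i)) (@sf_meas R V (s k))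
  (fun i => dp _ (@sf_dom R V (s k) i)).
have rE k t : sf_eval (r k) t = p (sf_eval (s k) t).
  rewrite /sf_eval /=; elim/big_rec2 : _ => [|i x y _ ->]; first by rewrite p0.
  by rewrite lin.
exists r => t Dt; apply: squeeze0 (hs t Dt) => k.
rewrite ger0_norm ?(ph_ge0 phW)// rE.
have -> : p (sf_eval (s k) t) - (p \o f) t = p (sf_eval (s k) t - f t).
  by have := lin (-1) (f t) (sf_eval (s k) t); rewrite !scaleN1r addrC => ->; rewrite addrC.
exact: hp.
Qed.

(** * The state equation *)

Lemma bounded_linear_functional (R : realType) (V : snspace R) (b : V -> V -> R)
    (phi : V -> R) : prehilbert b ->
  @bounded_linear R V (normed_snspace R^o) phi -> exists M, bounded_functional phi M.
Proof.
move=> phV [_ lin [C hC]]; exists `|C|; split=> // [a x y dx dy|x dx].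
  by apply/eqP; rewrite -subr_eq0 -normr_eq0; apply/eqP; exact: (lin a x y dx dy).
by rewrite (le_trans (hC x dx))// ler_wpM2r ?(ph_ge0 phV)// ler_norm.
Qed.

Lemma functional_bounded_linear (R : realType) (V : snspace R) (phi : V -> R) M :
  bounded_functional phi M -> @bounded_linear R V (normed_snspace R^o) phi.
Proof.
move=> bphi; split=> //.
- by move=> a x y dx dy; rewrite /= (bl_lin bphi)// subrr normr0.
- by exists M => x dx; exact: (bl_le bphi).
Qed.

Section state_equation.
Variables (R : realType) (d : nat) (T : R) (Omega : set 'rV[R]_d).
Hypotheses (T0 : 0 < T) (mOmega : measurable Omega).
Local Notation mu := (@lebesgue_measure R).
Local Notation D := (`[0, T]%classic : set R).
Local Notation S := (L2sym Omega).
Local Notation bS := (@L2ip R d Omega d d).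
Let phS := L2sym_prehilbert mOmega.
Let phLdd := @L2_prehilbert R d Omega mOmega d d.
Let phL1d := @L2_prehilbert R d Omega mOmega 1 d.

Lemma H1_sn_fst (v : H1 Omega) : sn (L2 Omega 1 d) v.1 <= sn (H1 Omega) v.
Proof.
rewrite -ler_sqr ?nnegrE ?sqrtr_ge0// [leRHS]sqr_sqrtr ?addr_ge0 ?sqr_ge0//.
by rewrite lerDl sqr_ge0.
Qed.

Lemma H1_sn_snd (v : H1 Omega) : sn (L2 Omega d d) v.2 <= sn (H1 Omega) v.
Proof.
rewrite -ler_sqr ?nnegrE ?sqrtr_ge0// [leRHS]sqr_sqrtr ?addr_ge0 ?sqr_ge0//.
by rewrite lerDr sqr_ge0.
Qed.

Lemma symgrad_L2T (w : L2T (H1 Omega) T) : dom (L2T (H1 Omega) T) w ->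
  dom (L2T S T) (fun t => symgrad Omega (w t)).
Proof.
move=> [dw mw woo].
(* The first component enters because measurability of the full seminorm of [w] is derived from both
   components. *)
have m1 : strongly_measurable D (fst \o w : R -> L2 Omega 1 d).
  apply: (strongly_measurable_proj phL1d _ _ _ mw) => //; first by move=> x [].
  exact: H1_sn_fst.
have m2 : strongly_measurable D (snd \o w : R -> L2 Omega d d).
  apply: (strongly_measurable_proj phLdd _ _ _ mw) => //; first by move=> x [].
  exact: H1_sn_snd.
have d1 t : D t -> dom (L2 Omega 1 d) (w t).1 by move=> /dw[].
have d2 t : D t -> dom (L2 Omega d d) (w t).2 by move=> /dw[].
have mD : measurable (D : set (measurableTypeR R)) by exact: measurable_itv.
have e1 := measurable_funX 2 (measurable_sn phL1d d1 m1).
have e2 := measurable_funX 2 (measurable_sn phLdd d2 m2).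
have wi : rintegrable mu D (fun t => sn (H1 Omega) (w t) ^+ 2).
  apply: rintegrable_fin => //; last by move=> t _; exact: sqr_ge0.
  apply: (eq_measurable_fun (fun t => sn (L2 Omega 1 d) (w t).1 ^+ 2 +
    sn (L2 Omega d d) (w t).2 ^+ 2)); last exact: measurable_funD.
  by move=> t _; rewrite [RHS]sqr_sqrtr// addr_ge0 ?sqr_ge0.
have dw2 : dom (L2T (L2 Omega d d) T) (snd \o w).
  apply: L2T_domI => //; apply: le_rintegrable wi => // t Dt.
  rewrite ger0_norm ?sqr_ge0// ler_sqr ?nnegrE ?sqrtr_ge0//; exact: H1_sn_snd.
exact: (L2T_map phLdd phS (symmetric_part_bounded_linear mOmega) dw2).
Qed.

Section control.
Variables (Xc X : completeNormedModType R) (ip : {dot Xc for idfun}).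
Hypothesis Xc_hilbert : forall x : Xc, `|x| ^+ 2 = ip x x.
Variables (j : {linear Xc -> X}) (G : X -> H1 Omega).
Hypotheses (j_compact : compact (closure (j @` [set x | `|x| <= 1])))
  (G_lin : @bounded_linear R (normed_snspace X) (H1 Omega) G).
Local Notation NXc := (normed_snspace Xc).
Let phX := hilbert_prehilbert Xc_hilbert.

Definition control_strain (x : NXc) : S := symgrad Omega (G (j x)).

Lemma symgrad_sn (v : H1 Omega) : dom (L2 Omega d d) v.2 ->
  sn S (symgrad Omega v) <= sn (L2 Omega d d) v.2.
Proof.
move=> dv; rewrite ler_sqrt; last by apply: Rintegral_ge0 => x _; exact: mxdot_ge0.
have [dS _ _] := symmetric_part_bounded_linear mOmega.
apply: le_Rintegral => //.
- exact: (L2_rintegrable_sqr mOmega (dS _ dv).1).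
- exact: (L2_rintegrable_sqr mOmega dv).
- by move=> x _; exact: mxdot_symmetric_part_le.
Qed.

Lemma control_strain_le : exists2 C : R, 0 <= C &
  forall x, sn S (control_strain x) <= C * `|j x|.
Proof.
have [dG _ [C hC]] := G_lin; exists `|C| => // x.
have [_ dGx _] := dG (j x) I.
rewrite (le_trans (symgrad_sn dGx))// (le_trans (H1_sn_snd _))//.
apply: le_trans (hC (j x) I) _.
by apply: ler_wpM2r; [exact: normr_ge0|exact: ler_norm].
Qed.

Lemma control_strain_bounded_linear : bounded_linear (V := NXc) (W := S) control_strain.
Proof.
have [dG linG _] := G_lin; have [dS _ _] := symmetric_part_bounded_linear mOmega.
split.
- by move=> x _; have [_ dGx _] := dG (j x) I; exact: (dS _ dGx).
- move=> a x y _ _; apply/eqP; rewrite eq_le (ph_ge0 phS) andbT.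
  (* [G] is linear up to the seminorm of [H1 Omega]; the defect of [control_strain] is the symmetric
     gradient of that null element. *)
  have := linG a (j x) (j y) I I; rewrite -linearP.
  set g := G _ - _ => g0.
  have -> : control_strain (a *: x + y) - (a *: control_strain x + control_strain y) =
      symgrad Omega g.
    have := symmetric_partP (-1) (a *: (G (j x)).2 + (G (j y)).2) (G (j (a *: x + y))).2.
    rewrite !scaleN1r symmetric_partP addrC [in RHS]addrC => E.
    exact: esym E.
  rewrite -g0 (le_trans _ (H1_sn_snd _))// symgrad_sn//.
  have [_ d1 _] := dG (j (a *: x + y)) I.
  have [_ d2 _] := dG (j x) I; have [_ d3 _] := dG (j y) I.
  by apply: (ph_domB phLdd) => //; apply: (ph_domP phLdd).
- have [C C0 hC] := control_strain_le; have [K K0 hK] := compact_operator_bounded j_compact.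
  exists (C * K) => x _.
  by rewrite (le_trans (hC x))// -mulrA ler_wpM2l.
Qed.

Variables (C A : 'M[R]_d -> 'M[R]_d) (GammaD : set 'rV[R]_d) (K : set 'M[R]_d).
Hypotheses (C_elast : elasticity_tensor C) (CA_inv : inverse_tensor C A).
Variables (sigma0 : S) (a : H1T (H1 Omega) T).
Hypotheses (sigma0_E : equilibrium_stresses GammaD sigma0)
  (a_dom : dom (H1T (H1 Omega) T) a).
Variable Sol : H10T NXc T -> H1T S T.
Hypothesis Sol_sol : forall l, dom (H10T NXc T) l ->
  reduced_solution GammaD A K sigma0
    (@lift_time R NXc (H1 Omega) T (G \o j) l + a) (Sol l).

Local Notation EK := (equilibrium_stresses GammaD `&` admissible_stresses K).
Local Notation bA := (@compliance_form R d Omega A).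

(** The symmetric gradient of the time derivative of the Dirichlet data, split so that the part from
    [a] cancels in differences and the part from the control is the image of a bounded linear
    map. *)
Definition strain_rate (l : H10T NXc T) : R -> S :=
  (control_strain \o l.2) + (fun t => symgrad Omega (a.2 t)).

Lemma Sol_evi l : dom (H10T NXc T) l ->
  @evolution_inequality R S bS T bA EK (strain_rate l) (Sol l).1 (Sol l).2.
Proof.
move=> dl; have [dSol _ hae] := Sol_sol dl.
have [dl' _ _] := H10T_primitive phX dl.
have df : dom (L2T S T) (strain_rate l).
  apply: (ph_domD (L2T_prehilbert T phS)).
    exact: (L2T_map phX phS control_strain_bounded_linear dl').
  by case: a_dom => da _ _; exact: (symgrad_L2T da).
have pS := H1T_primitive phS dSol; split=> //.
have aeF := ae_filter_ringOfSetsType mu.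
apply: filterS hae => t ht Dt'; have [EKt {}ht] := ht Dt'; split=> // tau EKtau dtau.
have Dt : D t by move: Dt'; apply: subset_itv_oo_cc.
have [dSol' dSol1 _] := pS.
have E : symgrad Omega (G (j (l.2 t)) + a.2 t) = strain_rate l t.
  have := symmetric_partP 1 (G (j (l.2 t))).2 (a.2 t).2; rewrite !scale1r; exact.
have h : 0 <= L2ip Omega
    (fun x => A ((Sol l).2 t x) - symgrad Omega (G (j (l.2 t)) + a.2 t) x)
    (fun x => tau x - (Sol l).1 t x) by exact: (ht _ EKtau).
rewrite E in h.
by rewrite -(compliance_L2ipB mOmega C_elast CA_inv (L2T_dom dSol' Dt)
  (L2T_dom df Dt) dtau (dSol1 _ Dt)).
Qed.

Lemma Sol_dom l : dom (H10T NXc T) l -> dom (H1T S T) (Sol l).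
Proof. by case/Sol_sol. Qed.

Lemma Sol_init l1 l2 : dom (H10T NXc T) l1 -> dom (H10T NXc T) l2 ->
  sn S ((Sol l1).1 0 - (Sol l2).1 0) = 0.
Proof.
move=> /Sol_sol[[_ d1 _] i1 _] /Sol_sol[[_ d2 _] i2 _].
have D0 : D 0 by rewrite /= in_itv/= lexx ltW.
have ds : dom S sigma0 by case: sigma0_E.
apply/eqP; rewrite eq_le (ph_ge0 phS) andbT.
rewrite (le_trans (ph_snB3 phS (d1 _ D0) ds (d2 _ D0)))// i1 add0r.
by rewrite (ph_snBC phS ds (d2 _ D0)) i2.
Qed.

Section convergence.
Variables (l_ : nat -> H10T NXc T) (l : H10T NXc T) (B : R).
Hypotheses (dl_ : forall k, dom (H10T NXc T) (l_ k)) (dl : dom (H10T NXc T) l)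
  (lB : forall k, sn (H10T NXc T) (l_ k - l) <= B)
  (l0 : forall t, D t -> (fun k => `|j ((l_ k - l).1 t)|) @ \oo --> (0 : R)).

Let phH := H10T_prehilbert phX T0.
(** The explicit primitive of the difference of strain rates; through [control_strain] it sees the
    controls only after the compact map [j]. *)
Let E_ k : R -> S := (control_strain \o (l_ k).1) - (control_strain \o l.1).

Lemma strain_rateB k : strain_rate (l_ k) - strain_rate l =
  (control_strain \o (l_ k).2) - (control_strain \o l.2).
Proof. by rewrite /strain_rate opprD addrACA subrr addr0. Qed.

Let pE k : primitive T (E_ k) (strain_rate (l_ k) - strain_rate l).
Proof.
rewrite strain_rateB; apply: (primitiveB phS).
  exact: (primitive_map phX phS control_strain_bounded_linear (H10T_primitive phX (dl_ k))).
exact: (primitive_map phX phS control_strain_bounded_linear (H10T_primitive phX dl)).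
Qed.

Lemma strain_rate_dist : exists2 C : R, 0 <= C & forall k,
  sn (L2T S T) (strain_rate (l_ k) - strain_rate l) <= C * sn (H10T NXc T) (l_ k - l).
Proof.
have [M M0 hM] := bounded_linear_dist phX phS control_strain_bounded_linear.
exists M => // k; rewrite strain_rateB.
have [d1 _ _] := H10T_primitive phX (dl_ k); have [d2 _ _] := H10T_primitive phX dl.
have h := L2T_map_dist phX phS control_strain_bounded_linear M0 hM d1 d2.
rewrite (le_trans h)// ler_wpM2l//; exact: (H1T_sn_der (l_ k - l)).
Qed.

Let E0 t : D t -> (fun k => sn S (E_ k t)) @ \oo --> (0 : R).
Proof.
move=> Dt; have [M M0 hM] := control_strain_le.
apply: (squeeze0 (v := fun k => M * `|j ((l_ k - l).1 t)|)) => [k|].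
  rewrite ger0_norm ?(ph_ge0 phS)// (le_trans _ (hM _))//.
  exact: (bounded_linear_sub phX phS control_strain_bounded_linear I I).
by rewrite -[X in _ --> X](mulr0 M); apply: cvgMr; exact: l0.
Qed.

Let bounds : exists B', (forall k, sn (L2T S T) (strain_rate (l_ k) - strain_rate l) <= B') /\
  forall k t, D t -> sn S (E_ k t) <= B'.
Proof.
have [M M0 hM] := bounded_linear_dist phX phS control_strain_bounded_linear.
have [M' M'0 hM'] := strain_rate_dist.
have B0 : 0 <= B by rewrite (le_trans _ (lB 0%N)) ?(ph_ge0 phH).
have sT : 0 <= Num.sqrt T by exact: sqrtr_ge0.
exists (M' * B + M * (Num.sqrt T * B)); split=> [k|k t Dt].
  rewrite (le_trans (hM' k))// (le_trans (ler_wpM2l M'0 (lB k)))// lerDl.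
  by rewrite !mulr_ge0.
rewrite (le_trans (hM _ _ I I))// (@le_trans _ _ (M * (Num.sqrt T * B)))//; last first.
  by rewrite lerDr mulr_ge0.
rewrite ler_wpM2l//.
have := H10T_eval_bound phX T0 (ph_domB phH (dl_ k) dl) Dt => h.
by rewrite (le_trans h)// ler_wpM2l.
Qed.

Let phT := L2T_prehilbert T phS.
Let phHS := H1T_prehilbert phS T0.
Let dw k := ph_domB phHS (Sol_dom (dl_ k)) (Sol_dom dl).

Lemma Sol_L2T_cvg :
  (fun k => sn (L2T S T) ((Sol (l_ k)).1 - (Sol l).1)) @ \oo --> (0 : R).
Proof.
have [M bbA] := compliance_bounded_form mOmega C_elast CA_inv.
have [c c0 coer] := compliance_coercive mOmega C_elast CA_inv.
have [B' [fB EB]] := bounds.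
apply: (evi_L2T_cvg phS T0 bbA (compliance_sym C_elast CA_inv) c0 coer
  (Sol_evi dl) (fun k => Sol_evi (dl_ k)) (fun k => Sol_init (dl_ k) dl) pE fB EB E0).
Qed.

Lemma Sol_derivative_bounded : exists B', forall k,
  sn (L2T S T) ((Sol (l_ k)).2 - (Sol l).2) <= B'.
Proof.
have [M bbA] := compliance_bounded_form mOmega C_elast CA_inv.
have [c c0 coer] := compliance_coercive mOmega C_elast CA_inv.
have [B' [fB EB]] := bounds.
exact: (evi_derivative_bounded phS T0 bbA c0 coer
  (Sol_evi dl) (fun k => Sol_evi (dl_ k)) fB).
Qed.

(** A functional on H^1 in time is approximated by inner products, which split into a part with the
    functions, converging strongly, and a part with the derivatives, converging weakly. *)
Lemma Sol_weak_cvg : weak_cvg (fun k => Sol (l_ k)) (Sol l).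
Proof.
move=> phi /(bounded_linear_functional phHS)[N bphi].
have [M bbA] := compliance_bounded_form mOmega C_elast CA_inv.
have [c c0 coer] := compliance_coercive mOmega C_elast CA_inv.
have [B1 [fB EB]] := bounds.
have [B2 hB2] := Sol_derivative_bounded.
have cv := Sol_L2T_cvg.
have /cvg_seq_bounded[B3 [_ hB3]] : cvgn (fun k => sn (L2T S T) ((Sol (l_ k)).1 - (Sol l).1)).
  by apply/cvg_ex; eexists; exact: cv.
have {}hB3 k : sn (L2T S T) ((Sol (l_ k)).1 - (Sol l).1) <= B3 + 1.
  by rewrite (le_trans (ler_norm _))// hB3// ltrDl.
apply/cvg_sub0P.
rewrite (_ : (fun k => _) = fun k => phi (Sol (l_ k) - Sol l)); last first.
  apply/funext => k; rewrite (blB phHS bphi)//; exact: Sol_dom.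
apply: (weakly_null_prehilbert phHS dw (B := B3 + 1 + B2) _ _ bphi) => [k|e de].
  exact: (H1T_sn_le (u := Sol (l_ k) - Sol l) (hB3 k) (hB2 k)).
rewrite -[X in _ --> X](addr0 0); apply: cvgD.
  apply: (squeeze0 (v := fun k =>
    sn (L2T S T) ((Sol (l_ k)).1 - (Sol l).1) * sn (L2T S T) e.1)) => [k|].
    exact: (ph_cauchy_schwarz phT (H1T_L2T phS T0 (dw k)) (H1T_L2T phS T0 de)).
  by rewrite -[X in _ --> X](mul0r (sn (L2T S T) e.1)); apply: cvgMl.
have wd := evi_weak_derivative phS T0 bbA (compliance_sym C_elast CA_inv) c0 coer
  (Sol_evi dl) (fun k => Sol_evi (dl_ k)) (fun k => Sol_init (dl_ k) dl) pE fB EB E0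
  (ph_bounded_form phS) (H1T_L2T_der de).
rewrite (_ : (fun k => _) = fun k => @formT R S T bS e.2 ((Sol (l_ k)).2 - (Sol l).2)).
  exact: wd.
apply/funext => k.
exact: (ph_sym phT (H1T_L2T_der (dw k)) (H1T_L2T_der de)).
Qed.

Lemma Sol_strong_cvg : strong_cvg l_ l -> strong_cvg (fun k => Sol (l_ k)) (Sol l).
Proof.
move=> ll; have [M bbA] := compliance_bounded_form mOmega C_elast CA_inv.
have [c c0 coer] := compliance_coercive mOmega C_elast CA_inv.
have [B1 [fB EB]] := bounds; have [M' M'0 hM'] := strain_rate_dist.
have f0 : (fun k => sn (L2T S T) (strain_rate (l_ k) - strain_rate l)) @ \oo --> (0 : R).
  apply: (squeeze0 (v := fun k => M' * sn (H10T NXc T) (l_ k - l))) => [k|].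
    by rewrite ger0_norm ?hM'// (ph_ge0 phT).
  by rewrite -[X in _ --> X](mulr0 M'); apply: cvgMr.
have d0 := evi_strong_derivative phS T0 bbA (compliance_sym C_elast CA_inv) c0 coer
  (Sol_evi dl) (fun k => Sol_evi (dl_ k)) (fun k => Sol_init (dl_ k) dl) pE fB EB E0 f0.
have cv := Sol_L2T_cvg.
suff h : (fun k => sn (L2T S T) ((Sol (l_ k)).1 - (Sol l).1) ^+ 2 +
    sn (L2T S T) ((Sol (l_ k)).2 - (Sol l).2) ^+ 2) @ \oo --> (0 : R).
  exact: sqrt_cvg0 h.
by have := cvgD (sqr_cvg0 cv) (sqr_cvg0 d0); rewrite addr0; exact.
Qed.

End convergence.

(** Pairing the value at time t with a fixed [h] is a bounded functional on the control space, so
    the values at t tend weakly to 0, boundedly, and [j] makes this convergence strong. *)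
Lemma weak_control_cvg (l_ : nat -> H10T NXc T) (l : H10T NXc T) :
  (forall k, dom (H10T NXc T) (l_ k)) -> dom (H10T NXc T) l -> weak_cvg l_ l ->
  (exists B, forall k, sn (H10T NXc T) (l_ k - l) <= B) /\
  forall t, D t -> (fun k => `|j ((l_ k - l).1 t)|) @ \oo --> (0 : R).
Proof.
move=> dl_ dl wl; have phH := H10T_prehilbert phX T0.
have dll k := ph_domB phH (dl_ k) dl.
have w0 phi M : bounded_functional phi M ->
    (fun k => phi (l_ k - l)) @ \oo --> (0 : R).
  move=> bphi; have /cvg_sub0P := wl _ (functional_bounded_linear bphi).
  by under eq_fun do rewrite -(blB phH bphi (dl_ _) dl).
have [B hB] : exists B, forall k, sn (H10T NXc T) (l_ k - l) <= B.
  apply: (uniform_boundedness phH dll) => phi M bphi.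
  have /cvg_seq_bounded[B [_ hB]] : cvgn (fun k => phi (l_ k - l)).
    by apply/cvg_ex; eexists; exact: (w0 _ _ bphi).
  by exists (B + 1) => k; apply: hB; rewrite // ltrDl.
split; first by exists B.
move=> t Dt.
apply: (compact_operator_weak_strong Xc_hilbert j_compact (B := Num.sqrt T * B)) => [k|h].
  rewrite (le_trans (H10T_eval_bound phX T0 (dll k) Dt))//.
  by rewrite ler_wpM2l ?sqrtr_ge0.
apply: (w0 (fun u : H10T NXc T => ip (u.1 t) h) (Num.sqrt T * `|h|)); split.
- by move=> c x y _ _; exact: (ph_lin phX).
- by rewrite mulr_ge0 ?sqrtr_ge0.
- move=> x dx; rewrite (le_trans (ph_cauchy_schwarz phX (x := x.1 t) (y := h) I I))//.
  rewrite mulrAC ler_wpM2r ?(ph_ge0 phX)//; exact: (H10T_eval_bound phX T0 dx Dt).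
Qed.

Lemma strong_control_cvg (l_ : nat -> H10T NXc T) (l : H10T NXc T) :
  (forall k, dom (H10T NXc T) (l_ k)) -> dom (H10T NXc T) l -> strong_cvg l_ l ->
  (exists B, forall k, sn (H10T NXc T) (l_ k - l) <= B) /\
  forall t, D t -> (fun k => `|j ((l_ k - l).1 t)|) @ \oo --> (0 : R).
Proof.
move=> dl_ dl sl; have phH := H10T_prehilbert phX T0.
have dll k := ph_domB phH (dl_ k) dl; split.
  have /cvg_seq_bounded[B [_ hB]] : cvgn (fun k => sn (H10T NXc T) (l_ k - l)).
    by apply/cvg_ex; eexists; exact: sl.
  by exists (B + 1) => k; rewrite (le_trans (ler_norm _))// hB// ltrDl.
move=> t Dt; have [M M0 hM] := compact_operator_bounded j_compact.
apply: (squeeze0 (v := fun k => M * (Num.sqrt T * sn (H10T NXc T) (l_ k - l)))) => [k|].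
  rewrite normr_id (le_trans (hM _))// ler_wpM2l//.
  exact: (H10T_eval_bound phX T0 (dll k) Dt).
rewrite -[X in _ --> X](mulr0 M); apply: cvgMr.
by rewrite -[X in _ --> X](mulr0 (Num.sqrt T)); apply: cvgMr.
Qed.

End control.

End state_equation.

(* The space dimension is d = n + 2 >= 2. *)
Theorem corollary4p3 (R : realType) (n : nat) (T : R) (hT : 0 < T)
  (Omega GammaN GammaD : set 'rV[R]_n.+2)
  (Omega_open : open Omega) (Omega_conn : connected Omega)
  (Omega_neq0 : Omega !=set0) (Omega_bounded : bounded_set Omega)
  (Omega_lip : lipschitz_boundary Omega)
  (Gamma_cover : GammaN `|` GammaD = boundary Omega)
  (Gamma_disj : GammaN `&` GammaD = set0)
  (GammaN_open : exists2 O, open O & GammaN = boundary Omega `&` O)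
  (GammaD_closed : exists2 F, closed F & GammaD = boundary Omega `&` F)
  (GammaD_pos : (0 < hausdorff_measure n.+1 GammaD)%E)
  (Omega_groeger : groeger_regular Omega GammaN)
  (C A : 'M[R]_n.+2 -> 'M[R]_n.+2)
  (C_elast : elasticity_tensor C) (CA_inv : inverse_tensor C A)
  (K : set 'M[R]_n.+2) (K_sym : K `<=` @symmx R n.+2)
  (K_closed : closed K)
  (K_convex : convex_set (K : set (convex_lmodType 'M[R]_n.+2)))
  (sigma0 : L2sym Omega)
  (sigma0_E : equilibrium_stresses GammaD sigma0)
  (sigma0_K : admissible_stresses K sigma0)
  (pbar : R) (hpbar : 2 < pbar)
  (sigma0_Lp : (\int[@lebesgue_rV R n.+2]_(x in Omega)
                  (enorm (sigma0 x) `^ pbar)%:E < +oo)%E)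
  (X : completeNormedModType R)
  (Xc : completeNormedModType R) (ip : {dot Xc for idfun})
  (Xc_hilbert : forall x : Xc, `|x| ^+ 2 = ip x x)
  (j : {linear Xc -> X}) (j_inj : injective j)
  (j_compact : compact (closure (j @` [set x | `|x| <= 1])))
  (G : X -> H1 Omega)
  (G_lin : @bounded_linear R (normed_snspace X) (H1 Omega) G)
  (a : H1T (H1 Omega) T) (a_dom : dom (H1T (H1 Omega) T) a)
  (Sol : H10T (normed_snspace Xc) T -> H1T (L2sym Omega) T)
  (Sol_sol : forall l, dom (H10T (normed_snspace Xc) T) l ->
     reduced_solution GammaD A K sigma0
       (@lift_time R (normed_snspace Xc) (H1 Omega) T (G \o j) l + a) (Sol l)) :
  (forall (l_ : nat -> H10T (normed_snspace Xc) T)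
          (l : H10T (normed_snspace Xc) T),
     (forall k, dom (H10T (normed_snspace Xc) T) (l_ k)) ->
     dom (H10T (normed_snspace Xc) T) l ->
     weak_cvg l_ l -> weak_cvg (fun k => Sol (l_ k)) (Sol l)) /\
  (forall (l_ : nat -> H10T (normed_snspace Xc) T)
          (l : H10T (normed_snspace Xc) T),
     (forall k, dom (H10T (normed_snspace Xc) T) (l_ k)) ->
     dom (H10T (normed_snspace Xc) T) l ->
     strong_cvg l_ l -> strong_cvg (fun k => Sol (l_ k)) (Sol l)).
Proof.
have mOmega := open_measurable_mx Omega_open.
split=> l_ l dl_ dl ll.
- have [[B lB] l0] := weak_control_cvg hT Xc_hilbert j_compact dl_ dl ll.
  exact: (Sol_weak_cvg hT mOmega Xc_hilbert j_compact G_lin C_elast CA_inv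
    sigma0_E a_dom Sol_sol dl_ dl lB l0).
- have [[B lB] l0] := strong_control_cvg hT Xc_hilbert j_compact dl_ dl ll.
  exact: (Sol_strong_cvg hT mOmega Xc_hilbert j_compact G_lin C_elast CA_inv
    sigma0_E a_dom Sol_sol dl_ dl lB l0 ll).
Qed.
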